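(* Let $(W,S)$ be a Coxeter system with $W$ finite, $L$ a weight function on $W$ with $L(s)>0$ for all $s\in S$, and assume that (P1)--(P15) hold for $W,L$. Let $\boldsymbol c$ be a two-sided cell of $W$ and let $R\subseteq\mathbb{C}(v)$ be a $\boldsymbol c$-adapted subring. Let $J_R=R\otimes_{\mathbb{Z}}J$. Then the following hold. (a) Let $d\in\mathcal D\cap\boldsymbol c$. Then $n_dt_d$ is a primitive idempotent in $J_R$. (b) $t_{\boldsymbol c}=\sum_{d\in\mathcal D\cap\boldsymbol c}n_dt_d$ is a primitive idempotent in the center of $J_R$.
   Context: **Hecke algebra.** $l$ is the length function of $(W,S)$. A weight function is a map $L\colon W\to\mathbb{Z}$ with $L(ww')=L(w)+L(w')$ whenever $l(ww')=l(w)+l(w')$. Let $A=\mathbb{Z}[v,v^{-1}]$, $v$ an indeterminate, and $v_w=v^{L(w)}$. $H$ is the $A$-algebra with $A$-basis $\{T_w\mid w\in W\}$ and $T_sT_w=T_{sw}$ if $l(sw)=l(w)+1$, $T_sT_w=T_{sw}+(v_s-v_s^{-1})T_w$ if $l(sw)=l(w)-1$ ($s\in S$, $w\in W$). The bar involution is the ring involution of $H$ with $\bar v=v^{-1}$, $\overline{T_w}=T_{w^{-1}}^{-1}$. $\{c_w\}$ is the unique $A$-basis with $\overline{c_w}=c_w$ and $c_w=T_w+\sum_{y<w}p_{y,w}T_y$, $p_{y,w}\in v^{-1}\mathbb{Z}[v^{-1}]$ ($<$ the Bruhat--Chevalley order). Write $c_xc_y=\sum_z h_{x,y,z}c_z$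 with $h_{x,y,z}\in A$. Let $h\mapsto h^\dagger$ be the $A$-algebra involution of $H$ with $T_s^\dagger=-T_s^{-1}$ for $s\in S$. **Cells.** $\leq_{\mathcal L}$ is the reflexive-transitive closure of the relation ''$h_{s,w,y}\neq 0$ for some $s\in S$'' (giving $y\leq_{\mathcal L}w$); $y\leq_{\mathcal R}w$ means $y^{-1}\leq_{\mathcal L}w^{-1}$; $\leq_{\mathcal{LR}}$ is the preorder generated by $\leq_{\mathcal L}$ and $\leq_{\mathcal R}$. The associated equivalence relations $\sim_{\mathcal L},\sim_{\mathcal R},\sim_{\mathcal{LR}}$ have as classes the left, right and two-sided cells. **Properties (P1)--(P15).** For $z\in W$, $\mathbf a(z)\geq 0$ is the integer with $h_{x,y,z}\in v^{\mathbf a(z)}\mathbb{Z}[v^{-1}]$ for all $x,y$ and $h_{x,y,z}\notin v^{\mathbf a(z)-1}\mathbb{Z}[v^{-1}]$ for some $x,y$. $\gamma_{x,y,z^{-1}}\in\mathbb{Z}$ is the coefficient of $v^{\mathbf a(z)}$ in $h_{x,y,z}$. $\Delta(z)\geq 0$ and $0\ne n_z\in\mathbb{Z}$ are defined by $p_{1,z}=n_zv^{-\Delta(z)}+$ strictly smaller powers of $v$ (with $p_{1,1}=1$). $\mathcal D=\{z\in W\mid \mathbf a(z)=\Delta(z)\}$. The properties are: (P1) $\mathbf a(z)\leq\Delta(z)$ for all $z$. (P2) If $d\in\mathcal D$ and $\gamma_{x,y,d}\neq0$ then $x=y^{-1}$. (P3) For each $y$ there is a unique $d\in\mathcal D$ with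 $\gamma_{y^{-1},y,d}\neq 0$. (P4) $z'\leq_{\mathcal{LR}}z$ implies $\mathbf a(z')\geq\mathbf a(z)$. (P5) If $d\in\mathcal D$ and $\gamma_{y^{-1},y,d}\neq0$ then $\gamma_{y^{-1},y,d}=n_d=\pm1$. (P6) $d^2=1$ for $d\in\mathcal D$. (P7) $\gamma_{x,y,z}=\gamma_{y,z,x}$. (P8) If $\gamma_{x,y,z}\neq0$ then $x\sim_{\mathcal L}y^{-1}$, $y\sim_{\mathcal L}z^{-1}$, $z\sim_{\mathcal L}x^{-1}$. (P9) $z'\leq_{\mathcal L}z$ and $\mathbf a(z')=\mathbf a(z)$ imply $z'\sim_{\mathcal L}z$. (P10) Same as (P9) with $\mathcal R$ in place of $\mathcal L$. (P11) Same as (P9) with $\mathcal{LR}$ in place of $\mathcal L$. (P12) For $I\subset S$ and $y\in W_I=\langle I\rangle$, $\mathbf a(y)$ computed in $W_I$ (with $L|_{W_I}$) equals $\mathbf a(y)$ computed in $W$. (P13) Every left cell $\Gamma$ contains a unique $d\in\mathcal D$, and $\gamma_{x^{-1},x,d}\neq0$ for all $x\in\Gamma$. (P14) $z\sim_{\mathcal{LR}}z^{-1}$ for all $z$. (P15) Let $v'$ be a second indeterminate and $h'_{x,y,z}$ be obtained from $h_{x,y,z}$ by $v\mapsto v'$. If $\mathbf a(w)=\mathbf a(y)$ then $\sum_{y'}h'_{w,x',y'}h_{x,y',y}=\sum_{y'}h_{x,w,y'}h'_{y',x',y}$ for all $x,x'\in W$. **The ring $J$.** $J$ is the free $\mathbb{Z}$-module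 with basis $\{t_w\mid w\in W\}$ and multiplication $t_xt_y=\sum_{z}\gamma_{x,y,z}t_{z^{-1}}$; it is (given (P1)--(P15)) an associative ring with identity $1_J=\sum_{d\in\mathcal D}n_dt_d$. There is an $A$-algebra homomorphism $\phi\colon H\to A\otimes_{\mathbb{Z}}J$, $\phi(c_w^\dagger)=\sum_{z\in W,\,d\in\mathcal D,\,\mathbf a(z)=\mathbf a(d)}h_{w,d,z}\hat n_z t_z$, where $\hat n_z=n_d$ for the unique $d\in\mathcal D$ with $d\sim_{\mathcal L}z^{-1}$. Specializing $v\mapsto1$ and extending scalars gives a $\mathbb{C}$-algebra isomorphism $\phi_1\colon\mathbb{C}[W]\to J_{\mathbb{C}}=\mathbb{C}\otimes_{\mathbb{Z}}J$. For a $\mathbb{C}[W]$-module $E$, $E_\spadesuit$ denotes $E$ regarded as a $J_{\mathbb{C}}$-module via $\phi_1^{-1}$. **The numbers $f_E$.** $\mathrm{Irr}(W)$ is the set of simple $\mathbb{C}[W]$-modules up to isomorphism. Let $K=\mathbb{C}(v)$, $H_K=K\otimes_AH$ (split semisimple). There is a bijection $E\mapsto E_v$ from $\mathrm{Irr}(W)$ to the simple $H_K$-modules, characterized by $\mathrm{tr}(T_w,E_v)\in\mathbb{C}[v,v^{-1}]$ and $\mathrm{tr}(w,E)=\mathrm{tr}(T_w,E_v)|_{v=1}$ for all $w$. $\mathbf a_E\geq0$ is the integer such that $v^{\mathbf a_E}\mathrm{tr}(T_w,E_v)\in\mathbb{C}[v]$ for all $w$ and $v^{\mathbf a_E-1}\mathrm{tr}(T_w,E_v)\notin\mathbb{C}[v]$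 for some $w$. Put $c_E=\frac1{\dim E}\sum_{w}\mathrm{tr}(T_w,E_v)\mathrm{tr}(T_{w^{-1}},E_v)$. Then $c_E=f_Ev^{-2\mathbf a_E}+$ combination of higher powers of $v$, where $f_E$ is a positive real number; this defines $f_E$. Equivalently, the linear form $\tau$ on $J_{\mathbb{C}}$ with $\tau(t_z)=n_z$ for $z\in\mathcal D$ and $\tau(t_z)=0$ otherwise satisfies $\tau(t_w)=\sum_{E}\frac1{f_E}\mathrm{tr}(t_w,E_\spadesuit)$ for all $w$. **$\boldsymbol c$-adapted rings.** For a two-sided cell $\boldsymbol c$, $\mathrm{Irr}(W,\boldsymbol c)=\{E\in\mathrm{Irr}(W)\mid t_{\boldsymbol c}E_\spadesuit\neq0\}$. A noetherian subring $R\subseteq\mathbb{C}(v)$ is called $\boldsymbol c$-adapted if $R\cap\bigl\{\sum_{E\in\mathrm{Irr}(W,\boldsymbol c)}\frac{n_E}{f_E}\mid n_E\in\mathbb{Z}\bigr\}\subseteq\mathbb{Z}$. *)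

(* Defs.v *)
From HB Require Import structures.
From mathcomp Require Import all_boot all_order all_algebra all_fingroup.
From mathcomp Require Import all_character.
From mathcomp Require Import boolp classical_sets reals.
From mathcomp.real_closed Require Import complex.
From mathcomp Require Import zify.

Set Implicit Arguments.
Unset Strict Implicit.
Unset Printing Implicit Defensive.

Import GRing.Theory Num.Theory.
Local Open Scope ring_scope.

Reserved Notation "x %:F" (format "x %:F").
Local Notation "x %:F" := (@FracField.tofrac _ x) : ring_scope.

(* A = Z[v, v^-1], as the subring of Q(v) = Frac Z[v] of the elements p / v^n *)

Definition is_laurent (x : {fraction {poly int}}) (q : {poly int} * nat) : Prop :=
  x = q.1%:F / 'X%:F ^+ q.2.

Definition laurent_pred : {pred {fraction {poly int}}} :=
  fun x => `[< exists q, is_laurent x q >].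

Lemma tofracX_neq0 (R : idomainType) :
  ('X : {poly R})%:F != 0.
Proof. by rewrite tofrac_eq0 polyX_eq0. Qed.

Lemma laurent_subring : subring_closed laurent_pred.
Proof.
have X0 n : ('X : {poly int})%:F ^+ n != 0.
  by rewrite expf_neq0 ?tofracX_neq0.
split=> [|x y|x y].
- by apply/asboolP; exists (1, 0%N); rewrite /is_laurent /= expr0 divr1 tofrac1.
- move=> /asboolP[[p n] ->] /asboolP[[q m] ->]; apply/asboolP.
  exists (p * 'X^m - q * 'X^n, (n + m)%N); rewrite /is_laurent /=.
  by rewrite -mulNr addf_div // exprD tofracB !tofracM !tofracXn mulNr.
- move=> /asboolP[[p n] ->] /asboolP[[q m] ->]; apply/asboolP.
  by exists (p * q, (n + m)%N); rewrite /is_laurent /= mulf_div tofracM exprD.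
Qed.

HB.instance Definition _ := GRing.isSubringClosed.Build {fraction {poly int}}
  laurent_pred laurent_subring.

Record laurent := Laurent { lval :> {fraction {poly int}};
                            lvalP : lval \in laurent_pred }.

HB.instance Definition _ := [isSub for lval].
HB.instance Definition _ := [Choice of laurent by <:].
HB.instance Definition _ := [SubChoice_isSubComNzRing of laurent by <:].

Fact lmono_subproof (k : int) :
  ('X : {poly int})%:F ^ k \in laurent_pred.
Proof.
apply/asboolP; case: k => n.
  by exists ('X^n, 0%N); rewrite /is_laurent /= expr0 divr1 tofracXn -exprnP.
by exists (1, n.+1); rewrite /is_laurent /= tofrac1 mul1r NegzE exprnN.
Qed.

Definition lmono (k : int) : laurent := Laurent (lmono_subproof k).

Definition laurent_rep (x : laurent) : {poly int} * nat :=
  xget (0, 0%N) (fun q => is_laurent (lval x) q).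

Definition lcoef (x : laurent) (k : int) : int :=
  let: (p, n) := laurent_rep x in
  if k + n%:Z is Posz m then p`_m else 0.

(* The image of x under the ring morphism v |-> b, for b <> 0 in a field. *)
Definition lev (F : fieldType) (b : F) (x : laurent) : F :=
  let: (p, n) := laurent_rep x in (map_poly intr p).[b] / b ^+ n.

(* x \in v^m Z[v^-1] *)
Definition degle (m : int) (x : laurent) : Prop :=
  forall k : int, m < k -> lcoef x k = 0.

Lemma laurent_repP (x : laurent) : is_laurent (lval x) (laurent_rep x).
Proof. by apply: xgetPex; apply/asboolP/lvalP. Qed.

(* Neither [lcoef] nor [lev] depends on the way x is written as p / v^n. *)
Lemma laurent_rep_eq (x : laurent) p n : is_laurent (lval x) (p, n) ->
  (laurent_rep x).1 * 'X^n = p * 'X^((laurent_rep x).2).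
Proof.
rewrite /is_laurent /= (laurent_repP x) /=; case: (laurent_rep x) => q m /= /eqP.
have X0 k : ('X : {poly int})%:F ^+ k != 0.
  by rewrite expf_neq0 ?tofracX_neq0.
rewrite eqr_div // -!tofracXn -!tofracM tofrac_eq => /eqP ->.
by [].
Qed.

Lemma lcoefE (x : laurent) p n (k : int) : is_laurent (lval x) (p, n) ->
  lcoef x k = if k + n%:Z is Posz m then p`_m else 0.
Proof.
move=> /laurent_rep_eq; rewrite /lcoef; case: (laurent_rep x) => q m /= E.
have cE (j : nat) : (q * 'X^n)`_j = (p * 'X^m)`_j by rewrite E.
have cX (r : {poly int}) (a b : nat) : (r * 'X^a)`_(b + a) = r`_b.
  by rewrite coefMXn ltnNge leq_addl /= addnK.
have c0 (r : {poly int}) (a b : nat) : (b < a)%N -> (r * 'X^a)`_b = 0.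
  by move=> ba; rewrite coefMXn ba.
case kn: (k + n%:Z) => [i|i]; case km: (k + m%:Z) => [j|j] //.
- have e : (j + n = i + m)%N by lia.
  by apply: etrans (esym (cX q n j)) (etrans _ (cX p m i)); rewrite cE e.
- by apply: esym; apply: etrans (esym (cX p m i)) _; rewrite -cE c0 //; lia.
- by apply: etrans (esym (cX q n j)) _; rewrite cE c0 //; lia.
Qed.

Lemma levE (F : fieldType) (b : F) (x : laurent) p n : b != 0 ->
  is_laurent (lval x) (p, n) -> lev b x = (map_poly intr p).[b] / b ^+ n.
Proof.
move=> b0 /laurent_rep_eq; rewrite /lev; case: (laurent_rep x) => q m /= E.
apply/eqP; rewrite eqr_div ?expf_neq0 //; apply/eqP.
have := congr1 (fun r => (map_poly intr r : {poly F}).[b]) E.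
by rewrite /= !rmorphM /= !map_polyXn !hornerM !hornerXn.
Qed.

(* W is presented by the generators S and the relations (s t)^m(s,t) = 1, where
   m(s,t) is the order of s t in W. *)
Definition coxeter_system (W : finGroupType) (S : {set W}) : Prop :=
  [/\ <<S>>%g = [set: W],
      forall s, s \in S -> #[s]%g = 2%N &
      forall (G : groupType) (f : W -> G),
        (forall s t, s \in S -> t \in S -> ((f s * f t) ^+ #[s * t])%g = 1%g) ->
        exists phi : W -> G,
          (forall x y, phi (x * y)%g = (phi x * phi y)%g) /\
          (forall s, s \in S -> phi s = f s)].

Section Coxeter.
Variables (W : finGroupType) (S : {set W}).

(* (S ^+ n)%g is the set of the products of n elements of S.  The partial
   products of a reduced expression are distinct, so that lengths are < #|W|. *)
Definition len (w : W) : nat := find (fun n => w \in (S ^+ n)%g) (iota 0 #|W|).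

Definition weight_function (L : W -> int) : Prop :=
  forall w w', len (w * w')%g = (len w + len w')%N ->
    L (w * w')%g = L w + L w'.

(* class_support S [set: W] is the set of reflections. *)
Definition bruhat_lt (y w : W) : bool :=
  (y != w) &&
  connect (fun a b => [exists t in class_support S [set: W],
                         (b == a * t)%g && (len a < len b)%N]) y w.

End Coxeter.

Section Basis.
Variables (I : finType) (H : lmodType laurent) (b : I -> H).

Definition is_basis : Prop :=
  forall h : H, exists! f : {ffun I -> laurent}, h = \sum_i f i *: b i.

Definition coords (h : H) : {ffun I -> laurent} :=
  xget 0 (fun f : {ffun I -> laurent} => h = \sum_i f i *: b i).

End Basis.

(* The Hecke algebra of (W, S, L), with the basis T_w, the bar involution, the
   involution h |-> h^dagger and the basis c_w.  These data exist and are unique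
   up to a unique isomorphism. *)
Record hecke (W : finGroupType) (S : {set W}) (L : W -> int) := Hecke {
  hecke_alg :> algType laurent;
  hT : W -> hecke_alg;
  hT_basis : is_basis hT;
  hT_mul : forall s w, s \in S ->
    (len S (s * w)%g = (len S w).+1 -> hT s * hT w = hT (s * w)%g) /\
    (len S w = (len S (s * w)%g).+1 ->
       hT s * hT w = hT (s * w)%g + (lmono (L s) - lmono (- L s)) *: hT w);
  hbar : {rmorphism hecke_alg -> hecke_alg};
  hbarK : involutive hbar;
  hbar_v : hbar (lmono 1)%:A = (lmono (-1))%:A;
  hbar_T : forall w, hbar (hT w) * hT w^-1%g = 1 /\ hT w^-1%g * hbar (hT w) = 1;
  hdag : {lrmorphism hecke_alg -> hecke_alg};
  hdagK : involutive hdag;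
  hdag_T : forall s, s \in S ->
    hdag (hT s) * hT s = -1 /\ hT s * hdag (hT s) = -1;
  hc : W -> hecke_alg;
  hc_basis : is_basis hc;
  hc_bar : forall w, hbar (hc w) = hc w;
  (* p_{y,w}, with p_{w,w} = 1 and p_{y,w} = 0 unless y <= w *)
  hp : W -> W -> laurent;
  hcE : forall w, hc w = hT w + \sum_(y | bruhat_lt S y w) hp y w *: hT y;
  hp_lt : forall y w, bruhat_lt S y w -> degle (-1) (hp y w);
  hp_refl : forall w, hp w w = 1;
  hp_nle : forall y w, y != w -> ~~ bruhat_lt S y w -> hp y w = 0 }.

Section Cells.
Variables (W : finGroupType) (S : {set W}) (L : W -> int) (H : hecke S L).

Definition hh (x y z : W) : laurent :=
  coords (hc H) (hc H x * hc H y) z.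

Definition leL (y w : W) : bool :=
  connect (fun y w => [exists s in S, hh s w y != 0]) y w.
Definition leR (y w : W) : bool := leL y^-1%g w^-1%g.
Definition leLR (y w : W) : bool := connect (fun a b => leL a b || leR a b) y w.
Definition simL (y w : W) : bool := leL y w && leL w y.
Definition simR (y w : W) : bool := leR y w && leR w y.
Definition simLR (y w : W) : bool := leLR y w && leLR w y.

Definition left_cell (C : {set W}) : Prop := exists w, C = [set x | simL x w].
Definition two_sided_cell (C : {set W}) : Prop :=
  exists w, C = [set x | simLR x w].

Definition afun (z : W) : nat :=
  xget 0%N (fun n : nat =>
    (forall x y, degle n%:Z (hh x y z)) /\
    (exists x y, ~ degle (n%:Z - 1) (hh x y z))).

Definition gam (x y z : W) : int := lcoef (hh x y z^-1%g) (afun z^-1%g)%:Z.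

(* The pair (Delta(z), n_z). *)
Definition Delta_n (z : W) : nat * int :=
  xget (0%N, 0) (fun q : nat * int => q.2 <> 0 /\
    lcoef (hp H 1%g z) (- q.1%:Z) = q.2 /\ degle (- q.1%:Z) (hp H 1%g z)).
Definition Delta (z : W) : nat := (Delta_n z).1.
Definition nz (z : W) : int := (Delta_n z).2.

Definition Dset : {set W} := [set z | afun z == Delta z].

Definition nhat (z : W) : int :=
  if [pick d in Dset | simL d z^-1%g] is Some d then nz d else 0.

(* Two independent indeterminates v and v', in the field Q(v)(v'). *)
Definition Qvv := {fraction {poly {fraction {poly int}}}}.
Definition Qvv_v : Qvv := ((('X : {poly int})%:F)%:P : {poly {fraction {poly int}}})%:F.
Definition Qvv_v' : Qvv := ('X : {poly {fraction {poly int}}})%:F.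

Definition P1 := forall z, (afun z <= Delta z)%N.
Definition P2 := forall x y d, d \in Dset -> gam x y d <> 0 -> x = y^-1%g.
Definition P3 := forall y, exists! d, d \in Dset /\ gam y^-1%g y d <> 0.
Definition P4 := forall z' z, leLR z' z -> (afun z <= afun z')%N.
Definition P5 := forall y d, d \in Dset -> gam y^-1%g y d <> 0 ->
  gam y^-1%g y d = nz d /\ (nz d = 1 \/ nz d = -1).
Definition P6 := forall d, d \in Dset -> (d * d)%g = 1%g.
Definition P7 := forall x y z, gam x y z = gam y z x.
Definition P8 := forall x y z, gam x y z <> 0 ->
  [/\ simL x y^-1%g, simL y z^-1%g & simL z x^-1%g].
Definition P9 := forall z' z, leL z' z -> afun z' = afun z -> simL z' z.
Definition P10 := forall z' z, leR z' z -> afun z' = afun z -> simR z' z.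
Definition P11 := forall z' z, leLR z' z -> afun z' = afun z -> simLR z' z.
Definition P13 := forall C : {set W}, left_cell C ->
  exists d, [/\ d \in Dset, d \in C,
                forall d', d' \in Dset -> d' \in C -> d' = d &
                forall x, x \in C -> gam x^-1%g x d <> 0].
Definition P14 := forall z, simLR z z^-1%g.
Definition P15 := forall w y, afun w = afun y -> forall x x',
  \sum_y' lev Qvv_v' (hh w x' y') * lev Qvv_v (hh x y' y) =
  \sum_y' lev Qvv_v (hh x w y') * lev Qvv_v' (hh y' x' y).

End Cells.

(* The parabolic subgroup W_I is taken as the group type [subg_of <<I>>]. *)
Definition P12 (W : finGroupType) (S : {set W}) (L : W -> int) (H : hecke S L) :=
  forall I : {set W}, I \subset S ->
  forall HI : @hecke (subg_of <<I>>) (sgval @^-1: I) (fun y => L (sgval y)),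
  forall y : subg_of <<I>>, afun HI y = afun H (sgval y).

Record P1_15 (W : finGroupType) (S : {set W}) (L : W -> int) (H : hecke S L)
    : Prop := {
  p1 : P1 H; p2 : P2 H; p3 : P3 H; p4 : P4 H; p5 : P5 H; p6 : P6 H; p7 : P7 H;
  p8 : P8 H; p9 : P9 H; p10 : P10 H; p11 : P11 H; p12 : P12 H; p13 : P13 H;
  p14 : P14 H; p15 : P15 H }.

Section J.
Variables (W : finGroupType) (S : {set W}) (L : W -> int) (H : hecke S L).
Variable B : comNzRingType.

(* B (x) J is {ffun W -> B}, with the basis t_w. *)
Definition jt (w : W) : {ffun W -> B} := [ffun z => (z == w)%:R].

Definition jmul (f g : {ffun W -> B}) : {ffun W -> B} :=
  [ffun u => \sum_x \sum_y f x * g y * (gam H x y u^-1%g)%:~R].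

Definition jtc (C : {set W}) : {ffun W -> B} :=
  \sum_(d in Dset H :&: C) jt d *~ nz H d.

(* A primitive idempotent of the subring X of B (x) J. *)
Definition primitive_idempotent (X : {ffun W -> B} -> Prop) (e : {ffun W -> B}) :=
  [/\ X e, e <> 0, jmul e e = e &
      forall e1 e2, X e1 -> X e2 -> jmul e1 e1 = e1 -> jmul e2 e2 = e2 ->
        jmul e1 e2 = 0 -> jmul e2 e1 = 0 -> e = e1 + e2 -> e1 = 0 \/ e2 = 0].

Definition jcenter (X : {ffun W -> B} -> Prop) (e : {ffun W -> B}) : Prop :=
  X e /\ forall f, X f -> jmul e f = jmul f e.

(* J_R = R (x) J inside B (x) J, for a subring R of B *)
Definition jsub (R : B -> Prop) (f : {ffun W -> B}) : Prop := forall w, R (f w).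

End J.

(* phi : H -> A (x) J, where phi (c_w^dagger) = sum h_{w,d,z} \hat n_z t_z; the
   c_w^dagger form a basis, and the coordinates of h on it are those of
   h^dagger on the basis of the c_w. *)
Definition jphi (W : finGroupType) (S : {set W}) (L : W -> int) (H : hecke S L)
    (h : H) : {ffun W -> laurent} :=
  [ffun z => \sum_w coords (hc H) (hdag H h) w *
               \sum_(d in Dset H | afun H z == afun H d)
                 hh H w d z * (nhat H z)%:~R].

Section Adapted.
Variable R0 : realType.
Variables (W : finGroupType) (S : {set W}) (L : W -> int) (H : hecke S L).

Local Notation C := R0[i].

Definition Cv := {fraction {poly C}}.
Definition Cv_v : Cv := ('X : {poly C})%:F.
Definition Cv_const (a : C) : Cv := (a%:P)%:F.

(* Irr(W): indices for the simple C[W]-modules up to isomorphism, afforded by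
   the matrix representations [irr_repr E]. *)
Definition IrrW : irrType C [set: W]%G :=
  DecSocleType (regular_repr C [set: W]%G).

(* phi_1 : C[W] -> J_C, an element of C[W] being given by its coordinates *)
Definition jphi1 (x : {ffun W -> C}) : {ffun W -> C} :=
  [ffun z => \sum_w x w * lev 1 (jphi (hT H w) z)].

Definition jphi1_inv (j : {ffun W -> C}) : {ffun W -> C} :=
  xget 0 (fun x => jphi1 x = j).

(* The action of j \in J_C on E_spade. *)
Definition spade (E : IrrW) (j : {ffun W -> C}) : 'M[C]_(irr_degree E) :=
  \sum_w jphi1_inv j w *: irr_repr E w.

Definition IrrWc (c : {set W}) : pred IrrW := fun E => spade E (jtc H C c) != 0.

(* An H_K-module of dimension n, K = C(v), is a K-algebra morphism from
   K (x)_A H to M_n(K), that is, an A-algebra morphism from H to M_n(K). *)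
Record HKrep (n : nat) := HKRep {
  hk_val :> {rmorphism H -> 'M[Cv]_n};
  hk_scale : forall a h, hk_val (a *: h) = lev Cv_v a *: hk_val h }.

(* U stands for its column space, which is a submodule of K^n if and only if
   rho h *m U is of the form U *m X for all h. *)
Definition HKsimple (n : nat) (rho : HKrep n) : Prop :=
  (0 < n)%N /\
  forall U : 'M[Cv]_n, (forall h, exists X : 'M[Cv]_n, rho h *m U = U *m X) ->
    U <> 0 -> U \in unitmx.

Definition HKiso (n n' : nat) (rho : HKrep n) (rho' : HKrep n') : Prop :=
  exists2 B : 'M[Cv]_(n', n), n = n' /\ row_free B &
    forall h, B *m rho h = rho' h *m B.

(* x \in C[v, v^-1], and its value at v = 1 is b. *)
Definition specializes1 (x : Cv) (b : C) : Prop :=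
  exists (p : {poly C}) (n : nat), x = p%:F / Cv_v ^+ n /\ p.[1] = b.

(* The bijection E |-> E_v from Irr(W) to the simple H_K-modules up to
   isomorphism; the trace condition determines it uniquely. *)
Record lusztig_bijection := LusztigBijection {
  ev_dim : IrrW -> nat;
  ev : forall E, HKrep (ev_dim E);
  ev_simple : forall E, HKsimple (ev E);
  ev_trace : forall E w,
    specializes1 (\tr (ev E (hT H w))) (\tr (irr_repr E w));
  ev_inj : forall E E', HKiso (ev E) (ev E') -> E = E';
  ev_surj : forall n (rho : HKrep n), HKsimple rho ->
    exists E, HKiso (ev E) rho }.

Variable Ev : lusztig_bijection.

Definition is_Cpoly (x : Cv) : Prop := exists p : {poly C}, x = p%:F.

Definition aE (E : IrrW) : nat :=
  xget 0%N (fun n : nat =>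
    (forall w, is_Cpoly (Cv_v ^ n%:Z * \tr (ev Ev E (hT H w)))) /\
    (exists w, ~ is_Cpoly (Cv_v ^ (n%:Z - 1) * \tr (ev Ev E (hT H w))))).

Definition cE (E : IrrW) : Cv :=
  (irr_degree E)%:R^-1 *
  \sum_w \tr (ev Ev E (hT H w)) * \tr (ev Ev E (hT H w^-1%g)).

Definition fE (E : IrrW) : C :=
  xget 0 (fun f : C => exists q : {poly C},
    cE E = Cv_const f * Cv_v ^ (- (2 * aE E)%N%:Z) +
           q%:F * Cv_v ^ (1 - (2 * aE E)%N%:Z)).

Definition is_subring (R : Cv -> Prop) : Prop :=
  [/\ R 1, forall x y, R x -> R y -> R (x - y) &
           forall x y, R x -> R y -> R (x * y)].

(* Every ideal of the ring R is finitely generated. *)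
Definition is_noetherian (R : Cv -> Prop) : Prop :=
  forall I : Cv -> Prop,
    I 0 -> (forall x, I x -> R x) -> (forall x y, I x -> I y -> I (x + y)) ->
    (forall r x, R r -> I x -> I (r * x)) ->
    exists (n : nat) (g : 'I_n -> Cv), (forall i, I (g i)) /\
      forall x, I x -> exists r : 'I_n -> Cv,
        (forall i, R (r i)) /\ x = \sum_i r i * g i.

Definition adapted (c : {set W}) (R : Cv -> Prop) : Prop :=
  [/\ is_subring R, is_noetherian R &
      forall m : IrrW -> int,
        R (Cv_const (\sum_(E | IrrWc c E) (m E)%:~R / fE E)) ->
        exists k : int, \sum_(E | IrrWc c E) (m E)%:~R / fE E = k%:~R].

End Adapted.

(* Main.v *)
(** Let tau(f) = \sum_(d in D) n_d f_d.  By (P2), (P3) and (P5) the bases t_w and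
t_{w^-1} of J are dual for tau, and comparing the leading terms of phi(T_w) with
those of phi_1 gives tau = \sum_E f_E^-1 tr(-, E_spade), where f_E > 0 because
t_w |-> t_{w^-1} is an anti-automorphism of J.  If e is an idempotent of J_R with
t_c e = e, then tau(e) is the sum over Irr(W, c) of rank(e | E_spade) / f_E and it
lies in R, so that it is a nonnegative integer, vanishing only for e = 0.  As
tau(n_d t_d) = n_d^2 = 1, the idempotent n_d t_d does not decompose.  If t_c = e1 + e2
with e1, e2 central, then each n_d t_d lies in one of the two summands, the same one
for d, d' as soon as t_z = n_d t_d t_z n_d' t_d' for some z; since a two-sided cell is
connected by left and right cells, e1 = 0 or e2 = 0. *)

Require Import Defs.
From HB Require Import structures.
From mathcomp Require Import all_boot all_order all_algebra all_fingroup.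
From mathcomp Require Import all_character.
From mathcomp Require Import boolp classical_sets reals.
From mathcomp.real_closed Require Import complex.
From mathcomp Require Import pgroup zify ring.

Set Implicit Arguments.
Unset Strict Implicit.
Unset Printing Implicit Defensive.

Import Order.TTheory GRing.Theory Num.Theory.
Local Open Scope ring_scope.

Local Notation "x %:F" := (@FracField.tofrac _ x) : ring_scope.

(** * Laurent polynomials *)

(** Everything known about phi and f_E has to be derived from (P1)-(P15) and the defining formulas.
    That phi_1 is bijective follows from a trace. The trace of left multiplication by h^dagger on H,
    read on the c_w, depends only on phi(h), since diagonal entries survive in the graded module for
    the function a; read on the T_w at v = 1 it is, up to sign, the regular character of W, which is
    nondegenerate. The number f_E is defined through E_v, which is known only by its trace at v = 1.
    The pullback of K (x) E_spade along phi is simple, because phi becomes onto over K = C(v) (its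
    determinant is nonzero already at v = 1), and it specializes to E, so it has the trace of E_v.
    The lowest power of v in the t_z-coordinate of phi(T_w) can be v^(-a(z)) only for z = w, and
    E_spade lives on a single two-sided cell, where a is constant. Hence tr(T_w, E_v) starts with a
    sign times v^(-a) tr(t_w, E_spade), and the signs of w and w^-1 cancel in c_E. Idempotents of
    J_R act on K (x) E_spade, so the ranks are taken over C(v). *)

Lemma lvalD (x y : laurent) : lval (x + y) = lval x + lval y.
Proof. by []. Qed.

Lemma lvalM (x y : laurent) : lval (x * y) = lval x * lval y.
Proof. by []. Qed.

Lemma tofracX_unit n : ('X : {poly int})%:F ^+ n != 0.
Proof. by rewrite expf_neq0 ?tofracX_neq0. Qed.

Lemma is_laurent_raise x p n m : is_laurent x (p, n) ->
  is_laurent x (p * 'X^m, (n + m)%N).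
Proof.
rewrite /is_laurent /= => ->; rewrite tofracM tofracXn exprD -mulf_div divff ?mulr1 //.
exact: tofracX_unit.
Qed.

Lemma laurentP (x : laurent) : exists p n, is_laurent (lval x) (p, n).
Proof. by exists (laurent_rep x).1, (laurent_rep x).2; case: laurent_rep (laurent_repP x). Qed.

Lemma laurent2P (x y : laurent) :
  exists p q n, is_laurent (lval x) (p, n) /\ is_laurent (lval y) (q, n).
Proof.
have [p [n Hx]] := laurentP x; have [q [m Hy]] := laurentP y.
exists (p * 'X^m), (q * 'X^n), (n + m)%N; split; first exact: is_laurent_raise.
by rewrite addnC; apply: is_laurent_raise.
Qed.

Lemma laurent_commonP (I : finType) (f : I -> laurent) :
  exists n (p : I -> {poly int}), forall i, is_laurent (lval (f i)) (p i, n).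
Proof.
have /choice [q Hq] i : exists q, is_laurent (lval (f i)) q.
  by have [p [n]] := laurentP (f i); exists (p, n).
pose N := \max_i (q i).2; exists N; exists (fun i => (q i).1 * 'X^(N - (q i).2)) => i.
have le : ((q i).2 <= N)%N by apply: leq_bigmax.
have := @is_laurent_raise (lval (f i)) (q i).1 (q i).2 (N - (q i).2).
by rewrite subnKC //; apply; case: (q i) (Hq i).
Qed.

Lemma is_laurentD x y p q n : is_laurent x (p, n) -> is_laurent y (q, n) ->
  is_laurent (x + y) (p + q, n).
Proof. by rewrite /is_laurent /= => -> ->; rewrite -mulrDl tofracD. Qed.

Lemma is_laurentM x y p q n m : is_laurent x (p, n) -> is_laurent y (q, m) ->
  is_laurent (x * y) (p * q, (n + m)%N).
Proof. by rewrite /is_laurent /= => -> ->; rewrite mulf_div tofracM exprD. Qed.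

Lemma is_laurentN x p n : is_laurent x (p, n) -> is_laurent (- x) (- p, n).
Proof. by rewrite /is_laurent /= => ->; rewrite tofracN mulNr. Qed.

Lemma lcoef_nat x p n m : is_laurent (lval x) (p, n) ->
  lcoef x (m%:Z - n%:Z) = p`_m.
Proof. by move=> /lcoefE ->; rewrite subrK. Qed.

Lemma lcoef_small x p n k : is_laurent (lval x) (p, n) -> k < - n%:Z ->
  lcoef x k = 0.
Proof. by move=> /lcoefE ->; case E: (k + n%:Z) => //; lia. Qed.

Variant lcoef_spec n (k : int) : Type :=
  | LcoefNat m of k = m%:Z - n%:Z : lcoef_spec n k
  | LcoefSmall of k < - n%:Z : lcoef_spec n k.

Lemma lcoefP n k : lcoef_spec n k.
Proof.
have [H|H] := leP (- n%:Z) k; last exact: LcoefSmall.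
by apply: (@LcoefNat n k (absz (k + n%:Z))); lia.
Qed.

Lemma lcoefD x y k : lcoef (x + y) k = lcoef x k + lcoef y k.
Proof.
have [p [q [n [Hx Hy]]]] := laurent2P x y.
have Hxy := is_laurentD Hx Hy; rewrite -lvalD in Hxy.
case: (lcoefP n k) => [m ->|kn]; last first.
  by rewrite (lcoef_small Hx kn) (lcoef_small Hy kn) (lcoef_small Hxy kn).
by rewrite !(lcoef_nat _ Hx, lcoef_nat _ Hy, lcoef_nat _ Hxy) coefD.
Qed.

Lemma lcoef_is_zmod k : zmod_morphism (lcoef^~ k).
Proof. by move=> x y; apply/(canRL (addrK _)); rewrite -lcoefD subrK. Qed.

Definition lcoef_at k x := lcoef x k.
HB.instance Definition _ k :=
  GRing.isZmodMorphism.Build laurent int (lcoef_at k) (lcoef_is_zmod k).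

Lemma lcoef_at0 k : lcoef 0 k = 0.
Proof. exact: (raddf0 (lcoef_at k)). Qed.

Lemma lcoef_sum (I : Type) (r : seq I) (P : pred I) (F : I -> laurent) k :
  lcoef (\sum_(i <- r | P i) F i) k = \sum_(i <- r | P i) lcoef (F i) k.
Proof. exact: (raddf_sum (lcoef_at k)). Qed.

Lemma lcoefMz x (a k : int) : lcoef (x * a%:~R) k = lcoef x k * a.
Proof.
rewrite mulrzr; have /= := raddfMz (lcoef_at k) a x.
by rewrite /lcoef_at => ->; rewrite -mulrzr intz.
Qed.

Lemma lcoef_inj x y : lcoef x =1 lcoef y -> x = y.
Proof.
move=> E; have [p [q [n [Hx Hy]]]] := laurent2P x y.
apply: val_inj; rewrite /= Hx Hy /=; congr (_%:F / _).
by apply/polyP => m; rewrite -(lcoef_nat _ Hx) -(lcoef_nat _ Hy).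
Qed.

Lemma is_laurent1 : is_laurent (lval 1) (1, 0%N).
Proof. by rewrite /is_laurent /= expr0 divr1 tofrac1. Qed.

Lemma is_laurent_lmono (n m : nat) :
  is_laurent (lval (lmono (m%:Z - n%:Z))) ('X^m, n).
Proof.
by rewrite /is_laurent /= tofracXn expfzDr ?tofracX_neq0 // exprnP exprnN.
Qed.

Lemma lcoef_lmono j k : lcoef (lmono j) k = (k == j)%:R.
Proof.
have [n [m ->]] : exists n m : nat, j = m%:Z - n%:Z.
  by exists (absz (Num.min 0 j)), (absz (Num.max 0 j)); lia.
have H := is_laurent_lmono n m.
case: (lcoefP n k) => [i ->|kn].
  rewrite (lcoef_nat _ H) coefXn (inj_eq (addIr _)) //.
by rewrite (lcoef_small H kn); case: eqP => //; lia.
Qed.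

Lemma lmono0 : lmono 0 = 1.
Proof. by apply: val_inj. Qed.

Lemma lmonoD j k : lmono (j + k) = lmono j * lmono k.
Proof. by apply: val_inj; rewrite /= expfzDr ?tofracX_neq0. Qed.

Lemma lcoef1 k : lcoef 1 k = (k == 0)%:R.
Proof. by rewrite -lmono0 lcoef_lmono. Qed.

Lemma degle0 m : degle m 0.
Proof. by move=> k _; rewrite lcoef_at0. Qed.

Lemma degle1 : degle 0 1.
Proof. by move=> k k0; rewrite lcoef1 gt_eqF. Qed.

Lemma degleW m n x : m <= n -> degle m x -> degle n x.
Proof. by move=> mn H k nk; apply: H; apply: le_lt_trans nk. Qed.

Lemma degleD m x y : degle m x -> degle m y -> degle m (x + y).
Proof. by move=> Hx Hy k mk; rewrite lcoefD Hx ?Hy ?addr0. Qed.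

Lemma degleB m x y : degle m x -> degle m y -> degle m (x - y).
Proof.
by move=> Hx Hy k mk; rewrite [lcoef _ _](lcoef_is_zmod k) /= Hx ?Hy ?subr0.
Qed.

Lemma degle_sum (I : Type) (r : seq I) (P : pred I) (F : I -> laurent) m :
  (forall i, P i -> degle m (F i)) -> degle m (\sum_(i <- r | P i) F i).
Proof. by move=> H k mk; rewrite lcoef_sum big1 // => i /H ->. Qed.

Lemma degleMz m x a : degle m x -> degle m (x * a%:~R).
Proof. by move=> H k mk; rewrite lcoefMz H ?mul0r. Qed.

Lemma degleP x : exists n : nat, degle n%:Z x.
Proof.
have [p [n H]] := laurentP x; exists (size p) => k pk.
case: (lcoefP n k) => [m E|kn]; last exact: lcoef_small H kn.
have pm : (size p <= m)%N by lia.
by rewrite E (lcoef_nat _ H) nth_default.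
Qed.

(** Once both degrees are bounded, only the pair of exponents m and n reaches m + n. The boolean
    factor lets one statement give both the degree of a product and its leading coefficient. *)
Lemma lcoefM_top m n x y k : degle m x -> degle n y -> m + n <= k ->
  lcoef (x * y) k = (k == m + n)%:R * (lcoef x m * lcoef y n).
Proof.
move=> Hx Hy mnk; have [p [a Hp]] := laurentP x; have [q [b Hq]] := laurentP y.
have Hpq := is_laurentM Hp Hq; rewrite -lvalM in Hpq.
have p0 i : m + a%:Z < i%:Z -> p`_i = 0.
  by move=> mi; rewrite -(lcoef_nat _ Hp) Hx //; lia.
have q0 i : n + b%:Z < i%:Z -> q`_i = 0.
  by move=> mi; rewrite -(lcoef_nat _ Hq) Hy //; lia.
case: (lcoefP (a + b) k) => [i E|kab]; last first.
  rewrite (lcoef_small Hpq kab); have [mn|mn] := ltP m (- a%:Z).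
    by rewrite (lcoef_small Hp mn) mul0r mulr0.
  by rewrite (@lcoef_small y _ _ n Hq) ?mulr0 //; lia.
rewrite E (lcoef_nat _ Hpq) coefM -E; case: eqP => /= [Ek|Ek]; last first.
  rewrite mul0r big1 // => j _; have jk := ltn_ord j.
  have [?|?] := ltP (m + a%:Z) j%:Z; first by rewrite p0 ?mul0r.
  by rewrite q0 ?mulr0 //; lia.
(* If m or n lies below the lowest exponent that the denominator allows, p or q is zero and there is
   no index at which to read the leading coefficient. *)
rewrite mul1r; have [ma|ma] := ltP m (- a%:Z).
  rewrite (lcoef_small Hp ma) mul0r big1 // => j _.
  by rewrite p0 ?mul0r //; lia.
have [nb|nb] := ltP n (- b%:Z).
  rewrite (lcoef_small Hq nb) mulr0 big1 // => j _; have jk := ltn_ord j.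
  by rewrite q0 ?mulr0 //; lia.
have li : (absz (m + a%:Z)%R < i.+1)%N by lia.
rewrite (bigD1 (Ordinal li)) //= big1 ?addr0 => [|j].
  by rewrite -(lcoef_nat _ Hp) -(lcoef_nat _ Hq); congr (lcoef _ _ * lcoef _ _); lia.
rewrite -val_eqE /= => /eqP ji; have jk := ltn_ord j.
have [?|?] := ltP (m + a%:Z) j%:Z; first by rewrite p0 ?mul0r.
by rewrite q0 ?mulr0 //; lia.
Qed.

Lemma degleM m n x y : degle m x -> degle n y -> degle (m + n) (x * y).
Proof.
move=> Hx Hy k mnk; rewrite (lcoefM_top Hx Hy) ?ltW //.
by rewrite gt_eqF ?mul0r.
Qed.

Definition lbar (x : laurent) : laurent :=
  let: (p, n) := laurent_rep x in
  \sum_(i < size p) lmono (n%:Z - i%:Z) * (p`_i)%:~R.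

Lemma laurent_expand x : x = let: (p, n) := laurent_rep x in
  \sum_(i < size p) lmono (i%:Z - n%:Z) * (p`_i)%:~R.
Proof.
case: laurent_rep (laurent_repP x) => p n H; apply: lcoef_inj => k.
rewrite lcoef_sum; under eq_bigr => i _ do rewrite lcoefMz lcoef_lmono.
case: (lcoefP n k) => [m ->|kn]; last first.
  rewrite (lcoef_small H kn) big1 // => i _.
  by case: eqP => [|_]; rewrite ?mul0r //; lia.
rewrite (lcoef_nat _ H); have [pm|pm] := ltnP m (size p).
  rewrite (bigD1 (Ordinal pm)) //= eqxx mul1r big1 ?addr0 // => i.
  rewrite -val_eqE /= => im; case: eqP => [|_]; rewrite ?mul0r //; lia.
rewrite nth_default // big1 // => i _; have := ltn_ord i.
by case: eqP => [|_]; rewrite ?mul0r //; lia.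
Qed.

Lemma lcoef_lbar x k : lcoef (lbar x) k = lcoef x (- k).
Proof.
rewrite {2}(laurent_expand x) /lbar; case: laurent_rep => p n.
rewrite !lcoef_sum; apply: eq_bigr => i _; rewrite !lcoefMz !lcoef_lmono.
by rewrite -[k == _]eqr_opp opprB.
Qed.

Lemma lbar_sum (I : Type) (r : seq I) (P : pred I) (F : I -> laurent) :
  lbar (\sum_(i <- r | P i) F i) = \sum_(i <- r | P i) lbar (F i).
Proof.
apply: lcoef_inj => k; rewrite lcoef_lbar !lcoef_sum.
by apply: eq_bigr => i _; rewrite lcoef_lbar.
Qed.

Lemma lbarMz x a : lbar (x * a%:~R) = lbar x * a%:~R.
Proof. by apply: lcoef_inj => k; rewrite !(lcoef_lbar, lcoefMz). Qed.

(** Invariance makes the coefficients symmetric under k |-> -k, and those with k >= 0 vanish. The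
    uniqueness of the basis c_w rests on this. *)
Lemma lbar_fixed0 x : lbar x = x -> degle (-1) x -> x = 0.
Proof.
move=> xx dx; apply: lcoef_inj => k; rewrite lcoef_at0.
have [k0|k0] := leP 0 k; first by rewrite dx //; lia.
by rewrite -xx lcoef_lbar dx //; lia.
Qed.

Section LevMorphism.
Variables (F : fieldType) (b : F) (b0 : b != 0).

(** [lev b] is a ring morphism only for b != 0; taking the proof as an argument gives the morphism
    structure a head to be attached to. *)
Definition levm of b != 0 := @lev F b.

Let lev_zmod : zmod_morphism (levm b0).
Proof.
move=> x y; have [p [q [n [Hx Hy]]]] := laurent2P x y.
have Hxy : is_laurent (lval (x - y)) (p - q, n) := is_laurentD Hx (is_laurentN Hy).
rewrite /levm (levE b0 Hx) (levE b0 Hy) (levE b0 Hxy).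
by rewrite rmorphB /= hornerD hornerN -mulNr -mulrDl.
Qed.

Let lev_monoid : monoid_morphism (levm b0).
Proof.
split=> [|x y]; first by rewrite /levm (levE b0 is_laurent1) rmorph1 hornerC expr0 divr1.
have [p [n Hx]] := laurentP x; have [q [m Hy]] := laurentP y.
have Hxy : is_laurent (lval (x * y)) (p * q, (n + m)%N) := is_laurentM Hx Hy.
rewrite /levm (levE b0 Hx) (levE b0 Hy) (levE b0 Hxy).
by rewrite rmorphM /= hornerM exprD mulf_div.
Qed.

HB.instance Definition _ :=
  GRing.isZmodMorphism.Build laurent F (levm b0) lev_zmod.
HB.instance Definition _ :=
  GRing.isMonoidMorphism.Build laurent F (levm b0) lev_monoid.

Lemma lev_lmono (k : int) : lev b (lmono k) = b ^ k.
Proof.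
have [n [m ->]] : exists n m : nat, k = m%:Z - n%:Z.
  by exists (absz (Num.min 0 k)), (absz (Num.max 0 k)); lia.
rewrite (levE b0 (is_laurent_lmono n m)) map_polyXn hornerXn.
by rewrite expfzDr // exprnP exprnN.
Qed.

End LevMorphism.

(** * Lengths in Coxeter groups *)

Section Length.
Variables (W : finGroupType) (S : {set W}).
Hypothesis cox : coxeter_system S.
Implicit Types (s w x y : W).
Local Notation len := (len S).

Lemma cox_gen x : exists n, x \in (S ^+ n)%g.
Proof.
have [gS _ _] := cox; have : x \in <<S>>%g by rewrite gS inE.
have [n ->] := gen_expgs S; elim: n x => [|n IH] x; first by exists 0%N.
rewrite expgS => /mulsgP[a b /setU1P[->|aS] /IH[m bm] ->]; first by exists m; rewrite mul1g.
by exists m.+1; rewrite expgS mem_mulg.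
Qed.

(* If w = x_i y_i with x_i a product of i generators and y_i a product of n - i
   generators, then x_i = x_j for i < j shortens w. *)
Lemma len_lt_card w n : w \in (S ^+ n)%g ->
  (forall m, w \in (S ^+ m)%g -> (n <= m)%N) -> (n < #|W|)%N.
Proof.
move=> wn min_n.
have /choice[f Hf] (i : 'I_n.+1) : exists p : W * W,
    [/\ p.1 \in (S ^+ i)%g, p.2 \in (S ^+ (n - i))%g & w = (p.1 * p.2)%g].
  have : w \in (S ^+ i * S ^+ (n - i))%g by rewrite -expgD subnKC // -ltnS.
  by case/mulsgP=> a b ai bi ->; exists (a, b).
have f_inj : injective (fun i => (f i).1).
  suff lt_neq (i j : 'I_n.+1) : (i < j)%N -> (f i).1 <> (f j).1.
    move=> i j E; apply: val_inj; case: (ltngtP i j) => //= /lt_neq; rewrite E //.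
  move=> ij E; have [ai _ _] := Hf i; have [_ bj wj] := Hf j.
  have /min_n : w \in (S ^+ (i + (n - j)))%g by rewrite wj expgD -E mem_mulg.
  by have := ltn_ord j; lia.
by have := leq_card _ f_inj; rewrite card_ord.
Qed.

Lemma lenP w : w \in (S ^+ (len w))%g /\ forall m, w \in (S ^+ m)%g -> (len w <= m)%N.
Proof.
have ex : exists n, w \in (S ^+ n)%g by apply: cox_gen.
case: (ex_minnP ex) => n wn min_n; have nW := len_lt_card wn min_n.
have -> : len w = n; last by [].
rewrite /Defs.len; set a := fun m => w \in (S ^+ m)%g.
have has_a : has a (iota 0 #|W|) by apply/hasP; exists n; rewrite ?mem_iota.
have lt_f : (find a (iota 0 #|W|) < #|W|)%N by rewrite has_find size_iota in has_a.
apply/eqP; rewrite eqn_leq; apply/andP; split; last first.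
  by apply: min_n; have := nth_find 0%N has_a; rewrite nth_iota.
rewrite leqNgt; apply/negP => /(before_find 0%N).
by rewrite nth_iota // /a add0n wn.
Qed.

Lemma len_mem w : w \in (S ^+ (len w))%g. Proof. by have [] := lenP w. Qed.

Lemma len_min w m : w \in (S ^+ m)%g -> (len w <= m)%N.
Proof. by have [_] := lenP w; apply. Qed.

Lemma len1 : len 1%g = 0%N.
Proof. by apply/eqP; rewrite -leqn0 len_min // expg0 set11. Qed.

Lemma len_eq0 w : len w = 0%N -> w = 1%g.
Proof. by move=> E; have := len_mem w; rewrite E expg0 => /set1P. Qed.

Lemma coxK s : s \in S -> (s * s)%g = 1%g.
Proof. by move=> sS; have [_ H _] := cox; rewrite -expg2 -(H s sS) expg_order. Qed.

Lemma coxV s : s \in S -> s^-1%g = s.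
Proof. by move=> sS; apply/eqP; rewrite eq_invg_mul coxK. Qed.

(** The sign character, obtained from the presentation of W: every generator may go to the same
    transposition of two points, since its square is trivial. *)
Lemma cox_exp_parity : exists phi : W -> {perm bool}, forall n w,
  w \in (S ^+ n)%g -> odd_perm (phi w) = odd n.
Proof.
have [_ _ /(_ _ (fun=> tperm true false))[|phi [phiM phiS]]] := cox.
  by move=> s t _ _; rewrite tperm2 expg1n.
have phi1 : phi 1%g = 1%g by apply: (@mulgI _ (phi 1%g)); rewrite -phiM !mulg1.
exists phi; elim=> [|n IH] w.
  by rewrite expg0 => /set1P ->; rewrite phi1 odd_perm1.
by rewrite expgS => /mulsgP[s x sS /IH E ->]; rewrite phiM odd_permM E phiS // odd_tperm.
Qed.

Lemma len_parity w n : w \in (S ^+ n)%g -> odd (len w) = odd n.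
Proof. by have [phi H] := cox_exp_parity => /H <-; rewrite (H _ _ (len_mem w)). Qed.

Lemma lenM x y : (len (x * y)%g <= len x + len y)%N.
Proof. by apply: len_min; rewrite expgD mem_mulg ?len_mem. Qed.

Lemma lenM_parity x y : odd (len (x * y)%g) = odd (len x + len y).
Proof. by apply: len_parity; rewrite expgD mem_mulg ?len_mem. Qed.

Lemma len_gen s : s \in S -> len s = 1%N.
Proof.
move=> sS; have : (len s <= 1)%N by rewrite len_min // expg1.
by have := @len_parity s 1; rewrite expg1 => /(_ sS); case: (len s) => [|[]].
Qed.

Lemma len_inv w : len w^-1%g = len w.
Proof.
suff le x : (len x^-1%g <= len x)%N.
  by apply/eqP; rewrite eqn_leq le -{1}[w]invgK le.
apply: len_min; move: (len x) (len_mem x) => n; elim: n x => [|n IH] x.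
  by rewrite !expg0 => /set1P ->; rewrite invg1 set11.
rewrite expgS => /mulsgP[s y sS /IH yn ->].
by rewrite invMg (coxV sS) -expgS expgSr mem_mulg.
Qed.

Lemma len_mulS s w : s \in S ->
  len (s * w)%g = (len w).+1 \/ len w = (len (s * w)%g).+1.
Proof.
move=> sS; have ls := len_gen sS.
have : (len (s * w)%g <= (len w).+1)%N by rewrite -add1n -ls lenM.
have : (len w <= (len (s * w)%g).+1)%N.
  by have := lenM s (s * w)%g; rewrite ls mulgA coxK // mul1g.
have : len (s * w)%g <> len w.
  by move=> E; have := lenM_parity s w; rewrite E ls /=; case: odd.
by lia.
Qed.

Lemma len_ind (P : W -> Prop) : P 1%g ->
  (forall s w, s \in S -> len (s * w)%g = (len w).+1 -> P w -> P (s * w)%g) ->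
  forall w, P w.
Proof.
move=> P1 PS w; move: {2}(len w) (erefl (len w)) => n; elim: n w => [|n IH] w lw.
  by rewrite (len_eq0 lw).
have := len_mem w; rewrite lw expgS => /mulsgP[s x sS /len_min xn E].
have lx : len x = n by have := lenM s x; rewrite -E lw len_gen //; lia.
by rewrite E; apply: PS => //; [rewrite -E lw lx | apply: IH].
Qed.

Lemma bruhat_lt_len y w : bruhat_lt S y w -> (len y < len w)%N.
Proof.
case/andP=> yw /connectP[p]; case: p => [|z p] /=; first by move=> _ E; rewrite E eqxx in yw.
case/andP=> /existsP[t /and3P[_ _ yz]] pp ->; apply: leq_trans yz _.
elim: p z pp => //= x p IH z /andP[/existsP[t' /and3P[_ _ zx]] /IH].
exact/leq_trans/ltnW.
Qed.

End Length.

(** * The Hecke algebra *)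

Section BasisTheory.
Variables (I : finType) (V : lmodType laurent) (b : I -> V).
Hypothesis bB : is_basis b.

Lemma coordsE h : h = \sum_i coords b h i *: b i.
Proof.
have [f [Hf _]] := bB h.
by apply: (@xgetPex _ 0 (fun f : {ffun I -> laurent} => h = \sum_i f i *: b i)); exists f.
Qed.

Lemma coords_eq h (f : I -> laurent) : h = \sum_i f i *: b i -> coords b h =1 f.
Proof.
move=> E; have Ef : h = \sum_i [ffun i => f i] i *: b i.
  by rewrite E; apply: eq_bigr => i _; rewrite ffunE.
have [g [_ g_uniq]] := bB h => i; have <- := g_uniq _ (coordsE h).
by rewrite (g_uniq _ Ef) ffunE.
Qed.

Lemma coordsP a h g i : coords b (a *: h + g) i = a * coords b h i + coords b g i.
Proof.
apply: (coords_eq (f := fun i => a * coords b h i + coords b g i)).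
rewrite {1}(coordsE h) {1}(coordsE g) scaler_sumr -big_split /=.
by apply: eq_bigr => j _; rewrite scalerA scalerDl.
Qed.

Lemma coordsD h g i : coords b (h + g) i = coords b h i + coords b g i.
Proof. by rewrite -[h]scale1r coordsP mul1r scale1r. Qed.

Lemma coords0 i : coords b 0 i = 0.
Proof. by apply: (addrI (coords b 0 i)); rewrite -coordsD !addr0. Qed.

Lemma coordsZ a h i : coords b (a *: h) i = a * coords b h i.
Proof. by rewrite -[a *: h]addr0 coordsP coords0 addr0. Qed.

Lemma coordsN h i : coords b (- h) i = - coords b h i.
Proof. by rewrite -scaleN1r coordsZ mulN1r. Qed.

Lemma coordsB h g i : coords b (h - g) i = coords b h i - coords b g i.
Proof. by rewrite coordsD coordsN. Qed.

Lemma coords_sum (J : Type) (r : seq J) (P : pred J) (F : J -> V) i :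
  coords b (\sum_(j <- r | P j) F j) i = \sum_(j <- r | P j) coords b (F j) i.
Proof.
elim: r => [|j r IH]; rewrite ?(big_nil, big_cons) ?coords0 //.
by case: ifP => // _; rewrite coordsD IH.
Qed.

Lemma coords_b i j : coords b (b i) j = (j == i)%:R.
Proof.
apply: (coords_eq (f := fun j => (j == i)%:R)).
by rewrite (bigD1 i) //= eqxx scale1r big1 ?addr0 // => k /negPf ->; rewrite scale0r.
Qed.

Lemma coords_inj g h : coords b g =1 coords b h -> g = h.
Proof. by move=> E; rewrite (coordsE g) (coordsE h); apply: eq_bigr => i _; rewrite E. Qed.

End BasisTheory.

Section BasisTrace.
Variables (I : finType) (V : lmodType laurent) (b b' : I -> V).
Hypotheses (bB : is_basis b) (bB' : is_basis b').

(** Used for left multiplication by h^dagger, whose trace on the c_w involves J and whose trace on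
    the T_w becomes the regular character at v = 1. *)
Lemma trace_basis (f : V -> V) : linear f ->
  \sum_i coords b (f (b i)) i = \sum_i coords b' (f (b' i)) i.
Proof.
move=> f_lin.
pose fl : {linear V -> V} := HB.pack f (GRing.isLinear.Build laurent V V *:%R f f_lin).
rewrite -[f]/(fl : V -> V); move: fl => {f_lin}f.
under eq_bigr => i _.
  rewrite {1}[b i](coordsE bB') linear_sum (coords_sum bB) /=.
  under eq_bigr => j _.
    rewrite linearZ (coordsZ bB) /= {1}[f _](coordsE bB') (coords_sum bB) mulr_sumr.
    under eq_bigr => k _ do rewrite (coordsZ bB) mulrCA.
  over.
over.
rewrite exchange_big; apply: eq_bigr => j _ /=; rewrite exchange_big /=.
transitivity (\sum_k coords b' (f (b' j)) k * (j == k)%:R); last first.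
  rewrite (bigD1 j) //= eqxx mulr1 big1 ?addr0 // => k /negPf kj.
  by rewrite eq_sym kj mulr0.
apply: eq_bigr => k _; rewrite -mulr_sumr -(coords_b bB') {2}[b' k](coordsE bB).
rewrite (coords_sum bB'); congr (_ * _); apply: eq_bigr => i _.
by rewrite (coordsZ bB') mulrC.
Qed.

End BasisTrace.

Section Hecke.
Variables (W : finGroupType) (S : {set W}) (L : W -> int) (H : hecke S L).
Hypothesis cox : coxeter_system S.
Hypothesis T1 : hT H 1%g = 1.
Implicit Types (s w x y z : W) (g h : H).
Local Notation len := (len S).
Local Notation T := (hT H).
Local Notation cT := (coords (hT H)).
Local Notation TB := (@hT_basis _ _ _ H).
Local Notation CB := (@hc_basis _ _ _ H).
Local Notation cc := (coords (hc H)).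

Definition xi s : laurent := lmono (L s) - lmono (- L s).

Lemma hT_sq s : s \in S -> T s * T s = 1 + xi s *: T s.
Proof.
move=> sS; have [_] := hT_mul H s sS; rewrite (coxK cox sS) (len1 cox) // (len_gen cox sS) T1.
by apply.
Qed.

Lemma hT_up s w : s \in S -> len (s * w)%g = (len w).+1 -> T s * T w = T (s * w)%g.
Proof. by move=> sS; have [+ _] := hT_mul H w sS. Qed.

Lemma hT_ind (P : H -> Prop) : P 1 -> (forall s h, s \in S -> P h -> P (T s * h)) ->
  (forall a g h, P g -> P h -> P (a *: g + h)) -> forall h, P h.
Proof.
move=> P1 PS PD h; have P0 : P 0 by rewrite -(subrr 1) addrC -scaleN1r; apply: PD.
have PT w : P (T w).
  elim/(len_ind cox): w => [|s w sS lw IH]; first by rewrite T1.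
  by rewrite -hT_up //; apply: PS.
rewrite (coordsE TB h); elim: (index_enum W) => [|w r IH]; rewrite ?(big_nil, big_cons) //.
exact: PD.
Qed.

(** [hecke] prescribes left multiplication by T_s only; the rule on the right follows by peeling
    generators off the left of w, which keeps both lengths additive. *)
Lemma hT_upr s w : s \in S -> len (w * s)%g = (len w).+1 -> T w * T s = T (w * s)%g.
Proof.
elim/(len_ind cox): w s => [|t w tS lw IH] s sS; first by rewrite T1 !mul1r mul1g.
move=> lws; have lw's : len (w * s)%g = (len w).+1.
  have := lenM cox t (w * s)%g; have := lenM cox w s.
  by rewrite mulgA lws lw (len_gen cox sS) (len_gen cox tS); lia.
by rewrite -hT_up // -mulrA IH // hT_up // ?mulgA // lws lw lw's.
Qed.

Lemma hT_downr s w : s \in S -> len w = (len (w * s)%g).+1 ->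
  T w * T s = T (w * s)%g + xi s *: T w.
Proof.
move=> sS lw; have E : T (w * s)%g * T s = T w.
  by rewrite hT_upr // -mulgA (coxK cox sS) mulg1.
by rewrite -{1}E -mulrA hT_sq // mulrDr mulr1 -scalerAr E.
Qed.

(** The A-linear anti-automorphism T_w |-> T_{w^-1}. It sends c_w to c_{w^-1} and so exchanges left
    and right in all statements on h_{x,y,z}. *)
Definition flat (h : H) : H := \sum_w cT h w *: T w^-1%g.

Lemma cT_flat h w : cT (flat h) w = cT h w^-1%g.
Proof.
apply: (coords_eq TB (f := fun w => cT h w^-1%g)).
by rewrite /flat (reindex_inj invg_inj); apply: eq_bigr => x _; rewrite invgK.
Qed.

Lemma flatP a g h : flat (a *: g + h) = a *: flat g + flat h.
Proof. by apply: (coords_inj TB) => w; rewrite (coordsP TB) !cT_flat (coordsP TB). Qed.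

HB.instance Definition _ := GRing.isLinear.Build laurent H H *:%R flat flatP.

Lemma flat_T w : flat (T w) = T w^-1%g.
Proof.
apply: (coords_inj TB) => x.
by rewrite cT_flat !(coords_b TB) -(inj_eq invg_inj) invgK.
Qed.

Lemma flat1 : flat 1 = 1.
Proof. by rewrite -T1 flat_T invg1. Qed.

Lemma flat_Ts s h : s \in S -> flat (T s * h) = flat h * T s.
Proof.
move=> sS; rewrite -[flat h]/(\sum_w cT h w *: T w^-1%g) mulr_suml.
rewrite {1}(coordsE TB h) mulr_sumr linear_sum.
apply: eq_bigr => w _; rewrite -scalerAr linearZ -scalerAl /=; congr (_ *: _).
have [up down] := hT_mul H w sS; have lsw := len_inv cox (s * w)%g.
rewrite invMg (coxV cox sS) in lsw; case: (len_mulS cox w sS) => lw.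
  by rewrite up // flat_T invMg (coxV cox sS) hT_upr // lsw (len_inv cox).
rewrite down // linearD linearZ /= !flat_T invMg (coxV cox sS) hT_downr //.
by rewrite lsw (len_inv cox).
Qed.

Lemma flatM g h : flat (g * h) = flat h * flat g.
Proof.
elim/hT_ind: g h => [|s g sS IH|a g g' IH IH'] h.
- by rewrite mul1r flat1 mulr1.
- by rewrite -mulrA (flat_Ts _ sS) IH (flat_Ts _ sS) mulrA.
by rewrite mulrDl -scalerAl !flatP IH IH' mulrDr -scalerAr.
Qed.

Lemma hbar_lmono (k : int) : hbar H (lmono k)%:A = (lmono (- k))%:A.
Proof.
have pos (n : nat) : hbar H (lmono n)%:A = (lmono (- n%:Z))%:A.
  elim: n => [|n IH]; first by rewrite oppr0 lmono0 scale1r rmorph1.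
  have A m k' : (lmono (m + k'))%:A = (lmono m)%:A * (lmono k')%:A :> H.
    by rewrite lmonoD -scalerA -scalerAl mul1r.
  by rewrite -addn1 PoszD opprD !A rmorphM /= IH hbar_v.
case: k => n; first exact: pos.
by rewrite NegzE opprK -pos hbarK.
Qed.

Lemma hbarZ a h : hbar H (a *: h) = lbar a *: hbar H h.
Proof.
rewrite -[a *: h]mulr_algl rmorphM /= -[RHS]mulr_algl; congr (_ * _).
rewrite {1}(laurent_expand a) /lbar; case: laurent_rep => p n.
rewrite !scaler_suml rmorph_sum; apply: eq_bigr => i _ /=.
by rewrite !mulrzr -!scalerMzl rmorphMz /= hbar_lmono opprB.
Qed.

Lemma hbar_Ts s : s \in S -> hbar H (T s) = T s - (xi s)%:A.
Proof.
move=> sS; have [bT Tb] := hbar_T H s; rewrite (coxV cox sS) in bT Tb.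
have E : T s * (T s - (xi s)%:A) = 1.
  by rewrite mulrBr hT_sq // -scalerAr mulr1 addrK.
by have := congr1 ( *%R^~ (T s - (xi s)%:A)) bT; rewrite /= -mulrA E mulr1 mul1r.
Qed.

(** Filtration by length, coarser than the Bruhat order: unitriangularity of the bar involution for
    it suffices for the uniqueness of the c_w. *)
Definition span_lt n h := forall w, (n <= len w)%N -> cT h w = 0.

Lemma span_ltP n a g h : span_lt n g -> span_lt n h -> span_lt n (a *: g + h).
Proof. by move=> Hg Hh w nw; rewrite (coordsP TB) Hg ?Hh // mulr0 addr0. Qed.

Lemma span_ltW n m h : (n <= m)%N -> span_lt n h -> span_lt m h.
Proof. by move=> nm Hh w mw; apply: Hh; apply: leq_trans mw. Qed.

Lemma span_lt_T n w : (len w < n)%N -> span_lt n (T w).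
Proof.
by move=> wn x nx; rewrite (coords_b TB); case: eqP => // E; rewrite E in nx; lia.
Qed.

Lemma span_lt_sum n (J : Type) (r : seq J) (F : J -> H) :
  (forall j, span_lt n (F j)) -> span_lt n (\sum_(j <- r) F j).
Proof. by move=> HF w nw; rewrite (coords_sum TB) big1 // => j _; apply: HF. Qed.

Lemma span_lt_Ts n s h : s \in S -> span_lt n h -> span_lt n.+1 (T s * h).
Proof.
move=> sS Hh; rewrite (coordsE TB h) mulr_sumr; apply: span_lt_sum => w.
rewrite -scalerAr => x nx; rewrite (coordsZ TB).
have [nw|wn] := leqP n (len w); first by rewrite Hh ?mul0r.
suff -> : cT (T s * T w) x = 0 by rewrite mulr0.
have [up down] := hT_mul H w sS; case: (len_mulS cox w sS) => lw.
  by rewrite up // (span_lt_T (n := n.+1)) // lw.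
have lswn : (len (s * w)%g < n.+1)%N by lia.
have lwn : (len w < n.+1)%N by lia.
by rewrite down // addrC (coordsP TB) (span_lt_T lswn) // (span_lt_T lwn) // mulr0 addr0.
Qed.

Lemma hbar_T_tri w : span_lt (len w) (hbar H (T w) - T w).
Proof.
elim/(len_ind cox): w => [|s w sS lw IH].
  by rewrite T1 rmorph1 subrr => x _; rewrite (coords0 TB).
rewrite -hT_up // rmorphM /= hbar_Ts // lw.
set Y := _ - T w in IH; have -> : hbar H (T w) = T w + Y by rewrite /Y addrC subrK.
have -> : (T s - (xi s)%:A) * (T w + Y) - T s * T w = - xi s *: (1 *: T w + Y) + T s * Y.
  by rewrite scale1r mulrBl mulr_algl mulrDr scaleNr (addrC (T s * T w)) addrAC addrK addrC.
apply: span_ltP; last exact: span_lt_Ts.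
by apply: span_ltP (span_lt_T _) (span_ltW _ IH).
Qed.

(** The Kazhdan-Lusztig uniqueness argument: by triangularity, the coefficient at an element of
    maximal length in the support of h is itself bar-invariant, hence zero by [lbar_fixed0]. *)
Lemma hbar_fixed0 h : hbar H h = h -> (forall w, degle (-1) (cT h w)) -> h = 0.
Proof.
move=> hh dh; apply/eqP; apply: contraT => h0.
have [w0 w0P] : exists w, cT h w != 0.
  apply/existsP; apply: contraNT h0; rewrite negb_exists => /forallP h0.
  by apply/eqP/(coords_inj TB) => w; rewrite (coords0 TB); apply/eqP; rewrite -[_ == _]negbK h0.
case: (@arg_maxnP _ w0 (fun w => cT h w != 0) len w0P) => w wP wmax.
case/eqP: wP; apply: lbar_fixed0; last exact: dh.
rewrite -[in RHS]hh {2}(coordsE TB h) rmorph_sum (coords_sum TB) (bigD1 w) //=.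
have E x : (len x <= len w)%N -> cT (hbar H (T x)) w = (w == x)%:R.
  move=> xw; rewrite -[hbar H _](subrK (T x)) (coordsD TB) (coords_b TB).
  by rewrite (hbar_T_tri xw) add0r.
rewrite hbarZ (coordsZ TB) E // eqxx mulr1 big1 ?addr0 // => x xw.
have [->|x0] := eqVneq (cT h x) 0; first by rewrite scale0r rmorph0 (coords0 TB).
by rewrite hbarZ (coordsZ TB) E 1?eq_sym ?(negPf xw) ?mulr0 //; apply: wmax x0.
Qed.

(** For h = T_w the left side is a left inverse and the right side a right inverse of T_w; both
    sides are semilinear. *)
Lemma hbar_flat h : hbar H (flat h) = flat (hbar H h).
Proof.
rewrite {1 2}(coordsE TB h) linear_sum !rmorph_sum linear_sum; apply: eq_bigr => w _.
rewrite linearZ /= !hbarZ linearZ /= flat_T; congr (_ *: _).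
have [_ Tb] := hbar_T H w^-1%g; rewrite invgK in Tb.
have /(congr1 flat) := (hbar_T H w).1.
rewrite flatM flat_T invgK flat1 => TfT.
have [bT _] := hbar_T H w^-1%g; rewrite invgK in bT.
by rewrite -[LHS]mulr1 -TfT mulrA bT mul1r.
Qed.

Lemma cT_hc w y : cT (hc H w) y = hp H y w.
Proof.
rewrite hcE (coordsD TB) (coords_sum TB) (coords_b TB).
under eq_bigr => x _ do rewrite (coordsZ TB) (coords_b TB).
have [->|yw] := eqVneq y w.
  rewrite hp_refl big1 ?addr0 // => x /andP[xw _]; rewrite eq_sym (negPf xw) mulr0 //.
rewrite add0r; have [lt|nlt] := boolP (bruhat_lt S y w); last first.
  rewrite hp_nle // big1 // => x xw; case: eqP => [E|_]; last by rewrite mulr0.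
  by rewrite E xw in nlt.
rewrite (bigD1 y) //= eqxx mulr1 big1 ?addr0 // => x /andP[_ xy].
by rewrite eq_sym (negPf xy) mulr0.
Qed.

Lemma hp_degle y w : y != w -> degle (-1) (hp H y w).
Proof.
move=> yw; have [/hp_lt //|nlt] := boolP (bruhat_lt S y w).
by rewrite hp_nle //; apply: degle0.
Qed.

Lemma flat_hc w : flat (hc H w) = hc H w^-1%g.
Proof.
apply/eqP; rewrite -subr_eq0; apply/eqP/hbar_fixed0.
  by rewrite rmorphB /= hbar_flat !hc_bar.
move=> y; rewrite (coordsB TB) cT_flat !cT_hc.
have [->|yw] := eqVneq y w^-1%g.
  by rewrite invgK !hp_refl subrr; apply: degle0.
apply: degleB; apply: hp_degle => //.
by rewrite -(inj_eq invg_inj) invgK.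
Qed.

Lemma cc_flat h z : cc (flat h) z = cc h z^-1%g.
Proof.
apply: (coords_eq CB (f := fun w => cc h w^-1%g)).
rewrite {1}(coordsE CB h) linear_sum (reindex_inj invg_inj).
by apply: eq_bigr => x _; rewrite linearZ /= flat_hc invgK.
Qed.

Lemma hh_flat x y z : hh H x y z = hh H y^-1%g x^-1%g z^-1%g.
Proof. by rewrite /hh -!flat_hc -flatM cc_flat invgK. Qed.

Lemma hc1 : hc H 1%g = 1.
Proof.
rewrite hcE T1 big1 ?addr0 // => y /(bruhat_lt_len); by rewrite (len1 cox).
Qed.

Lemma hc_gen s : s \in S -> exists a, hc H s = T s + a%:A.
Proof.
move=> sS; exists (hp H 1%g s); apply: (coords_inj TB) => y.
rewrite -T1 (coordsD TB) (coordsZ TB) !(coords_b TB) cT_hc.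
have s1 : s != 1%g by apply/eqP => E; have := len_gen cox sS; rewrite E (len1 cox).
have [->|ys] := eqVneq y s; first by rewrite hp_refl (negPf s1) mulr0 addr0.
have [->|y1] := eqVneq y 1%g; first by rewrite add0r mulr1.
rewrite add0r mulr0 hp_nle //; apply/negP => /bruhat_lt_len.
by rewrite (len_gen cox sS) ltnS leqn0 => /eqP/(len_eq0 cox)/eqP; rewrite (negPf y1).
Qed.

(** The matrix p_{y,w} is the identity modulo v^-1 Z[v^-1], hence so is its inverse, computed by
    induction on length. *)
Lemma cc_T w y : degle (-1) (cc (T w) y - (y == w)%:R).
Proof.
move: {2}(len w) (leqnn (len w)) y => n; elim: n w => [|n IH] w lw y.
  have -> : w = 1%g by apply: (len_eq0 cox); lia.
  by rewrite T1 -hc1 (coords_b CB) subrr; apply: degle0.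
have -> : T w = hc H w - \sum_(x | bruhat_lt S x w) hp H x w *: T x.
  by rewrite hcE addrK.
rewrite (coordsB CB) (coords_b CB) addrAC subrr sub0r -sub0r.
apply: degleB; first exact: degle0.
rewrite (coords_sum CB); apply: degle_sum => x xw; rewrite (coordsZ CB).
rewrite -[(-1)]addr0; apply: degleM; first exact: hp_lt.
rewrite -[coords _ _ _](subrK (y == x)%:R); apply: degleD.
  by apply: degleW (IH _ _ y) => //; have := bruhat_lt_len xw; lia.
by case: eqP => _; [apply: degle1 | apply: degle0].
Qed.

Lemma cc_hbar h z : cc (hbar H h) z = lbar (cc h z).
Proof.
apply: (coords_eq CB (f := fun w => lbar (cc h w))).
rewrite {1}(coordsE CB h) rmorph_sum.
by apply: eq_bigr => x _; rewrite /= hbarZ hc_bar.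
Qed.

Lemma hdag_Ts s : s \in S -> hdag H (T s) = - hbar H (T s).
Proof.
move=> sS; have [_ Td] := hdag_T H sS.
have [bT _] := hbar_T H s; rewrite (coxV cox sS) in bT.
by rewrite -[LHS]mul1r -bT -mulrA Td mulrN1.
Qed.

(** Each generator of a reduced expression contributes one sign. This reduces the lowest term of
    phi(T_w), which involves the dagger, to a highest term without it. *)
Lemma hdag_hbar w : hdag H (T w) = (-1) ^+ len w *: hbar H (T w).
Proof.
elim/(len_ind cox): w => [|s w sS lw IH].
  by rewrite T1 !rmorph1 (len1 cox) // expr0 scale1r.
rewrite -hT_up // !rmorphM /= hdag_Ts // IH lw exprS -scalerAr mulN1r.
by rewrite mulNr scaleNr scalerN.
Qed.

(** * The left and right preorders *)

Lemma cc_lin_neq0 a g h z : cc (a *: g + h) z != 0 -> cc g z != 0 \/ cc h z != 0.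
Proof.
rewrite (coordsP CB); case: (eqVneq (cc g z) 0) => [->|]; last by left.
by rewrite mulr0 add0r; right.
Qed.

Lemma leL_Ts s x z : s \in S -> cc (T s * hc H x) z != 0 -> leL H z x.
Proof.
move=> sS; have [a E] := hc_gen sS.
have -> : T s * hc H x = - a *: hc H x + hc H s * hc H x.
  by rewrite E mulrDl mulr_algl addrC scaleNr addrK.
case/cc_lin_neq0.
  by rewrite (coords_b CB); case: (eqVneq z x) => [-> _|_]; rewrite ?eqxx // /leL connect0.
by move=> Hz; apply: connect1; apply/existsP; exists s; rewrite sS.
Qed.

(** The preorder is defined by the c_s alone, but c_s and T_s differ by a scalar and the T_s
    generate H, so transitivity extends it to every h. *)
Lemma leL_cc h y z : cc (h * hc H y) z != 0 -> leL H z y.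
Proof.
elim/hT_ind: h z => [|s h sS IH|a g h IHg IHh] z.
- by rewrite mul1r (coords_b CB); case: (eqVneq z y) => [-> _|_]; rewrite ?eqxx // /leL connect0.
- rewrite -mulrA {1}(coordsE CB (h * _)) mulr_sumr (coords_sum CB) => nz.
  have [x] : exists x, cc (T s * (cc (h * hc H y) x *: hc H x)) z != 0.
    apply/existsP; apply: contraNT nz; rewrite negb_exists => /forallP z0.
    by rewrite big1 // => x _; apply/eqP; rewrite -[_ == _]negbK z0.
  rewrite -scalerAr (coordsZ CB) => nzx; apply: (@connect_trans _ _ x).
    by apply: leL_Ts sS _; apply: contraNneq nzx => ->; rewrite mulr0.
  by apply: IH; apply: contraNneq nzx => ->; rewrite mul0r.
- by rewrite mulrDl -scalerAl => /cc_lin_neq0[/IHg|/IHh].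
Qed.

Lemma leR_hh w x z : hh H w x z != 0 -> leR H z w.
Proof. by rewrite hh_flat => /leL_cc. Qed.

End Hecke.

(** * Comparison of coefficients in the second indeterminate of (P15) *)

Section TensorLaurent.

Lemma horner_tofracX (D : idomainType) (p : {poly int}) :
  (map_poly intr p : {poly {fraction {poly D}}}).['X%:F] =
  (map_poly intr p : {poly D})%:F.
Proof.
have E (K : nzRingType) (x : K) : (map_poly intr p).[x] = \sum_(i < size p) (p`_i)%:~R * x ^+ i.
  rewrite (@horner_coef_wide _ (size p)) ?size_poly //.
  by apply: eq_bigr => i _; rewrite coef_map.
rewrite E -[map_poly _ p in RHS]coefK poly_def rmorph_sum /=.
rewrite (@big_ord_widen _ _ _ _ (size p) (fun i => (_`_i *: 'X^i)%:F)) ?size_poly //.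
rewrite [RHS]big_mkcond; apply: eq_bigr => i _ /=.
have <- : ((p`_i)%:~R *: 'X^i)%:F = (p`_i)%:~R * 'X%:F ^+ i :> {fraction {poly D}}.
  by rewrite -mul_polyC tofracM tofracXn rmorph_int rmorph_int.
rewrite -(coef_map intr); case: ltnP => // le; rewrite nth_default // scale0r.
by rewrite tofrac0.
Qed.

Definition inQvv (x : {fraction {poly int}}) : Qvv := (x%:P)%:F.

HB.instance Definition _ := GRing.RMorphism.copy inQvv
  (@FracField.tofrac {poly {fraction {poly int}}} \o polyC).

Lemma lev_Qvv_v x : lev Qvv_v x = inQvv (lval x).
Proof.
have v0 : Qvv_v != 0 by rewrite tofrac_eq0 polyC_eq0 tofracX_neq0.
have [p [n Hp]] := laurentP x; rewrite (levE v0 Hp) Hp /=.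
have -> : map_poly intr p = map_poly inQvv (map_poly intr p).
  by rewrite -map_poly_comp; apply: eq_map_poly => a /=; rewrite !rmorph_int.
rewrite -[Qvv_v]/(inQvv 'X%:F) horner_map /= horner_tofracX.
rewrite map_poly_id; last by move=> a _; rewrite /= intz.
by rewrite rmorphM fmorphV rmorphXn.
Qed.

HB.instance Definition _ :=
  GRing.isZmodMorphism.Build laurent {fraction {poly int}} lval (fun x y => erefl).
HB.instance Definition _ :=
  GRing.isMonoidMorphism.Build laurent {fraction {poly int}} lval (conj erefl (fun x y => erefl)).

Lemma lev_Qvv_v' x p n : is_laurent (lval x) (p, n) ->
  lev Qvv_v' x = (map_poly intr p : {poly {fraction {poly int}}})%:F / Qvv_v' ^+ n.
Proof. by move=> Hp; rewrite (levE (tofracX_neq0 _) Hp) horner_tofracX. Qed.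

(** Since v' is transcendental over Q(v), clearing the powers of v' leaves an identity of
    polynomials in v' over Q(v), which is compared coefficient by coefficient. *)
Lemma Qvv_coef (I : finType) (a b a' b' : I -> laurent) :
  \sum_i lev Qvv_v' (b i) * lev Qvv_v (a i) =
  \sum_i lev Qvv_v (a' i) * lev Qvv_v' (b' i) ->
  forall k, \sum_i a i * (lcoef (b i) k)%:~R = \sum_i a' i * (lcoef (b' i) k)%:~R.
Proof.
(* A single family over [I + I], so that [b] and [b'] receive the same denominator v'^n. *)
have [n [r Hr]] := laurent_commonP
  (fun u : I + I => match u with inl i => b i | inr i => b' i end).
pose p i := r (inl i); pose p' i := r (inr i).
have Hp i : is_laurent (lval (b i)) (p i, n) := Hr (inl i).
have Hp' i : is_laurent (lval (b' i)) (p' i, n) := Hr (inr i).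
under eq_bigr => i _ do rewrite (lev_Qvv_v' (Hp i)) lev_Qvv_v mulrAC -tofracM.
under [in RHS]eq_bigr => i _ do rewrite (lev_Qvv_v' (Hp' i)) lev_Qvv_v mulrA -tofracM.
rewrite -!mulr_suml => /(mulIf _); rewrite invr_eq0 expf_neq0 ?tofracX_neq0 // => /(_ isT).
rewrite -!rmorph_sum /= => /eqP; rewrite tofrac_eq => /eqP E k.
case: (lcoefP n k) => [i ->|kn]; last first.
  rewrite !big1 // => i _; last by rewrite (lcoef_small (Hp i) kn) mulr0.
  by rewrite (lcoef_small (Hp' i) kn) mulr0.
apply: val_inj; rewrite /= !rmorph_sum /=.
have /= := congr1 (fun q : {poly _} => q`_i) E; rewrite !coef_sum => Ei.
under eq_bigr => j _ do rewrite (lcoef_nat _ (Hp j)).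
under [RHS]eq_bigr => j _ do rewrite (lcoef_nat _ (Hp' j)).
transitivity (\sum_j (map_poly intr (p j) * (lval (a j))%:P)`_i).
  by apply: eq_bigr => j _; rewrite coefMC coef_map /= ?rmorphM /= rmorph_int mulrC.
by rewrite Ei; apply: eq_bigr => j _; rewrite coefCM coef_map /= ?rmorphM /= rmorph_int.
Qed.

End TensorLaurent.

(** * Cells and the function a *)

Lemma lcoefN1 : lcoef (-1) =1 (fun k => - (k == 0)%:R).
Proof. by move=> k; have := lcoefD 1 (-1) k; rewrite subrr lcoef_at0 lcoef1; lia. Qed.

Section HeckeOne.
Variables (W : finGroupType) (S : {set W}) (L : W -> int) (H : hecke S L).
Hypothesis cox : coxeter_system S.
Hypothesis P : P1_15 H.

Lemma nz1 : nz H 1%g = 1.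
Proof.
rewrite /nz /Delta_n; case: xgetP => [[n b] _ /= [b0 [+ _]]|/(_ (0%N, 1))] /=.
  by rewrite hp_refl lcoef1; case: eqP => [_ <- //|_ E]; case: b0; rewrite -E.
case; split=> //=; rewrite hp_refl oppr0 lcoef1; split=> //; exact: degle1.
Qed.

(** If S contains some s, then T_s T_1 = T_s and T_s is invertible. If W is trivial, T_1 = c_1 is
    bar-invariant, so T_1 is a scalar of square 1; the value -1 would give gamma_{1,1,1} <> 1 = n_1,
    against (P5). *)
Lemma hT1 : hT H 1%g = 1.
Proof.
have [bT Tb] := hbar_T H 1%g; rewrite invg1 in bT Tb.
have [S0|[s sS]] := set_0Vmem S; last first.
  have [dT Td] := hdag_T H sS; have [up _] := hT_mul H 1%g sS.
  have {}up : hT H s * hT H 1%g = hT H s.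
    by rewrite up mulg1 // (len_gen cox sS) (len1 cox).
  by apply: oppr_inj; rewrite -mulN1r -dT -mulrA up.
have W1 (w : W) : w = 1%g.
  have [gS _ _] := cox; have : w \in <<S>>%g by rewrite gS inE.
  by rewrite S0 gen0 => /set1P.
have c1 : hc H 1%g = hT H 1%g.
  by rewrite hcE big1 ?addr0 // => y /andP[]; rewrite (W1 y) eqxx.
have TT : hT H 1%g * hT H 1%g = 1 by rewrite -{1}c1 -(hc_bar H) c1.
pose a := coords (hc H) 1 1%g.
have TaH : 1 = a *: hT H 1%g.
  rewrite {1}(coordsE (@hc_basis _ _ _ H) 1) (bigD1 1%g) //= big1 ?addr0 ?c1 // => w.
  by rewrite (W1 w) eqxx.
have Ta : hT H 1%g = a%:A by rewrite -[LHS]mulr1 {1}TaH -scalerAr TT.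
have hh1 : hh H 1%g 1%g 1%g = a by rewrite /hh c1 TT.
have aa : a * a = 1.
  have E : hT H 1%g = (a * a) *: hT H 1%g by rewrite -scalerA -TaH -Ta.
  have := congr1 (fun h => coords (hT H) h 1%g) E; rewrite (coordsZ (@hT_basis _ _ _ H)).
  by rewrite (coords_b (@hT_basis _ _ _ H)) eqxx mulr1.
have [aN1|a1] := eqVneq a (-1); last first.
  (* The absence of zero divisors is taken from the fraction field, [laurent] being declared only as
     a commutative ring. *)
  have : (a + 1) * (a - 1) = 0 by rewrite mulrC -subr_sqr expr2 expr1n aa subrr.
  move/(congr1 lval); rewrite rmorphM rmorph0 => /eqP; rewrite mulf_eq0.
  case/orP=> /eqP E.
    by case/eqP: a1; apply: (addIr 1); apply: val_inj; rewrite /= addNr; apply: E.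
  rewrite Ta; suff -> : a = 1 by rewrite scale1r.
  by apply: (addIr (-1)); apply: val_inj; rewrite /= subrr; apply: E.
have [d [[dD g0] _]] := p3 P 1%g; have [gn _] := p5 P dD g0.
move: gn; rewrite (W1 d) nz1 /gam !invg1 hh1 aN1 lcoefN1.
by case: eqP.
Qed.

End HeckeOne.

Section Cells.
Variables (W : finGroupType) (S : {set W}) (L : W -> int) (H : hecke S L).
Hypothesis cox : coxeter_system S.
Hypothesis P : P1_15 H.
Implicit Types (x y z w d : W) (h : H).
Local Notation cc := (coords (hc H)).
Local Notation CB := (@hc_basis _ _ _ H).
Local Notation a := (afun H).
Local Notation D := (Dset H).
Let T1 := hT1 cox P.

(** A bound exists because W is finite, and the least one is attained; when it is 0 this is
    witnessed by h_{1,z,z} = 1. *)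
Lemma afunP z : (forall x y, degle (a z)%:Z (hh H x y z)) /\
  (exists x y, ~ degle ((a z)%:Z - 1) (hh H x y z)).
Proof.
apply: (@xgetPex _ 0%N (fun n : nat => (forall x y, degle n%:Z (hh H x y z)) /\
  (exists x y, ~ degle (n%:Z - 1) (hh H x y z)))).
pose Q (n : nat) := `[< forall x y, degle n%:Z (hh H x y z) >].
have exQ : exists n, Q n.
  have /choice[f Hf] (p : W * W) := degleP (hh H p.1 p.2 z).
  exists (\max_p f p); apply/asboolP => x y; apply: degleW (Hf (x, y)).
  by rewrite lez_nat (leq_bigmax (x, y)).
case: (ex_minnP exQ) => n /asboolP Qn minn; exists n; split=> //.
case: n => [|n] in Qn minn *.
  exists 1%g, z => /(_ 0); rewrite /hh hc1 // mul1r (coords_b CB) eqxx lcoef1.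
  by move/(_ isT).
have /asboolPn nQ : ~~ Q n by apply/negP => /minn; rewrite ltnn.
have [x nx] := (existsNP _).2 nQ; have [y nxy] := (existsNP _).2 nx.
by exists x, y; rewrite -addn1 PoszD addrK.
Qed.

Lemma afun_degle x y z : degle (a z)%:Z (hh H x y z).
Proof. by have [] := afunP z. Qed.

Lemma gamE x y z : gam H x y z^-1%g = lcoef (hh H x y z) (a z)%:Z.
Proof. by rewrite /gam invgK. Qed.

Lemma leL_LR y w : leL H y w -> leLR H y w.
Proof. by move=> yw; apply: connect1; rewrite yw. Qed.

Lemma leR_LR y w : leR H y w -> leLR H y w.
Proof. by move=> yw; apply: connect1; rewrite yw orbT. Qed.

Lemma afun_leL y w : leL H y w -> (a w <= a y)%N.
Proof. by move/leL_LR/(p4 P). Qed.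

Lemma afun_leR y w : leR H y w -> (a w <= a y)%N.
Proof. by move/leR_LR/(p4 P). Qed.

Lemma afun_simLR y w : simLR H y w -> a y = a w.
Proof. by case/andP=> /(p4 P) H1 /(p4 P) H2; apply/eqP; rewrite eqn_leq H1 H2. Qed.

Lemma simL_LR y w : simL H y w -> simLR H y w.
Proof. by case/andP=> /leL_LR H1 /leL_LR H2; apply/andP. Qed.

Lemma afun_simL y w : simL H y w -> a y = a w.
Proof. by move/simL_LR/afun_simLR. Qed.

Lemma afunV z : a z^-1%g = a z.
Proof. by apply/esym/afun_simLR/(p14 P). Qed.

Lemma simL_refl x : simL H x x.
Proof. by rewrite /simL /leL connect0. Qed.

Lemma simL_sym x y : simL H x y = simL H y x.
Proof. exact: andbC. Qed.

Lemma simL_trans y x z : simL H x y -> simL H y z -> simL H x z.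
Proof.
case/andP=> xy yx /andP[yz zy]; apply/andP; split.
  exact: connect_trans yz.
exact: connect_trans yx.
Qed.

Lemma simLR_refl x : simLR H x x.
Proof. by rewrite /simLR /leLR connect0. Qed.

Lemma simLR_sym x y : simLR H x y = simLR H y x.
Proof. exact: andbC. Qed.

Lemma simLR_trans y x z : simLR H x y -> simLR H y z -> simLR H x z.
Proof.
case/andP=> xy yx /andP[yz zy]; apply/andP; split.
  exact: connect_trans yz.
exact: connect_trans yx.
Qed.

Lemma hh_leL x y z : hh H x y z != 0 -> leL H z y.
Proof. exact: leL_cc. Qed.

Lemma Dset_inv d : d \in D -> d^-1%g = d.
Proof. by move/(p6 P)/eqP; rewrite -eq_invg_mul => /eqP. Qed.

(** The element of D attached to y by (P3); by (P8) and (P13) it is also the only element of D in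
    the left cell of y. *)
Definition dd y : W := odflt 1%g [pick d in D | gam H y^-1%g y d != 0].

Lemma ddP y : dd y \in D /\ gam H y^-1%g y (dd y) <> 0.
Proof.
rewrite /dd; case: pickP => [d /andP[dD /eqP g0] //|/= no].
by have [d [[dD g0] _]] := p3 P y; have := no d; rewrite dD => /negbFE/eqP.
Qed.

Lemma dd_uniq y d : d \in D -> gam H y^-1%g y d <> 0 -> d = dd y.
Proof.
move=> dD g0; have [dyD gy0] := ddP y; have [d' [_ uniq]] := p3 P y.
by rewrite -(uniq d) //; apply: uniq.
Qed.

Lemma dd_simL y : simL H (dd y) y.
Proof.
have [dD g0] := ddP y; have [_ + _] := p8 P g0.
by rewrite Dset_inv // simL_sym.
Qed.

Lemma dd_eq y d : d \in D -> simL H d y -> d = dd y.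
Proof.
move=> dD dy; have [|d' [_ _ uniq _]] := p13 P (C := [set x | simL H x y]).
  by exists y.
have [dyD _] := ddP y; have mem x : simL H x y -> x \in [set x | simL H x y] by rewrite inE.
by rewrite (uniq d dD (mem d dy)) (uniq (dd y) dyD (mem _ (dd_simL y))).
Qed.

Lemma dd_congr x y : simL H x y -> dd x = dd y.
Proof. by move=> xy; apply: dd_eq (simL_trans (dd_simL x) xy); have [] := ddP x. Qed.

Lemma dd_D d : d \in D -> dd d = d.
Proof. by move=> dD; rewrite -(dd_eq dD) // simL_refl. Qed.

Lemma gam_dd y : gam H y^-1%g y (dd y) = nz H (dd y).
Proof. by have [dD g0] := ddP y; have [] := p5 P dD g0. Qed.

Lemma nz_sq d : d \in D -> nz H d * nz H d = 1.
Proof.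
move=> dD; have [_ g0] := ddP d; rewrite dd_D // in g0.
by have [_ [] ->] := p5 P dD g0.
Qed.

(** By (P2) and (P3) only x = y^-1 and d = [dd y] survive, with value n_d by (P5). The predicate
    serves all partial sums of 1_J as well as sums restricted by the value of a. *)
Lemma sum_gam (Q : pred W) (F : W -> int) x y : \sum_(d in D | Q d) F d * gam H x y d =
  ((x == y^-1%g) && Q (dd y))%:R * (F (dd y) * nz H (dd y)).
Proof.
have [dyD g0] := ddP y.
have [->|xy] /= := eqVneq x y^-1%g; last first.
  rewrite mul0r big1 // => d /andP[dD _]; suff -> : gam H x y d = 0 by rewrite mulr0.
  by apply/eqP; apply: contraNT xy => /eqP /(p2 P dD) ->.
have z d : d \in D -> d != dd y -> F d * gam H y^-1%g y d = 0.
  move=> dD; have [->|/eqP g] := eqVneq (gam H y^-1%g y d) 0; first by rewrite mulr0.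
  by rewrite -(dd_uniq dD g) eqxx.
case Qd: (Q (dd y)); last first.
  rewrite mul0r big1 // => d /andP[dD Qd']; apply: z => //.
  by apply: contraTneq Qd' => ->; rewrite Qd.
rewrite mul1r (bigD1 (dd y)) /= ?dyD ?Qd // gam_dd big1 ?addr0 // => d /andP[/andP[dD _]].
exact: z.
Qed.

Lemma nz_gam (Q : pred W) x y : \sum_(d in D | Q d) nz H d * gam H x y d =
  ((x == y^-1%g) && Q (dd y))%:R.
Proof. by rewrite sum_gam nz_sq ?mulr1 //; have [] := ddP y. Qed.

Lemma nhatE z : nhat H z = nz H (dd z^-1%g).
Proof.
rewrite /nhat; case: pickP => [d /andP[dD dz]|/(_ (dd z^-1%g))].
  by rewrite (dd_eq dD dz).
by have [-> _] := ddP z^-1%g; rewrite dd_simL.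
Qed.

Lemma nhat_sq z : nhat H z * nhat H z = 1.
Proof. by rewrite nhatE nz_sq //; have [] := ddP z^-1%g. Qed.

Lemma nhat_D d : d \in D -> nhat H d = nz H d.
Proof. by move=> dD; rewrite nhatE Dset_inv // dd_D. Qed.

Lemma gam_nhat x y z : gam H x y z^-1%g <> 0 -> nhat H x = nhat H z.
Proof. by move=> /(p8 P)[_ _ /dd_congr E]; rewrite !nhatE E. Qed.

Lemma gam_flat x y z : gam H x y z = gam H y^-1%g x^-1%g z^-1%g.
Proof. by rewrite /gam hh_flat // !invgK afunV. Qed.

(* The coefficient of v'^a in (P15), a being the common value of a(w) and a(y). *)
Lemma p15_gam w x x' y : a w = a y ->
  \sum_(y' | a y' == a w) hh H x y' y * (gam H w x' y'^-1%g)%:~R =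
  \sum_(y' | a y' == a w) hh H x w y' * (gam H y' x' y^-1%g)%:~R.
Proof.
move=> wy; have := Qvv_coef (p15 P wy x x') (a w)%:Z.
(* A nonzero term on the left has y <=_L y' <=_R w, one on the right y <=_R y' <=_L w; with a(y) =
   a(w), (P4) forces a(y') = a(w). *)
rewrite (bigID (fun y' => a y' == a w)) /= [X in _ + X]big1 => [|y' ay'].
  rewrite addr0 [RHS](bigID (fun y' => a y' == a w)) /= [X in _ = _ + X]big1 => [|y' ay'].
    rewrite addr0 => E.
    etransitivity; last (etransitivity; first exact: E).
      by apply: eq_bigr => y' /eqP ay'; rewrite gamE ay'.
    by apply: eq_bigr => y' _; rewrite gamE wy.
  have [->|/hh_leL/afun_leL wy'] := eqVneq (hh H x w y') 0; first by rewrite mul0r.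
  have [->|/leR_hh] := eqVneq (hh H y' x' y) 0; first by rewrite lcoef_at0 mulr0.
  by move=> /(_ cox T1)/afun_leR yy'; rewrite eqn_leq wy' wy yy' in ay'.
have [->|/hh_leL/afun_leL wy'] := eqVneq (hh H x y' y) 0; first by rewrite mul0r.
have [->|/leR_hh] := eqVneq (hh H w x' y') 0; first by rewrite lcoef_at0 mulr0.
by move=> /(_ cox T1)/afun_leR yy'; rewrite eqn_leq yy' wy wy' in ay'.
Qed.

Lemma p15_act h w x' y : a w = a y ->
  \sum_(y' | a y' == a w) cc (h * hc H y') y * (gam H w x' y'^-1%g)%:~R =
  \sum_(y' | a y' == a w) cc (h * hc H w) y' * (gam H y' x' y^-1%g)%:~R.
Proof.
move=> wy; have E u y' : cc (h * hc H u) y' = \sum_x cc h x * hh H x u y'.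
  rewrite {1}(coordsE CB h) mulr_suml (coords_sum CB).
  by apply: eq_bigr => x _; rewrite -scalerAl (coordsZ CB).
under eq_bigr => y' _ do rewrite E mulr_suml.
under [RHS]eq_bigr => y' _ do rewrite E mulr_suml.
rewrite exchange_big [RHS]exchange_big; apply: eq_bigr => x _ /=.
under eq_bigr => y' _ do rewrite -mulrA.
under [RHS]eq_bigr => y' _ do rewrite -mulrA.
by rewrite -!mulr_sumr p15_gam.
Qed.

End Cells.

(** * The ring J *)

Section JRing.
Variables (W : finGroupType) (S : {set W}) (L : W -> int) (H : hecke S L).
Hypothesis cox : coxeter_system S.
Hypothesis P : P1_15 H.
Implicit Types (u w x y z d : W).
Local Notation a := (afun H).
Local Notation D := (Dset H).
Local Notation dd := (dd H).

Lemma gam_afun x y z : gam H x y z <> 0 -> a x = a y /\ a y = a z.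
Proof.
move/(p8 P)=> [/(afun_simL P) xy /(afun_simL P) yz _].
by rewrite (afunV P) in xy; rewrite (afunV P) in yz; split.
Qed.

(** The coefficient of v^a in [p15_gam]. That identity needs a(y) = a(v) and sees only the u with
    this value of a; nothing else occurs, since a nonzero gamma has indices with equal values of
    a. *)
Lemma gam_assoc x y z v :
  \sum_u gam H x y u^-1%g * gam H u z v^-1%g =
  \sum_u gam H y z u^-1%g * gam H x u v^-1%g.
Proof.
have aL u : gam H x y u^-1%g * gam H u z v^-1%g != 0 -> a u == a y /\ a y == a v.
  rewrite mulf_eq0 negb_or => /andP[/eqP/gam_afun[_ ->] /eqP/gam_afun[]].
  by rewrite !(afunV P) => -> ->.
have aR u : gam H y z u^-1%g * gam H x u v^-1%g != 0 -> a u == a y /\ a y == a v.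
  rewrite mulf_eq0 negb_or => /andP[/eqP/gam_afun[-> ->] /eqP/gam_afun[_]].
  by rewrite !(afunV P) => ->.
have [yv|yv] := eqVneq (a y) (a v); last first.
  by rewrite !big1 // => u _; apply/eqP; apply: contraNT yv; [case/aR | case/aL].
have drop (F : W -> int) : (forall u, F u != 0 -> a u == a y) ->
    \sum_u F u = \sum_(u | a u == a y) F u.
  move=> HF; rewrite [RHS]big_mkcond; apply: eq_bigr => u _.
  by case: ifPn => // auy; apply/eqP; apply: contraNT auy; apply: HF.
rewrite drop; last by move=> u /aL[].
rewrite [RHS]drop; last by move=> u /aR[].
have := congr1 (fun f => lcoef f (a v)%:Z) (p15_gam cox P x z yv).
rewrite !lcoef_sum => E; symmetry; etransitivity; last (etransitivity; first exact: E).
  by apply: eq_bigr => u _; rewrite lcoefMz -gamE mulrC.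
by apply: eq_bigr => u /eqP au; rewrite lcoefMz -yv -au -gamE.
Qed.

Section Base.
Variable B : comNzRingType.
Implicit Types f g : {ffun W -> B}.
Local Notation jmul := (@jmul _ _ _ H B).

Lemma jmulDl f f' g : jmul (f + f') g = jmul f g + jmul f' g.
Proof.
apply/ffunP => u; rewrite !ffunE -big_split; apply: eq_bigr => x _ /=.
by rewrite -big_split; apply: eq_bigr => y _ /=; rewrite !ffunE !mulrDl.
Qed.

Lemma jmulDr f g g' : jmul f (g + g') = jmul f g + jmul f g'.
Proof.
apply/ffunP => u; rewrite !ffunE -big_split; apply: eq_bigr => x _ /=.
by rewrite -big_split; apply: eq_bigr => y _ /=; rewrite !ffunE mulrDr mulrDl.
Qed.

Lemma jmul0l g : jmul 0 g = 0.
Proof. by apply: (addrI (jmul 0 g)); rewrite -jmulDl !addr0. Qed.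

Lemma jmul0r f : jmul f 0 = 0.
Proof. by apply: (addrI (jmul f 0)); rewrite -jmulDr !addr0. Qed.

Lemma jmul_suml (I : Type) (r : seq I) (Q : pred I) (F : I -> {ffun W -> B}) g :
  jmul (\sum_(i <- r | Q i) F i) g = \sum_(i <- r | Q i) jmul (F i) g.
Proof. by rewrite (big_morph (jmul^~ g) (fun f f' => jmulDl f f' g) (jmul0l g)). Qed.

Lemma jmulA f g h : jmul f (jmul g h) = jmul (jmul f g) h.
Proof.
apply/ffunP => v; rewrite !ffunE.
transitivity (\sum_x \sum_y \sum_z
   f x * g y * h z * (\sum_u gam H y z u^-1%g * gam H x u v^-1%g)%:~R).
  apply: eq_bigr => x _.
  under eq_bigr => u _.
    rewrite ffunE mulr_sumr mulr_suml.
    under eq_bigr => y _ do rewrite mulr_sumr mulr_suml.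
  over.
  rewrite exchange_big; apply: eq_bigr => y _ /=; rewrite exchange_big.
  apply: eq_bigr => z _ /=; rewrite rmorph_sum mulr_sumr; apply: eq_bigr => u _ /=.
  by rewrite rmorphM /= !mulrA.
under eq_bigr => x _ do under eq_bigr => y _ do under eq_bigr => z _ do rewrite -gam_assoc.
under [RHS]eq_bigr => u _.
  under eq_bigr => z _.
    rewrite ffunE mulr_suml mulr_suml.
    under eq_bigr => x _ do rewrite mulr_suml mulr_suml.
  over.
  rewrite exchange_big.
over.
rewrite [RHS]exchange_big; apply: eq_bigr => x _ /=.
under [RHS]eq_bigr => u _ do rewrite exchange_big.
rewrite [RHS]exchange_big; apply: eq_bigr => y _ /=.
rewrite [RHS]exchange_big; apply: eq_bigr => z _ /=.
rewrite rmorph_sum mulr_sumr; apply: eq_bigr => u _ /=.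
by rewrite rmorphM /= !mulrA; congr (_ * _); rewrite mulrAC.
Qed.

(** Covers 1_J, t_c and the single n_d t_d at once, as well as the t_{c'} of the other two-sided
    cells. *)
Definition jD (Q : pred W) : {ffun W -> B} :=
  [ffun z => if (z \in D) && Q z then (nz H z)%:~R else 0].

(** (P7) moves the index d to the third place, where [nz_gam] applies. The product from the left
    selects right cells, that from the right selects left cells. *)
Lemma jmul_jDl Q f u : jmul (jD Q) f u = if Q (dd u^-1%g) then f u else 0.
Proof.
rewrite ffunE exchange_big (bigD1 u) //= [X in _ + X]big1 ?addr0 => [|y yu].
  transitivity (f u * (\sum_(d in D | Q d) nz H d * gam H u u^-1%g d)%:~R).
    rewrite rmorph_sum mulr_sumr [RHS]big_mkcond; apply: eq_bigr => x _; rewrite ffunE.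
    case: ifP => _; last by rewrite !mul0r.
    by rewrite (p7 P) rmorphM /= mulrA [_ * f u]mulrC.
  by rewrite (nz_gam P) invgK eqxx; case: (Q _); rewrite ?mulr1 ?mulr0.
transitivity (f y * (\sum_(d in D | Q d) nz H d * gam H y u^-1%g d)%:~R).
  rewrite rmorph_sum mulr_sumr [RHS]big_mkcond; apply: eq_bigr => x _; rewrite ffunE.
  case: ifP => _; last by rewrite !mul0r.
  by rewrite (p7 P) rmorphM /= mulrA [_ * f y]mulrC.
by rewrite (nz_gam P) invgK (negPf yu) mulr0.
Qed.

Lemma jmul_jDr Q f u : jmul f (jD Q) u = if Q (dd u) then f u else 0.
Proof.
have E x : \sum_y f x * jD Q y * (gam H x y u^-1%g)%:~R =
    f x * ((u == x) && Q (dd x))%:R.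
  have -> : ((u == x) && Q (dd x))%:R = (\sum_(d in D | Q d) nz H d * gam H u^-1%g x d)%:~R :> B.
    by rewrite (nz_gam P) (inj_eq invg_inj) mulrz_nat.
  rewrite rmorph_sum mulr_sumr [RHS]big_mkcond; apply: eq_bigr => d _; rewrite ffunE.
  case: ifP => _; last by rewrite mulr0 mul0r.
  by rewrite -(p7 P) rmorphM /= !mulrA.
rewrite ffunE; under eq_bigr => x _ do rewrite E.
rewrite (bigD1 u) //= eqxx big1 ?addr0 => [|x]; last by rewrite eq_sym => /negPf ->; rewrite mulr0.
by case: (Q _); rewrite ?mulr1 ?mulr0.
Qed.

Definition jone : {ffun W -> B} := jD predT.

Lemma jmul1l f : jmul jone f = f.
Proof. by apply/ffunP => u; rewrite jmul_jDl. Qed.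

Lemma jt_jD d : d \in D -> jt B d *~ nz H d = jD (pred1 d).
Proof.
move=> dD; apply/ffunP => z; rewrite ffunMzE !ffunE /=.
have [->|_] := eqVneq z d; first by rewrite dD.
by rewrite andbF mul0rz.
Qed.

Lemma jtc_jD (C : {set W}) : jtc H B C = jD (mem C).
Proof.
apply/ffunP => z; rewrite sum_ffunE !ffunE.
under eq_bigr => d _ do rewrite ffunMzE !ffunE.
case: ifP => [zDC|zDC].
  have zI : z \in D :&: C by rewrite finset.in_setI.
  rewrite (bigD1 z zI) /= eqxx big1 ?addr0 // => d /andP[_].
  by rewrite eq_sym => /negPf ->; rewrite mul0rz.
rewrite big1 // => d dDC; case: eqP => [E|_]; rewrite ?mul0rz //.
by rewrite -E finset.in_setI zDC in dDC.
Qed.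

Definition jtau f : B := \sum_(d in D) (nz H d)%:~R * f d.

Lemma jtauM f g : jtau (jmul f g) = \sum_x f x * g x^-1%g.
Proof.
transitivity (\sum_x \sum_y f x * g y * (\sum_(d in D | predT d) nz H d * gam H x y d)%:~R).
  rewrite /jtau; under eq_bigr => d _.
    rewrite ffunE mulr_sumr; under eq_bigr => x _ do rewrite mulr_sumr.
  over.
  rewrite exchange_big; apply: eq_bigr => x _ /=; rewrite exchange_big.
  apply: eq_bigr => y _ /=; rewrite rmorph_sum mulr_sumr.
  rewrite [RHS](eq_bigl (fun d => d \in D)) => [|d]; last exact: andbT.
  by apply: eq_bigr => d dD; rewrite (Dset_inv P) // rmorphM /= mulrCA.
apply: eq_bigr => x _; rewrite (bigD1 x^-1%g) //= (nz_gam P) invgK eqxx mulr1.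
rewrite big1 ?addr0 // => y yx; rewrite (nz_gam P) -(inj_eq invg_inj) invgK eq_sym.
by rewrite (negPf yx) mulr0.
Qed.

Lemma jtauC f g : jtau (jmul f g) = jtau (jmul g f).
Proof.
rewrite !jtauM (reindex_inj invg_inj); apply: eq_bigr => x _.
by rewrite invgK mulrC.
Qed.

End Base.

Lemma jmul_map (B B' : comNzRingType) (phi : {rmorphism B -> B'}) (f g : {ffun W -> B}) :
  [ffun u => phi (jmul H f g u)] = jmul H [ffun x => phi (f x)] [ffun x => phi (g x)].
Proof.
apply/ffunP => u; rewrite !ffunE rmorph_sum; apply: eq_bigr => x _.
rewrite rmorph_sum; apply: eq_bigr => y _ /=.
by rewrite !ffunE !rmorphM /= rmorph_int.
Qed.

End JRing.

(** * The homomorphism phi *)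

Section Phi.
Variables (W : finGroupType) (S : {set W}) (L : W -> int) (H : hecke S L).
Hypothesis cox : coxeter_system S.
Hypothesis P : P1_15 H.
Implicit Types (u w x y z d : W) (g h : H) (j : {ffun W -> laurent}).
Local Notation a := (afun H).
Local Notation D := (Dset H).
Local Notation dd := (dd H).
Local Notation cc := (coords (hc H)).
Local Notation CB := (@hc_basis _ _ _ H).
Local Notation len := (len S).
Let T1 := hT1 cox P.

(* The left H-module gr H = (+)_n H_{a >= n} / H_{a > n}, carried over to A (x) J
   by c_w |-> \hat n_w t_w.  By (P15) it commutes with right multiplication in J,
   so that h acts as left multiplication by the image h 1_J. *)
Definition jact h j : {ffun W -> laurent} :=
  [ffun y => \sum_(w | a w == a y) cc (h * hc H w) y * (nhat H w * nhat H y)%:~R * j w].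

Lemma jactP c g h j y : jact (c *: g + h) j y = c * jact g j y + jact h j y.
Proof.
rewrite !ffunE mulr_sumr -big_split; apply: eq_bigr => w _ /=.
by rewrite mulrDl -scalerAl (coordsP CB) !mulrDl !mulrA.
Qed.

Lemma jact1 j : jact 1 j = j.
Proof.
apply/ffunP => y; rewrite ffunE (bigD1 y) //= mul1r (coords_b CB) eqxx mul1r (nhat_sq P).
rewrite mul1r big1 ?addr0 // => w /andP[_ wy].
by rewrite mul1r (coords_b CB) eq_sym (negPf wy) !mul0r.
Qed.

Lemma jactM g h j : jact (g * h) j = jact g (jact h j).
Proof.
apply/ffunP => y; rewrite !ffunE.
(* A term through c_u has y <=_L u <=_L w, so that (P4) removes every u with another value of a. *)
have E w : a w == a y -> cc (g * h * hc H w) y =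
    \sum_(u | a u == a y) cc (g * hc H u) y * cc (h * hc H w) u.
  move=> /eqP wy; rewrite -mulrA {1}(coordsE CB (h * _)) mulr_sumr (coords_sum CB).
  rewrite [RHS]big_mkcond; apply: eq_bigr => u _; rewrite -scalerAr (coordsZ CB) mulrC.
  case: ifPn => // au.
  have [->|/(leL_cc cox T1)/(afun_leL P) uw] := eqVneq (cc (h * hc H w) u) 0.
    by rewrite mulr0.
  have [->|/(leL_cc cox T1)/(afun_leL P) yu] := eqVneq (cc (g * hc H u) y) 0.
    by rewrite mul0r.
  by rewrite eqn_leq yu -wy uw in au.
under eq_bigr => w wy do rewrite (E w wy) !mulr_suml.
rewrite exchange_big /=; apply: eq_bigr => u /eqP uy; rewrite ffunE uy mulr_sumr.
apply: eq_bigr => w _; rewrite !rmorphM /=.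
have nu : (nhat H u)%:~R * (nhat H u)%:~R = 1 :> laurent by rewrite -rmorphM (nhat_sq P).
move: ((nhat H u)%:~R : laurent) ((nhat H w)%:~R : laurent) ((nhat H y)%:~R : laurent) nu.
move=> p q r nu.
by rewrite -[LHS]mul1r -nu; ring.
Qed.

(** For a(w) <> a(y) both sides vanish. Otherwise this is (P15): a nonzero gamma equates \hat n_u
    with \hat n_w on the left and with \hat n_y on the right, so that the same sign factors out of
    both sums. *)
Lemma jact_jmul_coef h w x y :
  \sum_(u | a u == a y) cc (h * hc H u) y * (nhat H u * nhat H y)%:~R *
     (gam H w x u^-1%g)%:~R =
  \sum_(u | a u == a w) cc (h * hc H w) u * (nhat H w * nhat H u)%:~R *
     (gam H u x y^-1%g)%:~R.
Proof.
have [wy|wy] := eqVneq (a w) (a y); last first.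
  rewrite !big1 // => u /eqP au.
    have [->|/eqP/(gam_afun P)[wx xy]] := eqVneq (gam H u x y^-1%g) 0; first by rewrite mulr0.
    by rewrite -au wx xy (afunV P) eqxx in wy.
  have [->|/eqP/(gam_afun P)[wx xy]] := eqVneq (gam H w x u^-1%g) 0; first by rewrite mulr0.
  by rewrite wx xy (afunV P) au eqxx in wy.
transitivity ((nhat H w * nhat H y)%:~R *
    \sum_(u | a u == a w) cc (h * hc H u) y * (gam H w x u^-1%g)%:~R).
  rewrite mulr_sumr wy; apply: eq_bigr => u _.
  have [->|/eqP/(gam_nhat P) ->] := eqVneq (gam H w x u^-1%g) 0; first by rewrite !mulr0.
  by rewrite mulrCA mulrA.
rewrite (p15_act cox P h x wy) mulr_sumr; apply: eq_bigr => u _.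
have [->|/eqP/(gam_nhat P) ->] := eqVneq (gam H u x y^-1%g) 0; first by rewrite !mulr0.
by rewrite mulrCA mulrA.
Qed.

Lemma jact_jmul h j j' : jact h (jmul H j j') = jmul H (jact h j) j'.
Proof.
apply/ffunP => y; rewrite !ffunE.
transitivity (\sum_w \sum_x j w * j' x *
   \sum_(u | a u == a y) cc (h * hc H u) y * (nhat H u * nhat H y)%:~R *
      (gam H w x u^-1%g)%:~R).
  under eq_bigr => u _.
    rewrite ffunE mulr_sumr; under eq_bigr => w _ do rewrite mulr_sumr.
  over.
  rewrite exchange_big; apply: eq_bigr => w _ /=; rewrite exchange_big.
  by apply: eq_bigr => x _ /=; rewrite mulr_sumr; apply: eq_bigr => u _; rewrite mulrCA.
under eq_bigr => w _ do under eq_bigr => x _ do rewrite jact_jmul_coef big_mkcond mulr_sumr.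
under [RHS]eq_bigr => u _.
  under eq_bigr => x _ do rewrite ffunE !mulr_suml big_mkcond.
  rewrite exchange_big.
over.
rewrite [RHS]exchange_big; apply: eq_bigr => w _ /=.
rewrite [RHS]exchange_big; apply: eq_bigr => x _ /=.
apply: eq_bigr => u _; rewrite eq_sym; case: ifP => _; last by rewrite mulr0.
by ring.
Qed.

Lemma jactE h j : jact h j = jmul H (jact h (jone H laurent)) j.
Proof. by rewrite -jact_jmul (jmul1l P). Qed.

Lemma jact_one h z : jact h (jone H laurent) z =
  \sum_(d in D | a z == a d) cc (h * hc H d) z * (nhat H z)%:~R.
Proof.
rewrite ffunE big_mkcond [RHS]big_mkcond; apply: eq_bigr => d _.
rewrite ffunE andbT andbC eq_sym; case: ifP => _; last by [].
case: ifP => [dD|_] /=; last by rewrite mulr0.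
by rewrite -mulrA -rmorphM /= (nhat_D P) // mulrAC (nz_sq P) // mul1r.
Qed.

Lemma jphiE h : jphi h = jact (hdag H h) (jone H laurent).
Proof.
apply/ffunP => z; rewrite jact_one ffunE.
under eq_bigr => w _ do rewrite mulr_sumr.
rewrite exchange_big; apply: eq_bigr => d _ /=.
rewrite [in RHS](coordsE CB (hdag H h)) mulr_suml (coords_sum CB) mulr_suml.
by apply: eq_bigr => w _; rewrite -scalerAl (coordsZ CB) mulrA.
Qed.

Lemma jphi_1 : jphi (1 : H) = jone H laurent.
Proof. by rewrite jphiE rmorph1 jact1. Qed.

Lemma jphiM g h : jphi (g * h) = jmul H (jphi g) (jphi h).
Proof. by rewrite !jphiE rmorphM /= jactM [LHS]jactE. Qed.

Lemma jphiP c g h z : jphi (c *: g + h) z = c * jphi g z + jphi h z.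
Proof. by rewrite !jphiE linearP jactP. Qed.

Lemma jphiD g h z : jphi (g + h) z = jphi g z + jphi h z.
Proof. by rewrite -[g]scale1r jphiP mul1r scale1r. Qed.

Lemma jphi0 z : jphi (0 : H) z = 0.
Proof. by apply: (addrI (jphi (0 : H) z)); rewrite -jphiD !addr0. Qed.

Lemma jphiZ c g z : jphi (c *: g) z = c * jphi g z.
Proof. by rewrite -[c *: g]addr0 jphiP jphi0 addr0. Qed.

(** Diagonal coefficients are not affected by passing to the graded module, so that the trace of
    h^dagger on H is a function of phi(h). The injectivity of phi_1 comes from here. *)
Lemma jphi_diag h y : cc (hdag H h * hc H y) y = \sum_z jphi h z * (gam H z y y^-1%g)%:~R.
Proof.
have jtE w : jt laurent y w = (w == y)%:R by rewrite ffunE.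
have E : jact (hdag H h) (jt laurent y) y = cc (hdag H h * hc H y) y.
  rewrite ffunE (bigD1 y) //= jtE eqxx (nhat_sq P) !mulr1 big1 ?addr0 // => w /andP[_ wy].
  by rewrite jtE (negPf wy) mulr0.
rewrite -E jactE -jphiE; move: (jphi h) => f; rewrite ffunE; apply: eq_bigr => z _.
rewrite (bigD1 y) //= jtE eqxx mulr1 big1 ?addr0 // => w wy.
by rewrite jtE (negPf wy) mulr0 mul0r.
Qed.

(* The term of lowest degree of phi(T_w) is [jsign w] v^(- a(w)) t_w. *)
Definition jsign w : int := (-1) ^+ len w * (nz H (dd w) * nhat H w).

(** By [cc_T] the leading term sees T_w as c_w. The coefficient of v^(a(z)) in h_{w,d,z} is
    gamma_{w,d,z^-1} = gamma_{z^-1,w,d}, and [sum_gam] leaves only z = w. *)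
Lemma jact_T_lead w z : degle (a z)%:Z (jact (hT H w) (jone H laurent) z) /\
  lcoef (jact (hT H w) (jone H laurent) z) (a z)%:Z = (w == z)%:R * (nz H (dd w) * nhat H w).
Proof.
pose K x := jact (hc H x) (jone H laurent) z.
have -> : jact (hT H w) (jone H laurent) z = \sum_x cc (hT H w) x * K x.
  rewrite jact_one; under [RHS]eq_bigr => x _ do rewrite /K jact_one mulr_sumr.
  rewrite exchange_big; apply: eq_bigr => d _ /=.
  rewrite {1}(coordsE CB (hT H w)) mulr_suml (coords_sum CB) mulr_suml.
  by apply: eq_bigr => x _; rewrite -scalerAl (coordsZ CB) mulrA.
have degK x : degle (a z)%:Z (K x).
  by rewrite /K jact_one; apply: degle_sum => d _; apply/degleMz/(afun_degle cox P).
have topK x : lcoef (K x) (a z)%:Z = (x == z)%:R * (nz H (dd x) * nhat H x).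
  rewrite /K jact_one lcoef_sum.
  transitivity (\sum_(d in D | a z == a d) nhat H z * gam H z^-1%g x d).
    by apply: eq_bigr => d _; rewrite lcoefMz -(p7 P) mulrC -(p7 P) gamE.
  rewrite (sum_gam P) (inj_eq invg_inj) [z == x]eq_sym [_ * nz _ _]mulrC.
  case: eqP => [->|_] /=; last by rewrite !mul0r.
  by rewrite (afun_simL P (dd_simL P z)) eqxx.
have deg0 x : degle 0 (cc (hT H w) x).
  rewrite -[coords _ _ _](subrK (x == w)%:R); apply: degleD.
    by apply: degleW (cc_T cox T1 w x).
  by case: eqP => _; [apply: degle1 | apply: degle0].
split; first by apply: degle_sum => x _; rewrite -[(a z)%:Z]add0r; apply: degleM.
rewrite lcoef_sum; transitivity (\sum_x (x == w)%:R * ((x == z)%:R * (nz H (dd x) * nhat H x))).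
  apply: eq_bigr => x _; rewrite (lcoefM_top (deg0 x) (degK x)) ?add0r // eqxx mul1r topK.
  congr (_ * _); rewrite -[coords _ _ _](subrK (x == w)%:R) lcoefD (cc_T cox T1 w x) // add0r.
  by case: eqP => _; rewrite ?lcoef1 ?lcoef_at0.
rewrite (bigD1 w) //= eqxx mul1r big1 ?addr0 // => x /negPf ->; by rewrite mul0r.
Qed.

Lemma jact_hbar h z :
  jact (hbar H h) (jone H laurent) z = lbar (jact h (jone H laurent) z).
Proof.
rewrite !jact_one lbar_sum; apply: eq_bigr => d _.
by rewrite lbarMz -cc_hbar rmorphM /= hc_bar.
Qed.

Lemma jphi_T_lead w z : (forall k, k < - (a z)%:Z -> lcoef (jphi (hT H w) z) k = 0) /\
  lcoef (jphi (hT H w) z) (- (a z)%:Z) = (w == z)%:R * jsign w.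
Proof.
have E k : lcoef (jphi (hT H w) z) k =
    lcoef (jact (hT H w) (jone H laurent) z) (- k) * (-1) ^+ len w.
  rewrite jphiE (hdag_hbar cox T1) -[_ *: _]addr0 jactP jact_hbar.
  have -> : jact 0 (jone H laurent) z = 0.
    by rewrite jact_one big1 // => d _; rewrite mul0r (coords0 CB) mul0r.
  by rewrite addr0 -lcoef_lbar mulrC -lcoefMz rmorphXn rmorphN1.
have [d t] := jact_T_lead w z; split=> [k kz|]; rewrite E.
  by rewrite d ?mul0r //; lia.
by rewrite opprK t -mulrA [_ * (-1) ^+ _]mulrC.
Qed.

(** Passing to w^-1 exchanges the two signs n_d and preserves the length. The signs thus disappear
    from the products that make up c_E. *)
Lemma jsignV w : jsign w * jsign w^-1%g = 1.
Proof.
have key (e p q : int) : e * e = 1 -> p * p = 1 -> q * q = 1 ->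
    e * (p * q) * (e * (q * p)) = 1.
  move=> ee pp qq; have -> : e * (p * q) * (e * (q * p)) = e * e * (p * p) * (q * q) by ring.
  by rewrite ee pp qq.
have D1 x : dd x \in D by have [] := ddP P x.
rewrite /jsign (len_inv cox) !(nhatE P) invgK.
apply: key; [| exact: nz_sq P _ _ | exact: nz_sq P _ _].
by rewrite -expr2 sqrr_sign.
Qed.

End Phi.

(** * Specialization at v = 1 *)

Section KernelMatrix.
Variables (I : finType) (F : fieldType) (k : I -> I -> F).

Definition kmx : 'M[F]_#|I| := \matrix_(i, j) k (enum_val i) (enum_val j).

Lemma kmx_mul (x : I -> F) j :
  ((\row_i x (enum_val i)) *m kmx) 0 j = \sum_i x i * k i (enum_val j).
Proof.
rewrite mxE (reindex (@enum_val I predT)); last exact/onW_bij/enum_val_bij.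
by apply: eq_bigr => i _; rewrite !mxE.
Qed.

Lemma kmx_unit : (forall x : {ffun I -> F}, (forall j, \sum_i x i * k i j = 0) -> x = 0) ->
  kmx \in unitmx.
Proof.
move=> k_inj; rewrite -row_free_unit; apply: inj_row_free => v v0.
pose x := [ffun i => v 0 (enum_rank i)].
have Ev : v = \row_i x (enum_val i) by apply/rowP => i; rewrite !mxE ffunE enum_valK.
suff x0 : x = 0 by apply/rowP => i; rewrite Ev x0 !mxE ffunE.
apply: k_inj => j; rewrite -(enum_rankK j) -kmx_mul.
by rewrite -Ev v0 mxE.
Qed.

Lemma kmx_solve : kmx \in unitmx ->
  forall y : I -> F, exists x : {ffun I -> F}, forall j, \sum_i x i * k i j = y j.
Proof.
move=> ku y; pose v := (\row_i y (enum_val i)) *m invmx kmx.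
exists [ffun i => v 0 (enum_rank i)] => j; rewrite -{1}(enum_rankK j) -kmx_mul.
rewrite (_ : \row_i _ = v); last by apply/rowP => i; rewrite mxE ffunE enum_valK.
by rewrite /v mulmxKV // mxE enum_rankK.
Qed.

End KernelMatrix.

Section Specialization.
Variables (R0 : realType).
Variables (W : finGroupType) (S : {set W}) (L : W -> int) (H : hecke S L).
Hypothesis cox : coxeter_system S.
Hypothesis P : P1_15 H.
Local Notation C := R0[i].
Implicit Types (u w x y z d : W) (h : H) (j f g : {ffun W -> C}).
Local Notation cc := (coords (hc H)).
Local Notation cT := (coords (hT H)).
Local Notation CB := (@hc_basis _ _ _ H).
Local Notation TB := (@hT_basis _ _ _ H).
Local Notation len := (len S).
Let T1 := hT1 cox P.
Let C1 : (1 : C) != 0 := oner_neq0 _.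
Local Notation lev1 := (levm C1).

Lemma lev1_xi s : lev1 (xi L s) = 0.
Proof. by rewrite /xi rmorphB /= /levm !lev_lmono ?exp1rz ?subrr // oner_neq0. Qed.

Definition jT w : {ffun W -> C} := [ffun z => lev1 (jphi (hT H w) z)].

Lemma jphi1E f : jphi1 H f = [ffun z => \sum_w f w * jT w z].
Proof.
by apply/ffunP => z; rewrite ffunE [RHS]ffunE; apply: eq_bigr => w _; rewrite [jT w z]ffunE.
Qed.

Lemma jT1 : jT 1%g = jone H C.
Proof.
apply/ffunP => z; rewrite ffunE T1 jphi_1 // !ffunE.
by case: ifP => _; rewrite ?rmorph_int ?rmorph0.
Qed.

Lemma jT_gen s w : s \in S -> jT (s * w)%g = jmul H (jT s) (jT w).
Proof.
move=> sS; rewrite -jmul_map; apply/ffunP => z; rewrite ffunE [RHS]ffunE -jphiM //.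
have [up down] := hT_mul H w sS; case: (len_mulS cox w sS) => lw; first by rewrite up.
by rewrite down // -/(xi L s) jphiD // jphiZ // rmorphD rmorphM /= lev1_xi mul0r addr0.
Qed.

Lemma jTM x y : jT (x * y)%g = jmul H (jT x) (jT y).
Proof.
elim/(len_ind cox): x y => [|s x sS _ IH] y; first by rewrite mul1g jT1 jmul1l.
by rewrite -mulgA !(jT_gen _ sS) IH jmulA.
Qed.

Lemma lev1_hT s h z : s \in S -> lev1 (cT (hT H s * h) z) = lev1 (cT h (s * z)%g).
Proof.
move=> sS; rewrite {1}(coordsE TB h) mulr_sumr (coords_sum TB) rmorph_sum (bigD1 (s * z)%g) //=.
have E w : lev1 (cT (hT H s * hT H w) z) = (z == s * w)%g%:R.
  have [up down] := hT_mul H w sS; case: (len_mulS cox w sS) => lw.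
    by rewrite up // (coords_b TB) rmorph_nat.
  rewrite down // -/(xi L s) (coordsD TB) (coordsZ TB) rmorphD rmorphM /= lev1_xi mul0r addr0.
  by rewrite (coords_b TB) rmorph_nat.
rewrite -scalerAr (coordsZ TB) rmorphM /= E mulgA (coxK cox sS) mul1g eqxx mulr1.
rewrite big1 ?addr0 // => w wsz; rewrite -scalerAr (coordsZ TB) rmorphM /= E.
case: eqP => [zE|]; last by rewrite mulr0.
by rewrite zE mulgA (coxK cox sS) mul1g eqxx in wsz.
Qed.

Lemma lev1_hdag w h z :
  lev1 (cT (hdag H (hT H w) * h) z) = (-1) ^+ len w * lev1 (cT h (w^-1 * z)%g).
Proof.
elim/(len_ind cox): w h z => [|s w sS lw IH] h z.
  by rewrite T1 rmorph1 mul1r (len1 cox) mul1r invg1 mul1g.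
rewrite -(hT_up H sS lw) rmorphM -mulrA /= (hdag_Ts H cox sS) (hbar_Ts cox T1 sS) mulNr.
rewrite mulrBl mulr_algl (coordsN TB) (coordsB TB) (coordsZ TB) rmorphN rmorphB rmorphM /=.
rewrite lev1_xi mul0r subr0 lev1_hT // IH lw exprS mulN1r mulNr.
by rewrite invMg (coxV cox sS) mulgA.
Qed.

(** Both sides are the trace of T_w^dagger on H at v = 1. On the basis T_y it is (-1)^(len w) times
    the number of fixed points of translation by w^-1, which is nonzero only for w = 1, where the
    sign is 1. *)
Lemma jT_trace w :
  \sum_y \sum_z jT w z * (gam H z y y^-1%g)%:~R = #|W|%:R * (w == 1%g)%:R.
Proof.
transitivity (lev1 (\sum_y cc (hdag H (hT H w) * hc H y) y)).
  rewrite rmorph_sum; apply: eq_bigr => y _; rewrite jphi_diag // rmorph_sum.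
  by apply: eq_bigr => z _; rewrite ffunE rmorphM /= rmorph_int.
have lmul (c : laurent) (g h : H) : hdag H (hT H w) * (c *: g + h) =
    c *: (hdag H (hT H w) * g) + hdag H (hT H w) * h by rewrite mulrDr scalerAr.
rewrite (trace_basis CB TB lmul) rmorph_sum /=.
under eq_bigr => y _ do rewrite lev1_hdag (coords_b TB) rmorph_nat -{2}[y]mul1g (inj_eq (mulIg y)).
rewrite -mulr_sumr sumr_const invg_eq1.
by case: eqP => [->|_]; rewrite ?mul0rn ?mulr0 ?mulr1 // (len1 cox) mul1r.
Qed.

Lemma jphi1_mul f g z :
  jmul H (jphi1 H f) (jphi1 H g) z = \sum_u \sum_w f u * g w * jT (u * w)%g z.
Proof.
rewrite !jphi1E ffunE.
under [RHS]eq_bigr => u _.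
  under eq_bigr => w _.
    rewrite jTM ffunE mulr_sumr; under eq_bigr => x _ do rewrite mulr_sumr.
  over.
  rewrite exchange_big /=; under eq_bigr => x _ do rewrite exchange_big /=.
over.
rewrite [RHS]exchange_big; apply: eq_bigr => x _.
rewrite [RHS]exchange_big; apply: eq_bigr => y _; rewrite !ffunE !mulr_suml.
apply: eq_bigr => u _; rewrite mulr_sumr mulr_suml; apply: eq_bigr => w _ /=; ring.
Qed.

Lemma jphi1_jt w : jphi1 H (jt C w) = jT w.
Proof.
apply/ffunP => z; rewrite jphi1E ffunE (bigD1 w) //= ffunE eqxx mul1r big1 ?addr0 // => x xw.
by rewrite ffunE (negPf xw) mul0r.
Qed.

(** The kernel is an ideal, so it contains f x^-1 for each x, and the form of [jT_trace] reads off
    #|W| f(x) there. *)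
Lemma jphi1_inj f : jphi1 H f = 0 -> f = 0.
Proof.
move=> f0; apply/ffunP => x; rewrite [RHS]ffunE.
have E z : \sum_y f y * jT (y * x^-1)%g z = 0.
  have := jphi1_mul f (jt C x^-1%g) z; rewrite f0 jmul0l [LHS]ffunE => E0.
  rewrite [RHS]E0; apply: eq_bigr => y _.
  have jtE w : jt C x^-1%g w = (w == x^-1%g)%:R by rewrite ffunE.
  rewrite (bigD1 x^-1%g) //= jtE eqxx mulr1 big1 ?addr0 // => w wx.
  by rewrite jtE (negPf wx) mulr0 mul0r.
have : \sum_y f y * (#|W|%:R * (y * x^-1 == 1)%g%:R) = 0.
  under eq_bigr => y _.
    rewrite -jT_trace mulr_sumr; under eq_bigr => u _ do rewrite mulr_sumr.
  over.
  rewrite exchange_big big1 // => u _; rewrite exchange_big big1 // => z _.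
  by under eq_bigr => y _ do rewrite mulrA; rewrite -mulr_suml E mul0r.
rewrite (bigD1 x) //= mulgV eqxx mulr1 big1 ?addr0 => [/eqP|y yx]; last first.
  by rewrite -eq_mulgV1 (negPf yx) !mulr0.
have W0 : (#|W| != 0)%N by rewrite -lt0n; apply/card_gt0P; exists x.
by rewrite mulf_eq0 pnatr_eq0 (negPf W0) orbF => /eqP.
Qed.

Lemma jT_kmx : kmx jT \in unitmx.
Proof.
apply: kmx_unit => f f0; apply: jphi1_inj; rewrite jphi1E.
by apply/ffunP => z; rewrite !ffunE.
Qed.

Lemma jphi1_surj f : exists x : {ffun W -> C}, jphi1 H x = f.
Proof.
have [x Hx] := kmx_solve jT_kmx f; exists x.
by rewrite jphi1E; apply/ffunP => z; rewrite ffunE Hx.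
Qed.

Lemma jphi1_invK f : jphi1 H (jphi1_inv H f) = f.
Proof. exact: (xgetPex 0 (jphi1_surj f)). Qed.

Lemma jphi1K f : jphi1_inv H (jphi1 H f) = f.
Proof.
have E z := congr1 (fun f : {ffun _} => f z) (jphi1_invK (jphi1 H f)).
move: (jphi1_inv _ _) E => x E; apply/eqP; rewrite -subr_eq0; apply/eqP/jphi1_inj.
apply/ffunP => z; move: (E z); rewrite !jphi1E !ffunE => /eqP.
rewrite -subr_eq0 -sumrB => /eqP E'; rewrite -[RHS]E'.
by apply: eq_bigr => w _; rewrite -mulrBl; congr (_ * _); rewrite !ffunE.
Qed.

Lemma jphi1_invE f w : jphi1_inv H f w = \sum_z f z * jphi1_inv H (jt C z) w.
Proof.
pose x := [ffun w => \sum_z f z * jphi1_inv H (jt C z) w].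
suff E : jphi1 H x = f by rewrite -{1}E jphi1K ffunE.
have E z u : \sum_y jphi1_inv H (jt C z) y * jT y u = (u == z)%:R.
  have := congr1 (fun g : {ffun W -> C} => g u) (jphi1_invK (jt C z)).
  by rewrite jphi1E ffunE => ->; rewrite ffunE.
apply/ffunP => u; rewrite jphi1E ffunE.
under eq_bigr => y _ do rewrite ffunE mulr_suml.
rewrite exchange_big (bigD1 u) //= [X in _ + X]big1 ?addr0 => [|z zu].
  by under eq_bigr => y _ do rewrite -mulrA; rewrite -mulr_sumr E eqxx mulr1.
by under eq_bigr => y _ do rewrite -mulrA; rewrite -mulr_sumr E eq_sym (negPf zu) mulr0.
Qed.

End Specialization.

(** * The group algebra *)

Section GroupAlgebra.
Variables (R0 : realType) (W : finGroupType).
Local Notation C := R0[i].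
Local Notation Irr := (IrrW R0 W).
Implicit Types (E F : Irr) (f g : {ffun W -> C}) (w x y : W).
Local Notation deg := (@irr_degree _ _ _ Irr).
Local Notation aG := (regular_repr C [set: W]%G).

Definition galg E f : 'M[C]_(deg E) := \sum_w f w *: irr_repr E w.

Definition gmul f g : {ffun W -> C} := [ffun u => \sum_w f w * g (w^-1 * u)%g].

Lemma split_irr : group_splitting_field C [set: W]%G.
Proof. exact: group_closure_closed_field. Qed.

Lemma pchar_irr : ([pchar C]^'.-group [set: W])%g.
Proof. by rewrite /pgroup pcharf'_nat pnatr_eq0 -lt0n cardG_gt0. Qed.

Lemma irr_abs_irr E : mx_absolutely_irreducible (irr_repr E).
Proof. exact/split_irr/socle_irr. Qed.

Lemma galg_gmul E f g : galg E (gmul f g) = galg E f *m galg E g.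
Proof.
rewrite /galg mulmx_suml; under eq_bigr => u _ do rewrite ffunE scaler_suml.
rewrite exchange_big; apply: eq_bigr => w _ /=; rewrite mulmx_sumr.
rewrite (reindex_inj (mulgI w)); apply: eq_bigr => x _ /=.
by rewrite mulKg -scalemxAl -scalemxAr scalerA repr_mxM ?inE.
Qed.

Lemma galg_id E : exists f, forall F, galg F f = (F == E)%:R%:M.
Proof.
have : (Wedderburn_id E \in enveloping_algebra_mx aG)%MS.
  by rewrite -(Wedderburn_sum_pchar Irr pchar_irr) (sumsmx_sup E) ?Wedderburn_id_mem.
case/envelop_mxP=> e eE; exists [ffun w => e w] => F.
have -> : galg F [ffun w => e w] = gring_op (irr_repr F) (Wedderburn_id E).
  rewrite eE linear_sum /=; apply: eq_big => [w|w _]; first by rewrite inE.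
  by rewrite linearZ /= gring_opG ?inE // ffunE.
have [->|FE] := eqVneq F E; first exact: op_Wedderburn_id_pchar pchar_irr _.
rewrite (irr_repr'_op0_pchar pchar_irr _ (Wedderburn_id_mem _)) 1?eq_sym //.
by rewrite raddf0.
Qed.

(** Absolute irreducibility makes A a combination of the matrices of E; multiplying by the central
    idempotent of E kills the other components. *)
Lemma galg_surj E (A : 'M_(deg E)) :
  exists f, galg E f = A /\ forall F, F != E -> galg F f = 0.
Proof.
have /mx_abs_irrP[_ [a aE]] := irr_abs_irr E; have [e eE] := galg_id E.
exists (gmul [ffun w => a w A] e); split=> [|F FE]; last first.
  by rewrite galg_gmul eE (negPf FE) raddf0 mulmx0.
rewrite galg_gmul eE eqxx mulmx1 {2}(aE A) /galg.
by apply: eq_big => [w|w _]; rewrite ?inE // ffunE.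
Qed.

Lemma trace_regular w : \tr (aG w) = #|W|%:R * (w == 1%g)%:R.
Proof.
have G1 := group1 [set: W]%G.
transitivity (\sum_(i < #|[set: W]|) (w == 1%g)%:R : C).
  apply: eq_bigr => i _; rewrite !mxE /= /gring_index.
  congr ((nat_of_bool _)%:R).
  apply/eqP/eqP => [E|->]; last by rewrite mulg1 enum_valK_in.
  have := congr1 enum_val E; rewrite enum_rankK_in ?inE // => /eqP.
  by rewrite eq_sym -{2}[enum_val i]mulg1 (inj_eq (mulgI _)) => /eqP.
by rewrite sumr_const card_ord cardsT mulr_natl.
Qed.

Lemma galg_inj f : (forall E, galg E f = 0) -> f = 0.
Proof.
move=> f0; apply/ffunP => x; rewrite [RHS]ffunE.
have : \sum_w f w * \tr (aG (w * x^-1)%g) = 0.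
  transitivity (\sum_E \tr (galg E f *m irr_repr E x^-1%g) *+ deg E); last first.
    by rewrite big1 // => E _; rewrite f0 mul0mx raddf0 mul0rn.
  under eq_bigr => w _ do rewrite (mxtrace_regular_pchar Irr pchar_irr split_irr) ?inE // mulr_sumr.
  rewrite exchange_big; apply: eq_bigr => E _; rewrite mulmx_suml raddf_sum -sumrMnl.
  by apply: eq_bigr => w _; rewrite repr_mxM ?inE // -scalemxAl /= mxtraceZ mulrnAr.
under eq_bigr => w _ do rewrite trace_regular.
rewrite (bigD1 x) //= mulgV eqxx mulr1 big1 ?addr0 => [/eqP|y yx]; last first.
  by rewrite -eq_mulgV1 (negPf yx) !mulr0.
have W0 : (#|W| != 0)%N by rewrite -lt0n; apply/card_gt0P; exists x.
by rewrite mulf_eq0 pnatr_eq0 (negPf W0) orbF => /eqP.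
Qed.

Lemma irr_trace_inj E F : (forall w, \tr (irr_repr E w) = \tr (irr_repr F w)) -> E = F.
Proof.
move=> EF; have [e eE] := galg_id E; apply/eqP; apply: contraT => FE.
have : \tr (galg E e) = \tr (galg F e).
  by rewrite /galg !raddf_sum; apply: eq_bigr => w _ /=; rewrite !linearZ /= EF.
rewrite !eE eqxx eq_sym (negPf FE) !mxtrace_scalar mul0rn => /eqP.
by rewrite pnatr_eq0 -leqn0 leqNgt irr_degree_gt0.
Qed.

End GroupAlgebra.

(** * Schur elements of J *)

Section TraceForm.
Variables (F : fieldType) (n : nat) (lam : 'M[F]_n -> F).
Hypothesis n_gt0 : (0 < n)%N.
Hypothesis lamP : forall c A B, lam (c *: A + B) = c * lam A + lam B.
Hypothesis lamC : forall A B, lam (A *m B) = lam (B *m A).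

(** Writing a matrix unit as a product through index 0 and exchanging the factors kills the
    off-diagonal units and identifies the diagonal ones. *)
Lemma mx_trace_form A :
  lam A = lam (delta_mx (Ordinal n_gt0) (Ordinal n_gt0)) * \tr A.
Proof.
set o := Ordinal n_gt0.
have lam0 : lam 0 = 0.
  by apply: (addrI (lam 0)); rewrite -{1}[lam 0]mul1r -lamP scaler0 !addr0.
have lam_sum (I : finType) (G : I -> 'M[F]_n) (c : I -> F) :
    lam (\sum_i c i *: G i) = \sum_i c i * lam (G i).
  by elim/big_rec2: _ => // i x y _ <-; rewrite lamP.
have lam_delta i j : lam (delta_mx i j) = (i == j)%:R * lam (delta_mx o o).
  rewrite -(mul_delta_mx o i j) lamC mul_delta_mx_cond eq_sym.
  by case: eqP; rewrite ?mulr1n ?mulr0n ?mul1r ?mul0r.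
rewrite {1}[A]matrix_sum_delta pair_bigA /= lam_sum mulrC mulr_suml.
rewrite -(pair_bigA _ (fun i j => A i j * lam (delta_mx i j))) /=.
apply: eq_bigr => i _; rewrite (bigD1 i) //= lam_delta eqxx mul1r big1 ?addr0 // => j ji.
by rewrite lam_delta eq_sym (negPf ji) mul0r mulr0.
Qed.

End TraceForm.

Section Spade.
Variables (R0 : realType).
Variables (W : finGroupType) (S : {set W}) (L : W -> int) (H : hecke S L).
Hypothesis cox : coxeter_system S.
Hypothesis P : P1_15 H.
Local Notation C := R0[i].
Local Notation Irr := (IrrW R0 W).
Local Notation deg := (@irr_degree _ _ _ Irr).
Local Notation spade := (spade H).
Implicit Types (u w x y z d : W) (E F : Irr) (f g : {ffun W -> C}).

Lemma spade_jphi1 E f : spade E (jphi1 H f) = galg E f.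
Proof. by rewrite /Defs.spade jphi1K. Qed.

Lemma spade_jT E w : spade E (jT R0 H w) = irr_repr E w.
Proof.
rewrite -jphi1_jt spade_jphi1 /galg (bigD1 w) //= ffunE eqxx scale1r big1 ?addr0 // => x xw.
by rewrite ffunE (negPf xw) scale0r.
Qed.

Lemma spadeE E f : spade E f = \sum_z f z *: spade E (jt C z).
Proof.
rewrite /Defs.spade; under eq_bigr => w _ do rewrite (jphi1_invE cox P) scaler_suml.
rewrite exchange_big; apply: eq_bigr => z _ /=; rewrite scaler_sumr.
by apply: eq_bigr => w _; rewrite scalerA.
Qed.

Lemma spadeD E f g : spade E (f + g) = spade E f + spade E g.
Proof.
rewrite !(spadeE E (_ + _)) (spadeE E f) (spadeE E g) -big_split.
by apply: eq_bigr => z _; rewrite !ffunE scalerDl.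
Qed.

Lemma spade0 E : spade E 0 = 0.
Proof. by apply: (addrI (spade E 0)); rewrite -spadeD !addr0. Qed.

Lemma spade_sum E (I : Type) (r : seq I) (G : I -> {ffun W -> C}) :
  spade E (\sum_(i <- r) G i) = \sum_(i <- r) spade E (G i).
Proof. by rewrite (big_morph _ (spadeD E) (spade0 E)). Qed.

Lemma spadeM E f g : spade E (jmul H f g) = spade E f *m spade E g.
Proof.
rewrite -[f](jphi1_invK cox P) -[g](jphi1_invK cox P).
move: (jphi1_inv H f) (jphi1_inv H g) => x y.
have -> : jmul H (jphi1 H x) (jphi1 H y) = jphi1 H (gmul x y).
  apply/ffunP => z; rewrite jphi1_mul // jphi1E ffunE.
  under [RHS]eq_bigr => t _ do rewrite ffunE mulr_suml.
  rewrite [RHS]exchange_big; apply: eq_bigr => u _ /=.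
  by rewrite [RHS](reindex_inj (mulgI u)); apply: eq_bigr => w _; rewrite mulKg.
by rewrite !spade_jphi1 galg_gmul.
Qed.

Lemma spade1 E : spade E (jone H C) = 1%:M.
Proof. by rewrite -(jT1 _ cox P) spade_jT repr_mx1. Qed.

Lemma spade_surj E (A : 'M_(deg E)) :
  exists f, spade E f = A /\ forall F, F != E -> spade F f = 0.
Proof.
have [f [fE fF]] := galg_surj A; exists (jphi1 H f).
by split=> [|F FE]; rewrite spade_jphi1 ?fE //; apply: fF.
Qed.

Lemma spade_inj f : (forall E, spade E f = 0) -> f = 0.
Proof.
move=> f0; rewrite -[f](jphi1_invK cox P).
suff -> : jphi1_inv H f = 0.
  apply/ffunP => z; rewrite jphi1E [RHS]ffunE ffunE big1 // => w _.
  by rewrite ffunE mul0r.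
by apply: galg_inj => E; apply: f0.
Qed.

Definition jchi E w : C := \tr (spade E (jt C w)).

Lemma tr_spade E f : \tr (spade E f) = \sum_z f z * jchi E z.
Proof.
rewrite spadeE raddf_sum; apply: eq_bigr => z _ /=; exact: mxtraceZ.
Qed.

Lemma spade_eq f g : (forall E, spade E f = spade E g) -> f = g.
Proof.
move=> fg; apply/eqP; rewrite -subr_eq0; apply/eqP/spade_inj => E.
by apply: (addIr (spade E g)); rewrite -spadeD subrK add0r fg.
Qed.

(* J_C is a product of matrix algebras, on which a trace form is a multiple of the trace. *)
Lemma jtau_trace : exists a : Irr -> C, forall f,
  jtau H f = \sum_E a E * \tr (spade E f).
Proof.
have /choice[v vP] (p : {E : Irr & 'M[C]_(deg E)}) : exists f,
    spade (tag p) f = tagged p /\ forall F, F != tag p -> spade F f = 0.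
  exact: spade_surj.
pose lift E A := v (Tagged (fun E : Irr => 'M[C]_(deg E)) (A : 'M[C]_(deg E))).
have lift_id E A : spade E (@lift E A) = A by have [] := vP (Tagged _ A).
have lift_0 E A F : F != E -> spade F (@lift E A) = 0.
  by move=> FE; have [_] := vP (Tagged _ A); apply.
pose o E := Ordinal (irr_degree_gt0 E).
exists (fun E => jtau H (lift E (delta_mx (o E) (o E)))).
move=> f; have {1}-> : f = \sum_E lift E (spade E f).
  apply: spade_eq => E; rewrite spade_sum (bigD1 E) //= lift_id big1 ?addr0 // => F FE.
  by rewrite lift_0 // eq_sym.
have tauP c (g h : {ffun W -> C}) :
    jtau H ([ffun z => c * g z + h z] : {ffun W -> C}) = c * jtau H g + jtau H h.
  rewrite /jtau mulr_sumr -big_split; apply: eq_bigr => d _.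
  by rewrite ffunE mulrDr mulrCA.
have tauD : {morph @jtau _ _ _ H C : g h / g + h >-> g + h :> C}.
  by move=> g h; rewrite -[jtau H g]mul1r -tauP; congr (jtau H _); apply/ffunP => z;
     rewrite !ffunE mul1r.
have tau0 : jtau H (0 : {ffun W -> C}) = 0.
  by rewrite /jtau big1 // => d _; rewrite ffunE mulr0.
rewrite (big_morph _ tauD tau0); apply: eq_bigr => E _.
apply: (@mx_trace_form _ _ (fun A => jtau H (lift E A))) => [c A B|A B].
  rewrite -tauP; congr (jtau H _); apply: spade_eq => F.
  have -> : spade F [ffun z => c * lift E A z + lift E B z] =
      c *: spade F (lift E A) + spade F (lift E B).
    rewrite !(spadeE F) scaler_sumr -big_split; apply: eq_bigr => z _.
    by rewrite ffunE scalerDl scalerA.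
  have [->|FE] := eqVneq F E; first by rewrite !lift_id.
  by rewrite !lift_0 // scaler0 addr0.
have -> : lift E (A *m B) = jmul H (lift E A) (lift E B).
  apply: spade_eq => F; rewrite spadeM; have [->|FE] := eqVneq F E.
    by rewrite !lift_id.
  by rewrite !lift_0 // mul0mx.
rewrite (jtauC P); congr (jtau H _).
apply: spade_eq => F; rewrite spadeM; have [->|FE] := eqVneq F E.
  by rewrite !lift_id.
by rewrite !lift_0 // mul0mx.
Qed.

(** The Schur element of E_spade for the symmetrizing form tau; it is f_E by [fEE]. *)
Definition jschur E : C := (deg E)%:R^-1 * \sum_w jchi E w * jchi E w^-1%g.

Lemma deg_neq0 E : (deg E)%:R != 0 :> C.
Proof. by rewrite pnatr_eq0 -lt0n irr_degree_gt0. Qed.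

(* z_E = \sum_w chi_E(t_w) t_{w^-1} represents chi_E with respect to tau; evaluate
   tau = \sum_F a_F chi_F at z_E 1_E. *)
Lemma jschur_inv (a : Irr -> C) : (forall f, jtau H f = \sum_E a E * \tr (spade E f)) ->
  forall E, a E * jschur E = 1.
Proof.
move=> aP E; have [u [uE uF]] := spade_surj (1%:M : 'M_(deg E)).
pose ze : {ffun W -> C} := [ffun w => jchi E w^-1%g].
have : jtau H (jmul H ze u) = \tr (spade E u).
  rewrite (jtauM P) tr_spade (reindex_inj invg_inj); apply: eq_bigr => x _.
  by rewrite ffunE !invgK mulrC.
rewrite aP (bigD1 E) //= spadeM uE mulmx1 big1 ?addr0 => [|F FE]; last first.
  by rewrite spadeM uF // mulmx0 raddf0 mulr0.
rewrite mxtrace1 tr_spade /jschur => E1.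
rewrite mulrCA -[X in _ * X = _](_ : (deg E)%:R = _) ?mulVf ?deg_neq0 //.
rewrite -E1; congr (_ * _); apply: eq_bigr => w _.
by rewrite ffunE mulrC.
Qed.

Definition jstar f : {ffun W -> C} := [ffun w => (f w^-1%g)^*%C].

Lemma jstarK f : jstar (jstar f) = f.
Proof. by apply/ffunP => w; rewrite !ffunE invgK conjcK. Qed.

Lemma jstarM f g : jstar (jmul H f g) = jmul H (jstar g) (jstar f).
Proof.
apply/ffunP => u; rewrite !ffunE rmorph_sum [RHS]exchange_big (reindex_inj invg_inj).
apply: eq_bigr => x _ /=; rewrite rmorph_sum (reindex_inj invg_inj); apply: eq_bigr => y _ /=.
rewrite !ffunE !rmorphM /= rmorph_int (gam_flat cox P) !invgK.
by congr (_ * _); rewrite mulrC.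
Qed.

Lemma jtau_star f : jtau H (jmul H f (jstar f)) = \sum_w `|f w| ^+ 2.
Proof.
by rewrite (jtauM P); apply: eq_bigr => w _; rewrite ffunE invgK -sqr_normc.
Qed.

Lemma jtau_star_gt0 f : f != 0 -> 0 < jtau H (jmul H f (jstar f)).
Proof.
move=> f0; rewrite jtau_star lt_def sumr_ge0 ?andbT => [|w _]; last by rewrite exprn_ge0.
apply: contra f0; rewrite psumr_eq0 => [/allP s0|w _]; last by rewrite exprn_ge0.
apply/eqP/ffunP => w; rewrite ffunE; apply/eqP.
by have := s0 w (mem_index_enum w); rewrite sqrf_eq0 normr_eq0.
Qed.

(* The central idempotent 1_E is self-adjoint for t_w^* = t_{w^-1}, so that
   tau(1_E) = tau(1_E 1_E^* ) > 0. *)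
Lemma jtau_coef_gt0 (a : Irr -> C) : (forall f, jtau H f = \sum_E a E * \tr (spade E f)) ->
  forall E, 0 < a E.
Proof.
move=> aP E; have [u [uE uF]] := spade_surj (1%:M : 'M_(deg E)).
have uC (x : {ffun W -> C}) : jmul H u x = jmul H x u.
  apply: spade_eq => F; rewrite !spadeM; have [->|FE] := eqVneq F E.
    by rewrite uE mulmx1 mul1mx.
  by rewrite uF // mulmx0 mul0mx.
have uu : jmul H u u = u.
  apply: spade_eq => F; rewrite !spadeM; have [->|FE] := eqVneq F E.
    by rewrite uE mulmx1.
  by rewrite uF // mulmx0.
have u0 : u != 0.
  apply: contraTneq (deg_neq0 E) => u0; move: uE; rewrite u0 spade0 => /esym/(congr1 mxtrace).
  by rewrite mxtrace1 raddf0 => ->; rewrite eqxx.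
have susu : jmul H (jstar u) (jstar u) = jstar u by rewrite -jstarM uu.
have suC (x : {ffun W -> C}) : jmul H (jstar u) x = jmul H x (jstar u).
  by rewrite -[x]jstarK -!jstarM uC.
have /is_scalar_mxP[c cE] : is_scalar_mx (spade E (jstar u)).
  apply: mx_abs_irr_cent_scalar (irr_abs_irr E) _ _; apply/centgmxP => w _.
  by rewrite -spade_jT -!spadeM suC.
have cc : c * c = c.
  have /(congr1 (spade E)) := susu; rewrite spadeM !cE -scalar_mxM => /(congr1 mxtrace).
  by rewrite !mxtrace_scalar -[RHS]mulr_natr -[LHS]mulr_natr => /(mulIf (deg_neq0 E)).
have usu : jmul H u (jstar u) = [ffun z => c * u z].
  apply: spade_eq => F; rewrite spadeM.
  have -> : spade F [ffun z => c * u z] = c *: spade F u.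
    rewrite !(spadeE F) scaler_sumr; apply: eq_bigr => z _.
    by rewrite ffunE scalerA.
  have [->|FE] := eqVneq F E; first by rewrite uE cE mul1mx scalemx1.
  by rewrite uF // mul0mx scaler0.
have pos := jtau_star_gt0 u0.
have c1 : c = 1.
  have [c0|c0] := eqVneq c 0; last by apply: (mulfI c0); rewrite cc mulr1.
  move: pos; rewrite usu c0 /jtau big1 ?ltxx // => d _.
  by rewrite ffunE mul0r mulr0.
move: pos; have -> : jmul H u (jstar u) = u.
  by rewrite usu c1; apply/ffunP => z; rewrite ffunE mul1r.
rewrite aP (bigD1 E) //= uE mxtrace1 big1 ?addr0 => [|F FE]; last first.
  by rewrite uF // raddf0 mulr0.
by rewrite pmulr_lgt0 // ltr0n irr_degree_gt0.
Qed.

End Spade.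

(** * Extension of scalars to C(v) *)

Lemma laurent_lead (F : fieldType) (b : F) (x : laurent) (m : int) : b != 0 ->
  (forall k, k < m -> lcoef x k = 0) ->
  exists q : {poly int}, lev b x = b ^ m * ((lcoef x m)%:~R + b * (map_poly intr q).[b]).
Proof.
(* The denominator is enlarged by |m| so that m = j - n for a natural number j. *)
move=> b0 xm; have [p0 [n0 /(is_laurent_raise (absz m)) Hp]] := laurentP x.
move: (p0 * _) (n0 + _)%N (leq_addl n0 (absz m)) Hp => p n mn Hp {p0 n0}.
have [j Ej] : exists j : nat, m = j%:Z - n%:Z by exists (absz (m + n%:Z)); lia.
have pE i : (i < j)%N -> p`_i = 0 by move=> ij; rewrite -(lcoef_nat _ Hp) xm // Ej; lia.
exists (drop_poly j.+1 p); rewrite (levE b0 Hp) {2}Ej (lcoef_nat _ Hp).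
have {1}-> : p = 'X^j * ((p`_j)%:P + 'X * drop_poly j.+1 p).
  apply/polyP => i; rewrite coefXnM; case: ltnP => [/pE //|ji].
  rewrite coefD coefC coefXM coef_drop_poly; case: (i - j)%N (subnKC ji) => [|k] <- /=.
    by rewrite addn0 addr0.
  by rewrite add0r; congr p`_(_); lia.
rewrite rmorphM rmorphD /= map_polyXn map_polyC rmorphM /= map_polyX.
rewrite hornerM hornerXn hornerD hornerC hornerM hornerX mulrAC; congr (_ * _).
by rewrite Ej expfzDr // exprnP exprnN.
Qed.

(** With a nonzero entry of U at (i0, j0), E_{k,i0} U E_{j0,k} is this entry times E_kk. By
    stability it is also U times a matrix, and summing over k gives a right inverse of U. *)
Lemma mx_ideal_unit (F : fieldType) n (U : 'M[F]_n) :
  (forall A, exists X, A *m U = U *m X) -> U != 0 -> U \in unitmx.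
Proof.
move=> stabU U0.
have [[i0 j0] /= Uij] : exists ij, U ij.1 ij.2 != 0.
  apply/existsP; apply: contraR U0; rewrite negb_exists => /forallP z.
  by apply/eqP/matrixP => i j; rewrite mxE; apply/eqP/negbNE/(z (i, j)).
have /choice[X XP] i := stabU (delta_mx i i0).
suff : U *m (\sum_i (U i0 j0)^-1 *: (X i *m delta_mx j0 i)) = 1%:M by case/mulmx1_unit.
rewrite mulmx_sumr; apply/matrixP => i j; rewrite summxE (bigD1 i) //=.
have E1 k : U *m ((U i0 j0)^-1 *: (X k *m delta_mx j0 k)) = delta_mx k k.
  rewrite -scalemxAr mulmxA -XP; apply/matrixP => x y; rewrite mxE mxE (bigD1 j0) //=.
  rewrite !mxE (bigD1 i0) //= !mxE !eqxx andbT big1 => [|z zi]; last first.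
    by rewrite mxE (negPf zi) andbF mul0r.
  rewrite big1 => [|z zj]; last by rewrite [delta_mx _ _ _ _]mxE (negPf zj) mulr0.
  case: (x == k); rewrite /= ?mul1r ?mul0r ?addr0 ?mulr0 ?mul0r ?mulr0 //.
  by rewrite mulrA mulVf // mul1r.
rewrite E1 big1 ?addr0 => [|k ki]; last by rewrite E1 mxE eq_sym (negPf ki).
by rewrite !mxE eqxx eq_sym.
Qed.

Lemma mxtrace_conj (F : fieldType) n n' (B : 'M[F]_(n', n)) X Y :
  n = n' -> row_free B -> B *m X = Y *m B -> \tr X = \tr Y.
Proof.
move=> nn'; case: _ / nn' in B Y *; rewrite row_free_unit => Bu E.
by rewrite -[Y](mulmxK Bu) -E mxtrace_mulC mulmxA mulVmx // mul1mx.
Qed.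

Section KModules.
Variables (R0 : realType).
Variables (W : finGroupType) (S : {set W}) (L : W -> int) (H : hecke S L).
Hypothesis cox : coxeter_system S.
Hypothesis P : P1_15 H.
Local Notation C := R0[i].
Local Notation K := (Cv R0).
Local Notation v := (Cv_v R0).
Local Notation cst := (@Cv_const R0).
Local Notation Irr := (IrrW R0 W).
Local Notation deg := (@irr_degree _ _ _ Irr).
Local Notation spade := (spade H).
Local Notation jchi := (jchi H).
Local Notation a := (afun H).
Implicit Types (u w x y z d : W) (E F : Irr) (f g : {ffun W -> K}) (h : H).

HB.instance Definition _ := GRing.RMorphism.copy cst
  (@FracField.tofrac {poly C} \o polyC).

Lemma cst_inj : injective cst.
Proof. by move=> c c' /eqP; rewrite /Cv_const tofrac_eq => /eqP/polyC_inj. Qed.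

Let v0 : v != 0 := tofracX_neq0 _.
Local Notation levv := (levm v0).

Lemma levvE (x : laurent) p n : is_laurent (lval x) (p, n) ->
  lev v x = (map_poly intr p : {poly C})%:F / v ^+ n.
Proof. by move=> Hp; rewrite (levE v0 Hp) horner_tofracX. Qed.

Lemma levv_neq0 (x : laurent) : lev (1 : C) x != 0 -> lev v x != 0.
Proof.
have [p [n Hp]] := laurentP x; rewrite (levvE Hp) (levE (oner_neq0 _) Hp).
apply: contraNneq => /eqP; rewrite mulf_eq0 invr_eq0 expf_eq0 (negPf v0) andbF orbF.
by rewrite tofrac_eq0 => /eqP ->; rewrite horner0 mul0r.
Qed.

Definition kspade E f : 'M[K]_(deg E) := \sum_z f z *: map_mx cst (spade E (jt C z)).

Lemma jmul_jt (B : comNzRingType) x y u : jmul H (jt B x) (jt B y) u = (gam H x y u^-1%g)%:~R.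
Proof.
have jtE (z w : W) : jt B z w = (w == z)%:R by rewrite ffunE.
rewrite ffunE (bigD1 x) //= (bigD1 y) //= !jtE !eqxx !mul1r.
rewrite big1 ?addr0 => [|z zy]; last by rewrite jtE (negPf zy) mulr0 mul0r.
rewrite big1 ?addr0 // => z zx; rewrite big1 // => w _.
by rewrite jtE (negPf zx) !mul0r.
Qed.

Lemma kspadeM E f g : kspade E (jmul H f g) = kspade E f *m kspade E g.
Proof.
rewrite /kspade mulmx_suml; under eq_bigr => u _ do rewrite ffunE scaler_suml.
rewrite exchange_big; apply: eq_bigr => x _ /=; rewrite mulmx_sumr.
under eq_bigr => u _ do rewrite scaler_suml.
rewrite exchange_big; apply: eq_bigr => y _ /=.
rewrite -scalemxAl -scalemxAr scalerA -map_mxM -(spadeM cox P) (spadeE cox P).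
rewrite map_mx_sum scaler_sumr; apply: eq_bigr => u _.
by rewrite map_mxZ scalerA jmul_jt rmorph_int.
Qed.

Lemma kspade_one E : kspade E (jone H K) = 1%:M.
Proof.
rewrite -(map_mx1 cst) -(spade1 cox P) (spadeE cox P) map_mx_sum; apply: eq_bigr => z _.
rewrite map_mxZ !ffunE; case: ifP => _; first by rewrite rmorph_int.
by rewrite rmorph0.
Qed.

Lemma kspade_lift E (A : 'M[C]_(deg E)) : exists f, kspade E f = map_mx cst A.
Proof.
have [f [<- _]] := spade_surj cox P A; exists [ffun z => cst (f z)].
rewrite (spadeE cox P) map_mx_sum; apply: eq_bigr => z _.
by rewrite map_mxZ ffunE.
Qed.

Lemma kspade_surj E (A : 'M[K]_(deg E)) : exists f, kspade E f = A.
Proof.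
have /choice[r rP] (ij : 'I_(deg E) * 'I_(deg E)) := kspade_lift (delta_mx ij.1 ij.2).
exists [ffun z => \sum_ij A ij.1 ij.2 * r ij z].
rewrite /kspade; under eq_bigr => z _ do rewrite ffunE scaler_suml.
rewrite exchange_big [RHS]matrix_sum_delta [RHS]pair_bigA; apply: eq_bigr => ij _ /=.
rewrite -(map_delta_mx cst) -rP /kspade scaler_sumr.
by apply: eq_bigr => z _; rewrite scalerA.
Qed.

(* The matrix of J_C -> \prod_E M_n(C) keeps its rank over C(v). *)
Lemma kspade_inj f : (forall E, kspade E f = 0) -> f = 0.
Proof.
pose T : finType := {E : Irr & ('I_(deg E) * 'I_(deg E))%type}.
pose M : 'M[C]_(#|W|, #|T|) := \matrix_(i, p)
  spade (tag (enum_val p)) (jt C (enum_val i)) (tagged (enum_val p)).1 (tagged (enum_val p)).2.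
have Mfree : row_free M.
  apply: inj_row_free => r r0; pose g := [ffun z => r 0 (enum_rank z)].
  suff g0 : g = 0.
    by apply/rowP => i; have := congr1 (fun g : {ffun W -> C} => g (enum_val i)) g0;
       rewrite !ffunE enum_valK mxE.
  apply: (spade_inj cox P) => E; rewrite (spadeE cox P); apply/matrixP => i j.
  have := congr1 (fun A : 'rV_#|T| => A 0 (enum_rank (Tagged _ (i, j) : T))) r0.
  rewrite !mxE summxE => r0'; rewrite -[RHS]r0'.
  rewrite (reindex (@enum_val W predT)); last exact/onW_bij/enum_val_bij.
  by apply: eq_bigr => w _; rewrite !mxE ffunE enum_valK enum_rankK.
move=> f0; have : (\row_i f (enum_val i)) *m map_mx cst M = 0.
  apply/rowP => p; rewrite !mxE.
  have := congr1 (fun A : 'M_(deg (tag (enum_val p))) =>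
    A (tagged (enum_val p)).1 (tagged (enum_val p)).2) (f0 (tag (enum_val p))).
  rewrite /kspade summxE mxE => E0; rewrite -[RHS]E0.
  rewrite [RHS](reindex (@enum_val W predT)); last exact/onW_bij/enum_val_bij.
  by apply: eq_bigr => i _; rewrite !mxE.
have MfreeK : row_free (map_mx cst M) by rewrite row_free_map.
move=> rM0; have r0 : (\row_i f (enum_val i) : 'rV[K]_#|W|) = 0.
  by apply/eqP; rewrite -(mulmx_free_eq0 _ MfreeK) rM0.
apply/ffunP => w; rewrite ffunE.
by have := congr1 (fun A : 'rV_#|W| => A 0 (enum_rank w)) r0; rewrite !mxE enum_rankK.
Qed.

Definition jphiK h : {ffun W -> K} := [ffun z => levv (jphi h z)].

Lemma jphiKE h z : jphiK h z = levv (jphi h z).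
Proof. by rewrite [LHS]ffunE. Qed.

(** The module K (x) E_spade pulled back along phi, a concrete model of E_v. *)
Definition rho E h : 'M[K]_(deg E) := kspade E (jphiK h).

Lemma rhoM E (g h : H) : rho E (g * h) = rho E g *m rho E h.
Proof. by rewrite /rho -kspadeM /jphiK -jmul_map jphiM. Qed.

Lemma rho1 E : rho E 1 = 1%:M.
Proof.
rewrite -kspade_one /rho; congr (kspade E _); apply/ffunP => z; rewrite jphiKE jphi_1 // !ffunE.
by case: ifP => _; rewrite ?rmorph_int ?rmorph0.
Qed.

Lemma rhoZ E c h : rho E (c *: h) = lev v c *: rho E h.
Proof.
rewrite /rho /kspade scaler_sumr; apply: eq_bigr => z _.
by rewrite !jphiKE jphiZ // rmorphM /= scalerA.
Qed.

Lemma rhoB E : zmod_morphism (rho E).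
Proof.
move=> g h; rewrite /rho /kspade -sumrB; apply: eq_bigr => z _.
by rewrite !jphiKE jphiD // -scaleN1r jphiZ // mulN1r rmorphB /= scalerBl.
Qed.

Definition rho_rep E : HKrep R0 H (deg E) :=
  @HKRep _ _ _ _ H _ (HB.pack (rho E)
    (GRing.isZmodMorphism.Build _ _ (rho E) (rhoB E))
    (GRing.isMonoidMorphism.Build _ _ (rho E) (conj (rho1 E) (rhoM E)))) (rhoZ E).

(* det(phi(T_w)_z) is nonzero at v = 1, hence nonzero. *)
Lemma jphi_T_kmx : kmx (fun w z => levv (jphi (hT H w) z)) \in unitmx.
Proof.
pose N : 'M[laurent]_#|W| := \matrix_(i, j) jphi (hT H (enum_val i)) (enum_val j).
have EN : kmx (fun w z => levv (jphi (hT H w) z)) = map_mx levv N.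
  by apply/matrixP => i j; rewrite !mxE.
have EN1 : kmx (jT R0 H) = map_mx (levm (oner_neq0 C)) N.
  by apply/matrixP => i j; rewrite !mxE ffunE.
rewrite EN unitmxE det_map_mx unitfE; apply: levv_neq0.
by have := jT_kmx R0 cox P; rewrite EN1 unitmxE det_map_mx unitfE.
Qed.

Lemma rho_span E (A : 'M[K]_(deg E)) :
  exists k : {ffun W -> K}, A = \sum_w k w *: rho E (hT H w).
Proof.
have [f <-] := kspade_surj A; have [k kP] := kmx_solve jphi_T_kmx f.
exists k; rewrite /rho /kspade; under [RHS]eq_bigr => w _ do rewrite scaler_sumr.
rewrite exchange_big; apply: eq_bigr => z _ /=; rewrite -kP scaler_suml.
by apply: eq_bigr => w _; rewrite jphiKE scalerA.
Qed.

Lemma rho_simple E : HKsimple (rho_rep E).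
Proof.
split=> [|U stabU /eqP U0]; first exact: irr_degree_gt0.
have {}stabU A : exists X, A *m U = U *m X.
  have [k ->] := rho_span A; have /choice[X XP] w := stabU (hT H w).
  exists (\sum_w k w *: X w); rewrite mulmx_suml mulmx_sumr; apply: eq_bigr => w _.
  by rewrite -scalemxAl -scalemxAr -XP.
exact: mx_ideal_unit.
Qed.

Lemma specializes1_uniq (x : K) (b b' : C) : specializes1 x b -> specializes1 x b' -> b = b'.
Proof.
move=> [p [n [-> <-]]] [q [m [+ <-]]] => /eqP.
rewrite eqr_div ?expf_neq0 // -!tofracXn -!tofracM tofrac_eq => /eqP/(congr1 (horner^~ 1)).
by rewrite !hornerM !hornerXn !expr1n !mulr1.
Qed.

Lemma tr_rho E h : \tr (rho E h) = \sum_z lev v (jphi h z) * cst (jchi E z).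
Proof.
rewrite /rho /kspade raddf_sum; apply: eq_bigr => z _ /=.
by rewrite mxtraceZ jphiKE trace_map_mx.
Qed.

Lemma rho_specializes E w : specializes1 (\tr (rho E (hT H w))) (\tr (irr_repr E w)).
Proof.
have [n [p Hp]] := laurent_commonP (fun z => jphi (hT H w) z).
exists (\sum_z map_poly intr (p z) * (jchi E z)%:P), n; split.
  rewrite tr_rho rmorph_sum mulr_suml; apply: eq_bigr => z _ /=.
  by rewrite (levvE (Hp z)) rmorphM /= mulrAC.
rewrite -(spade_jT cox P) (tr_spade cox P) horner_sum; apply: eq_bigr => z _.
by rewrite hornerM hornerC ffunE /levm (levE (oner_neq0 _) (Hp z)) expr1n divr1.
Qed.

(** * Leading terms of the traces on E_v and the numbers f_E *)

Variable Ev : lusztig_bijection R0 H.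

(** As a simple module, [rho E] is isomorphic to some E'_v; comparing the characters at v = 1 yields
    E' = E. *)
Lemma tr_ev E h : \tr (ev Ev E h) = \tr (rho E h).
Proof.
have [E' [B [nn' Bfree] EB]] := ev_surj Ev (rho_simple E).
have tr' h' : \tr (ev Ev E' h') = \tr (rho E h') := mxtrace_conj nn' Bfree (EB h').
have <- : \tr (ev Ev E' h) = \tr (rho E h) by apply: tr'.
suff -> : E' = E by [].
apply: irr_trace_inj => w; apply: specializes1_uniq (ev_trace Ev E' w) _.
by rewrite tr'; apply: rho_specializes.
Qed.

(** The elements t_{c'} for the various two-sided cells c' are central, hence scalar on E, and
    mutually orthogonal, so that only one acts by a nonzero scalar. A nonzero trace of t_x singles
    out the cell of x. *)
Lemma jchi_afun E y z : jchi E y != 0 -> jchi E z != 0 -> a y = a z.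
Proof.
move=> y0 z0; apply: (afun_simLR P); apply: contraT => nyz.
pose Q x : pred W := fun u => simLR H u x.
have dQ x u : Q x (dd H u) = Q x u.
  have du : simLR H (dd H u) u by apply/simL_LR/(dd_simL P).
  apply/idP/idP => [|] Hx; last exact: simLR_trans du Hx.
  by apply: simLR_trans Hx; rewrite simLR_sym.
have VQ x u : Q x u^-1%g = Q x u.
  apply/idP/idP => Hx; first exact: simLR_trans (p14 P u) Hx.
  by apply: simLR_trans Hx; rewrite simLR_sym; apply: (p14 P).
have scal x : is_scalar_mx (spade E (jD H C (Q x))).
  apply: mx_abs_irr_cent_scalar (irr_abs_irr E) _ _; apply/centgmxP => w _.
  rewrite -(spade_jT cox P) -!(spadeM cox P); congr (spade E _); apply/ffunP => u.
  by rewrite (jmul_jDl P) (jmul_jDr P) !dQ VQ.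
have nz x : jchi E x != 0 -> spade E (jD H C (Q x)) != 0.
  apply: contra => /eqP e0; have : jmul H (jD H C (Q x)) (jt C x) = jt C x.
    apply/ffunP => u; rewrite (jmul_jDl P) dQ VQ ffunE; case: ifP => //.
    by case: eqP => // ->; rewrite /Q simLR_refl.
  by move=> E1; rewrite -[jchi E x]/(\tr (spade E (jt C x))) -E1 (spadeM cox P) e0 mul0mx mxtrace0.
have [cy Ey] := is_scalar_mxP (scal y); have [cz Ez] := is_scalar_mxP (scal z).
have : spade E (jmul H (jD H C (Q y)) (jD H C (Q z))) = 0.
  rewrite (_ : jmul H _ _ = 0) ?(spade0 cox P) //; apply/ffunP => u.
  rewrite (jmul_jDl P) dQ VQ !ffunE; case: ifP => // uy; case: ifP => // /andP[_ uz].
  by case/negP: nyz; apply: simLR_trans uz; rewrite simLR_sym.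
rewrite (spadeM cox P) Ey Ez -scalar_mxM => /(congr1 mxtrace)/eqP.
rewrite mxtrace_scalar mxtrace0 -mulr_natr !mulf_eq0 (negPf (deg_neq0 E)) orbF.
by case/orP=> /eqP c0; [have := nz y y0 | have := nz z z0];
  rewrite ?Ey ?Ez c0 raddf0 eqxx.
Qed.

Lemma jchi_ex E : exists z, jchi E z != 0.
Proof.
apply/existsP; apply: contraT; rewrite negb_exists => /forallP z0.
have := congr1 mxtrace (spade1 cox P E); rewrite (tr_spade cox P) mxtrace1 big1 => [/esym/eqP|z _].
  by rewrite (negPf (deg_neq0 E)).
by have /negbNE/eqP -> := z0 z; rewrite mulr0.
Qed.

(** By [jchi_afun] all contributing z share the value a(z0), hence the same lowest power of v, and
    [jphi_T_lead] leaves only z = w in its coefficient. *)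
Lemma tr_ev_lead E z0 w : jchi E z0 != 0 -> exists q : {poly C},
  \tr (ev Ev E (hT H w)) =
  v ^ (- (a z0)%:Z) * (cst ((jsign H w)%:~R * jchi E w) + v * q%:F).
Proof.
move=> z0P; have lead z := laurent_lead v0 (jphi_T_lead cox P w z).1.
have /choice[q qP] z : exists q : {poly C}, lev v (jphi (hT H w) z) =
    v ^ (- (a z)%:Z) * (((w == z)%:R * jsign H w)%:~R + v * q%:F).
  have [q ->] := lead z; exists (map_poly intr q).
  by rewrite (jphi_T_lead cox P w z).2 horner_tofracX.
exists (\sum_z q z * (jchi E z)%:P); rewrite tr_ev tr_rho.
transitivity (\sum_z v ^ (- (a z0)%:Z) *
    (((w == z)%:R * jsign H w)%:~R * cst (jchi E z) + v * (q z * (jchi E z)%:P)%:F)).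
  apply: eq_bigr => z _; have [->|zP] := eqVneq (jchi E z) 0.
    by rewrite /Cv_const polyC0 mulr0 tofrac0 !mulr0 addr0 mulr0.
  by rewrite qP (jchi_afun zP z0P) -mulrA mulrDl -mulrA tofracM.
rewrite -mulr_sumr big_split /= -mulr_sumr rmorph_sum; congr (_ * (_ + _)).
rewrite (bigD1 w) //= eqxx mul1r big1 ?addr0 => [|z /negPf zw].
  by rewrite [RHS]rmorphM /= rmorph_int.
by rewrite eq_sym zw mul0r mul0r.
Qed.

Lemma tofrac_v_inj (c c' : C) (q q' : {poly C}) :
  cst c + v * q%:F = cst c' + v * q'%:F -> c = c'.
Proof.
rewrite /Cv_const /Cv_v -!tofracM -!tofracD => /eqP; rewrite tofrac_eq => /eqP.
move/(congr1 (horner^~ 0)).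
by rewrite !hornerD !hornerC !hornerM !hornerX !mul0r !addr0.
Qed.

Lemma aEE E z0 : jchi E z0 != 0 -> aE Ev E = a z0.
Proof.
move=> z0P; rewrite /aE.
set Q := (X in xget _ X).
have Qa : Q (a z0).
  split=> [w|].
    have [q ->] := tr_ev_lead w z0P; rewrite mulrA -expfzDr // subrr expr0z mul1r.
    by exists (((jsign H w)%:~R * jchi E w)%:P + 'X * q); rewrite tofracD tofracM.
  (* The exponent cannot be lowered: at w = z0 the lowest coefficient is a sign times the nonzero
     [jchi E z0]. *)
  exists z0 => -[p]; have [q ->] := tr_ev_lead z0 z0P.
  rewrite mulrA -expfzDr // addrAC subrr sub0r => /(congr1 ( *%R v)).
  rewrite mulrA -{1}[v]expr1z -expfzDr // subrr expr0z mul1r => E1.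
  have : (jsign H z0)%:~R * jchi E z0 = 0.
    apply: (@tofrac_v_inj _ _ q p); rewrite E1 /Cv_const polyC0 tofrac0 add0r //.
  move/eqP; rewrite mulf_eq0 (negPf z0P) orbF intr_eq0.
  have := jsignV cox P z0; case: eqP => [->|//]; by rewrite mul0r.
(* The exponent with this property is unique, so that [xget] can return nothing but a(z0). *)
have lt n m : Q n -> Q m -> (n < m)%N -> False.
  move=> [Hn _] [_ [w Hw]] nm; apply: Hw; have [p pE] := Hn w.
  exists ('X^(m - n.+1) * p); rewrite rmorphM rmorphXn /= -pE mulrA exprnP -expfzDr //.
  by congr (v ^ _ * _); lia.
have Qx : Q (xget 0%N Q) by apply: xgetPex; exists (a z0).
have [ltx|gtx|//] := ltngtP (xget 0%N Q) (a z0); first by case: (lt _ _ Qx Qa ltx).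
by case: (lt _ _ Qa Qx gtx).
Qed.

Lemma fEE E : fE Ev E = jschur H E.
Proof.
have R1 (A : comNzRingType) (x b b' q q' : A) :
  (b + x * q) * (b' + x * q') = b * b' + x * (b * q' + q * b' + q * (x * q')) by ring.
have R2 (A : comNzRingType) (x D V X Y : A) :
  D * (V * (X + x * Y)) = D * X * V + D * Y * (x * V) by ring.
have R3 (A : comNzRingType) (x V b p : A) : (b + x * p) * V = b * V + p * (x * V) by ring.
have expfzDr0 N : v ^ (1 - N) = v * v ^ (- N) by rewrite expfzDr // expr1z.
have [z0 z0P] := jchi_ex E; rewrite /fE (aEE z0P).
have /choice[q qP] w := tr_ev_lead w z0P.
set Q := (X in xget _ X).
have Qs : Q (jschur H E).
  pose s w : C := (jsign H w)%:~R * jchi E w.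
  pose r w : {poly C} := (s w)%:P * q w^-1%g + q w * (s w^-1%g)%:P + q w * ('X * q w^-1%g).
  exists (((deg E)%:R^-1)%:P * \sum_w r w).
  have Ew w : \tr (ev Ev E (hT H w)) * \tr (ev Ev E (hT H w^-1%g)) =
      v ^ (- (2 * a z0)%N%:Z) * (cst (jchi E w * jchi E w^-1%g) + v * (r w)%:F).
    have -> : jchi E w * jchi E w^-1%g = s w * s w^-1%g.
      by rewrite /s mulrACA -rmorphM /= (jsignV cox P) mul1r.
    rewrite !qP mulrACA -expfzDr // R1 [cst (s w * _)]rmorphM /r !tofracD !tofracM /=.
    by congr (v ^ _ * _); lia.
  have sumE : \sum_w cst (jchi E w * jchi E w^-1%g) + v * \sum_w (r w)%:F =
      cst (\sum_w jchi E w * jchi E w^-1%g) + v * (\sum_w r w)%:F by rewrite !rmorph_sum.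
  have degE : (deg E)%:R^-1 = cst (deg E)%:R^-1 :> K by rewrite fmorphV rmorph_nat.
  rewrite /cE; under eq_bigr => w _ do rewrite Ew.
  rewrite -mulr_sumr big_split /= -mulr_sumr sumE degE R2 -expfzDr0 // tofracM.
  by rewrite /jschur [cst (_^-1 * _)]rmorphM.
have Qx : Q (xget 0 Q) by apply: xgetPex; exists (jschur H E).
move: Qx Qs => [p Hp] [p' Hp']; apply: (@tofrac_v_inj _ _ p p').
have vn : v ^ (- (2 * a z0)%N%:Z) != 0 by rewrite expfz_neq0.
by apply: (mulIf vn); rewrite !R3 -!expfzDr0 // -Hp -Hp'.
Qed.

End KModules.

(** * Primitive idempotents *)

(** In a full-rank factorization A = C R the relation A A = A cancels to R C = 1, an identity matrix
    of size rank A. *)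
Lemma mxtrace_idem (F : fieldType) n (A : 'M[F]_n) : A *m A = A -> \tr A = (\rank A)%:R.
Proof.
move=> AA; have RC : row_base A *m col_base A = 1%:M.
  apply: (row_full_inj (col_base_full A)); apply: (row_free_inj (row_base_free A)).
  by rewrite /= mulmx1 mulmxA mulmx_base -mulmxA mulmx_base.
by rewrite -{1}(mulmx_base A) mxtrace_mulC RC mxtrace1.
Qed.

Section Cell.
Variables (W : finGroupType) (S : {set W}) (L : W -> int) (H : hecke S L).
Hypothesis P : P1_15 H.
Implicit Types (x y z w : W).

(* The function a is constant along a chain inside a two-sided cell by (P4), so that
   (P9) and (P10) turn each step of <=_L or <=_R into one of ~_L or ~_R. *)
Lemma simLR_ind (Q : W -> Prop) y :
  (forall u w, simLR H u y -> simLR H w y -> simL H u w \/ simR H u w -> Q u -> Q w) ->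
  forall x, simLR H x y -> Q x -> Q y.
Proof.
move=> step x /andP[/connectP[p]]; elim: p x => [|x1 p IH] x /=; first by move=> _ ->.
case/andP=> xx1 px1 ly yx Qx.
have x1y : leLR H x1 y by apply/connectP; exists p.
have xle : leLR H x x1 by apply: connect1.
have yx1 : leLR H y x1 := connect_trans yx xle.
have xy : leLR H x y := connect_trans xle x1y.
apply: (IH x1 px1 ly yx1); apply: step Qx; [by apply/andP | by apply/andP |].
have ax : afun H x = afun H x1.
  by apply: (afun_simLR P); rewrite /simLR xle; apply: connect_trans x1y yx.
by case/orP: xx1 => [/(p9 P)|/(p10 P)] => /(_ ax); [left | right].
Qed.

End Cell.

Section Primitive.
Variables (R0 : realType) (W : finGroupType) (S : {set W}).
Variables (L : W -> int) (H : hecke S L) (Ev : lusztig_bijection R0 H).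
Variables (c : {set W}) (R : Cv R0 -> Prop).
Hypothesis cox : coxeter_system S.
Hypothesis P : P1_15 H.
Hypothesis cell : two_sided_cell H c.
Hypothesis adR : adapted Ev c R.
Local Notation C := R0[i].
Local Notation K := (Cv R0).
Local Notation D := (Dset H).
Local Notation cst := (@Cv_const R0).
Local Notation jmul := (@jmul _ _ _ H K).
Local Notation jt := (@jt W K).
Local Notation jD := (jD H K).
Local Notation tc := (jtc H K c).
Local Notation dd := (dd H).
Implicit Types (x y z u w d : W) (f g e : {ffun W -> K}).

Lemma sub1R : R 1. Proof. by have [[]] := adR. Qed.
Lemma subBR (x y : K) : R x -> R y -> R (x - y).
Proof. by have [[_ subR _] _ _] := adR; apply: subR. Qed.
Lemma subMR (x y : K) : R x -> R y -> R (x * y).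
Proof. by have [[_ _ mulR] _ _] := adR; apply: mulR. Qed.

Lemma sub0R : R 0. Proof. by rewrite -(subrr 1); apply: subBR sub1R sub1R. Qed.

Lemma subDR (x y : K) : R x -> R y -> R (x + y).
Proof.
by move=> Rx Ry; rewrite -[y]opprK -[- y]sub0r; apply: subBR => //; apply: subBR sub0R Ry.
Qed.

Lemma subZR (k : int) : R k%:~R.
Proof.
have nat (n : nat) : R n%:R.
  by elim: n => [|n IH]; [exact: sub0R | rewrite -addn1 natrD; apply: subDR IH sub1R].
case: k => n; first exact: nat.
by rewrite NegzE mulrNz -[- _]sub0r; apply: subBR sub0R (nat _).
Qed.

Lemma subR_sum (I : Type) (r : seq I) (Q : pred I) (F : I -> K) :
  (forall i, Q i -> R (F i)) -> R (\sum_(i <- r | Q i) F i).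
Proof. by move=> HF; elim/big_ind: _ => //; [exact: sub0R | exact: subDR]. Qed.

Lemma jsub_mul f g : jsub R f -> jsub R g -> jsub R (jmul f g).
Proof.
move=> Rf Rg u; rewrite ffunE; apply: subR_sum => x _; apply: subR_sum => y _.
by apply: subMR (subZR _); apply: subMR.
Qed.

Lemma jsub_jD Q : jsub R (jD Q).
Proof. by move=> z; rewrite ffunE; case: ifP => _; [apply: subZR | apply: sub0R]. Qed.

Lemma jsub_jt z : jsub R (jt z).
Proof. by move=> w; rewrite ffunE; apply: (subZR (w == z)). Qed.

Lemma jsub_tau f : jsub R f -> R (jtau H f).
Proof. by move=> Rf; apply: subR_sum => d _; apply: subMR (subZR _) _. Qed.

Lemma cellP x y : simLR H x y -> (x \in c) = (y \in c).
Proof.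
have [w ->] := cell; rewrite !inE => xy.
by apply/idP/idP; apply: simLR_trans; rewrite // simLR_sym.
Qed.

Lemma cellV x : (x^-1%g \in c) = (x \in c).
Proof. by rewrite (cellP (p14 P x)). Qed.

Lemma cell_dd x : (dd x \in c) = (x \in c).
Proof. by apply/cellP/simL_LR/(dd_simL P). Qed.

Lemma dd_Dset x : dd x \in D. Proof. by have [] := ddP P x. Qed.

Lemma jmul_tcl f u : jmul tc f u = if u \in c then f u else 0.
Proof. by rewrite jtc_jD (jmul_jDl P) /= cell_dd cellV. Qed.

Lemma jmul_tcr f u : jmul f tc u = if u \in c then f u else 0.
Proof. by rewrite jtc_jD (jmul_jDr P) /= cell_dd. Qed.

Lemma jtau_K f (a : IrrW R0 W -> C) :
  (forall g : {ffun W -> C}, jtau H g = \sum_E a E * \tr (spade H E g)) ->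
  jtau H f = \sum_E cst (a E) * \tr (kspade H E f).
Proof.
move=> aP; have tau_jt z : jtau H (jt z) = cst (jtau H (Defs.jt C z)).
  rewrite /jtau rmorph_sum; apply: eq_bigr => d _.
  by rewrite !ffunE rmorphM /= rmorph_int rmorph_nat.
transitivity (\sum_z f z * jtau H (jt z)).
  rewrite /jtau; under [RHS]eq_bigr => z _ do rewrite mulr_sumr.
  rewrite exchange_big; apply: eq_bigr => d _ /=.
  rewrite (bigD1 d) //= ffunE eqxx mulr1 mulrC big1 ?addr0 // => z zd.
  by rewrite ffunE eq_sym (negPf zd) !mulr0.
under eq_bigr => z _ do rewrite tau_jt aP rmorph_sum mulr_sumr.
rewrite exchange_big; apply: eq_bigr => E _ /=.
rewrite /kspade raddf_sum mulr_sumr; apply: eq_bigr => z _ /=.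
by rewrite mxtraceZ trace_map_mx rmorphM mulrCA.
Qed.

Lemma jtau_idem f : jsub R f -> jmul f f = f -> jmul tc f = f ->
  exists k : int, [/\ jtau H f = k%:~R, 0 <= k & k = 0 -> f = 0].
Proof.
move=> Rf ff cf; have [a aP] := @jtau_trace R0 _ _ _ _ cox P.
have a_gt0 := jtau_coef_gt0 cox P aP; have a_f := jschur_inv cox P aP.
pose m E : nat := \rank (kspade H E f).
have trE E : \tr (kspade H E f) = (m E)%:R.
  by apply: mxtrace_idem; rewrite -(kspadeM cox P) ff.
(* Here f = t_c f is used: t_c acts as zero on the E outside Irr(W, c), which restricts the sum to
   the one in [adapted]. *)
have m0 E : ~~ IrrWc H c E -> m E = 0%N.
  move=> /negbNE/eqP E0; apply/eqP; rewrite mxrank_eq0 -cf (kspadeM cox P).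
  suff -> : kspade H E tc = 0 by rewrite mul0mx.
  rewrite -(map_mx0 cst) -E0 (spadeE cox P) map_mx_sum; apply: eq_bigr => z _.
  by rewrite map_mxZ !jtc_jD !ffunE; case: ifP => _; rewrite ?rmorph_int ?rmorph0.
have fEa E : (fE Ev E)^-1 = a E.
  rewrite (fEE cox P); have := a_f E; have [->|s0] := eqVneq (jschur H E) 0.
    by rewrite mulr0 => /eqP; rewrite eq_sym oner_eq0.
  by move=> E1; apply: (mulIf s0); rewrite E1 mulVf.
pose s : C := \sum_(E | IrrWc H c E) ((m E)%:Z)%:~R / fE Ev E.
have tau_s : jtau H f = cst s.
  rewrite (jtau_K f aP) rmorph_sum [RHS]big_mkcond; apply: eq_bigr => E _ /=.
  case: ifPn => [_|/m0 mE]; last by rewrite trE mE mulr0.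
  by rewrite rmorphM /= fEa rmorph_int trE mulrC.
have [_ _ /(_ (fun E => (m E)%:Z))] := adR; rewrite -/s -tau_s => /(_ (jsub_tau Rf)) [k sk].
have s_ge0 E : IrrWc H c E -> 0 <= ((m E)%:Z)%:~R / fE Ev E.
  by move=> _; rewrite fEa mulr_ge0 ?ler0z // ltW.
exists k; split; first by rewrite tau_s sk rmorph_int.
  by rewrite -(ler0z C) -sk; apply: sumr_ge0.
move=> k0; apply: (kspade_inj cox P) => E; apply/eqP; rewrite -mxrank_eq0 -/(m E).
have [cE|/m0 -> //] := boolP (IrrWc H c E).
move/eqP: sk; rewrite k0 psumr_eq0 // => /allP/(_ E (mem_index_enum E)).
by rewrite cE fEa mulf_eq0 (gt_eqF (a_gt0 E)) orbF intr_eq0.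
Qed.

Lemma intrK_inj (k : int) : k%:~R = 0 :> K -> k = 0.
Proof.
by move=> k0; apply/eqP; rewrite -(intr_eq0 C); apply/eqP/cst_inj; rewrite rmorph_int k0 rmorph0.
Qed.

Lemma jD_idem Q : jmul (jD Q) (jD Q) = jD Q.
Proof.
apply/ffunP => u; rewrite (jmul_jDl P) !ffunE.
have [uD /=|//] := boolP (u \in D); last by rewrite if_same.
by rewrite (Dset_inv P uD) (dd_D P uD); case: (Q u).
Qed.

Lemma jmul_jt_l z : jmul (jD (pred1 (dd z^-1%g))) (jt z) = jt z.
Proof.
apply/ffunP => u; rewrite (jmul_jDl P) ffunE /=.
by have [->|_] := eqVneq u z; [rewrite eqxx | rewrite if_same].
Qed.

Lemma jmul_jt_r z : jmul (jt z) (jD (pred1 (dd z))) = jt z.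
Proof.
apply/ffunP => u; rewrite (jmul_jDr P) ffunE /=.
by have [->|_] := eqVneq u z; [rewrite eqxx | rewrite if_same].
Qed.

Lemma nz_neq0 d : d \in D -> (nz H d)%:~R != 0 :> K.
Proof.
move=> dD; apply/eqP => /intrK_inj n0.
by have := nz_sq P dD; rewrite n0.
Qed.

Lemma jD_primitive d : d \in D :&: c ->
  primitive_idempotent H (jsub R) (jD (pred1 d)).
Proof.
case/setIP=> dD dc; split; [exact: jsub_jD | | exact: jD_idem |].
  move/(congr1 (fun f : {ffun W -> K} => f d)); rewrite !ffunE dD /= eqxx => /eqP.
  by rewrite (negPf (nz_neq0 dD)).
move=> e1 e2 R1 R2 e11 e22 e12 e21 eE.
(* Both summands satisfy e_i = n_d t_d e_i, so that t_c e_i = e_i and [jtau_idem] applies to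
   them. *)
have tcd g : jmul tc (jmul (jD (pred1 d)) g) = jmul (jD (pred1 d)) g.
  apply/ffunP => u; rewrite jmul_tcl (jmul_jDl P) /=; case: eqP => [du|_]; last by rewrite if_same.
  by rewrite -cellV -cell_dd du dc.
have c1 : jmul tc e1 = e1.
  have <- : jmul (jD (pred1 d)) e1 = e1 by rewrite eE jmulDl e11 e21 addr0.
  exact: tcd.
have c2 : jmul tc e2 = e2.
  have <- : jmul (jD (pred1 d)) e2 = e2 by rewrite eE jmulDl e22 e12 add0r.
  exact: tcd.
have [k1 [t1 k1_ge0 k10]] := jtau_idem R1 e11 c1.
have [k2 [t2 k2_ge0 k20]] := jtau_idem R2 e22 c2.
have : jtau H (jD (pred1 d)) = 1.
  rewrite /jtau (bigD1 d) //= ffunE dD /= eqxx -rmorphM /= (nz_sq P) // big1 ?addr0 //.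
  by move=> d' /andP[_ d'd]; rewrite ffunE /= (negPf d'd) andbF mulr0.
have -> : jtau H (jD (pred1 d)) = jtau H e1 + jtau H e2.
  rewrite eE /jtau -big_split; apply: eq_bigr => d' _.
  by rewrite ffunE mulrDr.
rewrite t1 t2 -rmorphD -[1]/(1%:~R) => /eqP; rewrite -subr_eq0 -rmorphB => /eqP/intrK_inj k12.
have [/k10|/k20] : k1 = 0 \/ k2 = 0 by lia.
  by left.
by right.
Qed.

Lemma tc_primitive : primitive_idempotent H (jcenter H (jsub R)) tc.
Proof.
have Rtc : jsub R tc by rewrite jtc_jD; apply: jsub_jD.
have tcC f : jmul tc f = jmul f tc.
  by apply/ffunP => u; rewrite jmul_tcl jmul_tcr.
have [w cw] := cell.
have wc : w \in c by rewrite cw inE simLR_refl.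
split; [by split | | by rewrite jtc_jD jD_idem |].
  move/(congr1 (fun f : {ffun W -> K} => f (dd w))); rewrite jtc_jD !ffunE dd_Dset /=.
  by rewrite cell_dd wc => /eqP; rewrite (negPf (nz_neq0 (dd_Dset w))).
move=> e1 e2 X1 X2 e11 e22 e12 e21 eE.
pose p d := jD (pred1 d).
(* As f and g are central, n_d t_d f and n_d t_d g are orthogonal idempotents of J_R with sum n_d
   t_d, which is primitive. *)
have block f g d : jcenter H (jsub R) f -> jcenter H (jsub R) g ->
    jmul f f = f -> jmul g g = g -> jmul f g = 0 -> jmul g f = 0 -> tc = f + g ->
    d \in D :&: c -> jmul (p d) f = 0 \/ jmul (p d) g = 0.
  move=> [Rf Cf] [Rg Cg] ff gg fg gf fgE dDc.
  have Rp : jsub R (p d) by apply: jsub_jD.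
  have comm h h' : jsub R h -> (forall f, jsub R f -> jmul h f = jmul f h) ->
      jmul (jmul (p d) h) (jmul (p d) h') = jmul (p d) (jmul h h').
    move=> Rh Ch; rewrite (jmulA cox P (jmul (p d) h)) -(jmulA cox P (p d) h (p d)) Ch //.
    by rewrite (jmulA cox P (p d) (p d) h) /p jD_idem -(jmulA cox P).
  have [_ _ _ prim] := jD_primitive dDc.
  apply: prim; rewrite ?comm ?ff ?gg ?fg ?gf ?jmul0r //; try exact: jsub_mul.
  rewrite -jmulDr -fgE; apply/ffunP => u; rewrite jmul_tcr ffunE /=.
  have [->|_] := eqVneq u d; last by rewrite andbF if_same.
  by have [_ ->] := finset.setIP dDc.
have main f g : jcenter H (jsub R) f -> jcenter H (jsub R) g ->
    jmul f f = f -> jmul g g = g -> jmul f g = 0 -> jmul g f = 0 -> tc = f + g ->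
    jmul (p (dd w)) f = 0 -> f = 0.
  move=> Xf Xg ff gg fg gf fgE pw.
  have [Rf Cf] := Xf.
  have ddc x : x \in c -> dd x \in D :&: c by move=> xc; rewrite finset.in_setI dd_Dset cell_dd.
  (* Otherwise p(dd z) g = 0 by [block]. Then t_z g = t_z p(dd z) g = 0 and t_z f = p(dd z^-1) f t_z
     = 0, so that t_z = t_z t_c = 0. *)
  have inv z : z \in c -> jmul (p (dd z^-1%g)) f = 0 -> jmul (p (dd z)) f = 0.
    move=> zc pf; have [//|pg] := block f g (dd z) Xf Xg ff gg fg gf fgE (ddc z zc).
    have : jmul (jt z) tc = jt z.
      by apply/ffunP => u; rewrite jmul_tcr ffunE; case: eqP => [->|_]; rewrite ?zc ?if_same.
    rewrite fgE jmulDr -{1}(jmul_jt_l z) -(jmulA cox P) -Cf; last exact: jsub_jt.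
    rewrite (jmulA cox P) pf jmul0l add0r -{1}(jmul_jt_r z) -(jmulA cox P) pg jmul0r.
    move/(congr1 (fun f : {ffun W -> K} => f z)); rewrite !ffunE eqxx => E1.
    by case/eqP: (oner_neq0 K); apply: esym.
  have all0 x : x \in c -> jmul (p (dd x)) f = 0.
    move=> xc; have xw : simLR H w x by rewrite simLR_sym; move: xc; rewrite cw inE.
    apply: (simLR_ind P (Q := fun x => jmul (p (dd x)) f = 0) _ xw pw) => u v ux vx uv pu.
    have uc : u \in c by rewrite (cellP ux).
    have vc : v \in c by rewrite (cellP vx).
    (* [dd] is constant on left cells. For u ~_R v it agrees on u^-1 and v^-1, so [inv] is applied
       twice: from u to u^-1, then from v^-1 to v. *)
    case: uv => [/(dd_congr P) <- //|/(dd_congr P) uv].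
    by apply: (inv _ vc); rewrite -uv; apply: (inv u^-1%g); rewrite ?cellV ?invgK.
  have -> : f = jmul tc f by rewrite fgE jmulDl ff gf addr0.
  rewrite /jtc jmul_suml big1 // => d dDc; have [dD dc] := setIP dDc.
  by rewrite (jt_jD _ dD); have := all0 d dc; rewrite (dd_D P dD).
have ddw : dd w \in D :&: c by rewrite finset.in_setI dd_Dset cell_dd.
have [p1|p2] := block e1 e2 (dd w) X1 X2 e11 e22 e12 e21 eE ddw.
  by left; apply: (main e1 e2).
by right; apply: (main e2 e1) => //; rewrite addrC.
Qed.

End Primitive.

Theorem theorem3p7 (R0 : realType) (W : finGroupType) (S : {set W})
    (L : W -> int) (H : hecke S L) (Ev : lusztig_bijection R0 H)
    (c : {set W}) (R : Cv R0 -> Prop) :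
  coxeter_system S -> weight_function S L -> (forall s, s \in S -> 0 < L s) ->
  P1_15 H -> two_sided_cell H c -> adapted Ev c R ->
  (forall d, d \in Dset H :&: c ->
     primitive_idempotent H (jsub R) (jt (Cv R0) d *~ nz H d)) /\
  primitive_idempotent H (jcenter H (jsub R)) (jtc H (Cv R0) c).
Proof.
move=> cox _ _ P cell adR; split; last exact: tc_primitive cox P cell adR.
move=> d dDc; have [dD _] := finset.setIP dDc.
by rewrite (jt_jD _ dD); apply: jD_primitive cox P cell adR _ dDc.
Qed.
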